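(* Let $1\le p<\infty$ and let $\varphi\colon\mathbb{D}\to\mathbb{D}$ be analytic, $C_\varphi\colon H^p\to H^p$, $C_\varphi f=f\circ\varphi$. (1) If $\overline{\varphi(\mathbb{D})}\subseteq\mathbb{D}$, then $\beta(C_\varphi)=\lim_{n\to\infty}[a_n(C_\varphi)]^{1/n}$ exists and equals $\exp\big(-1/\operatorname{Cap}[\varphi(\mathbb{D})]\big)$. (2) If $\|\varphi\|_\infty=1$, then $\beta(C_\varphi)=\lim_{n\to\infty}[a_n(C_\varphi)]^{1/n}$ exists and equals $1$.
   Context: $H^p$ is the Hardy space of the unit disk. Approximation numbers: $a_n(T)=\inf\{\|T-R\|:\operatorname{rank}R<n\}$. Green capacity: $g(z,w)=\log\left|\frac{1-\bar wz}{z-w}\right|$, $I(\mu)=\iint g\,d\mu\,d\mu$, $V(E)=\inf I(\mu)$ over probability measures supported by a compact subset of $E\subseteq\mathbb{D}$, $\operatorname{Cap}(E)=1/V(E)$. *)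

(* Defs.v *)
(* complex numbers are mathcomp-real-closed's R[i]
   over an abstract R : realType. *)
From HB Require Import structures.
From mathcomp Require Import all_boot all_order all_algebra.
From mathcomp Require Import all_classical all_reals all_analysis.
From mathcomp Require Import complex.
Import Order.TTheory GRing.Theory Num.Theory.

Set Implicit Arguments.
Unset Strict Implicit.
Unset Printing Implicit Defensive.

Local Open Scope classical_set_scope.
Local Open Scope ring_scope.

(* modulus of a complex number *)
Definition cabs {R : realType} (z : R[i]) : R := Normc.normc z.

(* the open unit disk D *)
Definition disk {R : realType} : set R[i] := [set z | cabs z < 1].

(* e^{it} *)
Definition cexpi {R : realType} (t : R) : R[i] := (cos t +i* sin t)%C.

(* f is analytic (complex differentiable at every point) on D *)
Definition holo_on_disk {R : realType} (f : R[i] -> R[i]) : Prop :=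
  forall z, cabs z < 1 -> exists l : R[i], forall e : R, 0 < e ->
    exists d : R, 0 < d /\ forall h : R[i], 0 < cabs h < d ->
      cabs (f (z + h) - f z - l * h) <= e * cabs h.

(* M_p(r,f)^p = (1/2pi) int_0^{2pi} |f(r e^{it})|^p dt *)
Definition Mp_pow {R : realType} (p r : R) (f : R[i] -> R[i]) : \bar R :=
  (((2 * pi)^-1)%:E *
   \int[@lebesgue_measure R]_(t in `[0%R, (2 * pi)%R]%classic)
      ((cabs (f (r%:C%C * cexpi t))) `^ p)%:E)%E.

(* ||f||_{H^p} = sup_{0 <= r < 1} M_p(r,f) *)
Definition hp_norm {R : realType} (p : R) (f : R[i] -> R[i]) : \bar R :=
  ereal_sup [set poweR (Mp_pow p r f) p^-1 | r in [set r : R | 0 <= r < 1]].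

(* membership in the Hardy space H^p (functions are only looked at on D) *)
Definition hardy {R : realType} (p : R) (f : R[i] -> R[i]) : Prop :=
  holo_on_disk f /\ (hp_norm p f < +oo)%E.

(* operator norm of T - S on H^p *)
Definition opnorm_diff {R : realType} (p : R)
  (T S : (R[i] -> R[i]) -> (R[i] -> R[i])) : \bar R :=
  ereal_sup [set hp_norm p (fun z => T f z - S f z)
            | f in [set f | hardy p f /\ (hp_norm p f <= 1)%E]].

(* S is a linear operator on H^p with rank S < n *)
Definition linear_rank_lt {R : realType} (p : R)
  (S : (R[i] -> R[i]) -> (R[i] -> R[i])) (n : nat) : Prop :=
  (forall f, hardy p f -> hardy p (S f)) /\
  (forall (a : R[i]) f g, hardy p f -> hardy p g ->
     forall z, cabs z < 1 -> S (fun w => a * f w + g w) z = a * S f z + S g z) /\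
  exists m : nat, (m < n)%N /\
    exists gs : 'I_m -> (R[i] -> R[i]), (forall i, hardy p (gs i)) /\
      forall f, hardy p f -> exists c : 'I_m -> R[i],
        forall z, cabs z < 1 -> S f z = \sum_(i < m) c i * gs i z.

(* approximation numbers a_n(T) = inf { ||T - S|| : rank S < n } *)
Definition approx_num {R : realType} (p : R)
  (T : (R[i] -> R[i]) -> (R[i] -> R[i])) (n : nat) : \bar R :=
  ereal_inf [set opnorm_diff p T S | S in [set S | linear_rank_lt p S n]].

(* composition operator C_phi f = f o phi *)
Definition compo {R : realType} (phi : R[i] -> R[i]) (f : R[i] -> R[i]) :
  R[i] -> R[i] := fun z => f (phi z).

(* closure of a subset of C *)
Definition cclosure {R : realType} (A : set R[i]) : set R[i] :=
  [set w | forall e : R, 0 < e -> exists2 a, A a & cabs (w - a) < e].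

(* ||phi||_oo = sup_D |phi| *)
Definition supnorm_disk {R : realType} (phi : R[i] -> R[i]) : \bar R :=
  ereal_sup [set (cabs (phi z))%:E | z in disk].

(* Green capacity; C is identified with R x R (Borel sigma-algebra) *)
Definition toC {R : realType} (u : R * R) : R[i] := (u.1 +i* u.2)%C.

Definition green {R : realType} (z w : R[i]) : \bar R :=
  if z == w then +oo%E
  else (ln (cabs (1 - (w^*)%C * z) / cabs (z - w)))%:E.

Definition energy {R : realType} (mu : probability (R * R)%type R) : \bar R :=
  (\int[mu]_u \int[mu]_v green (toC u) (toC v))%E.

Definition green_V {R : realType} (E : set R[i]) : \bar R :=
  ereal_inf [set energy mu | mu in
    [set mu : probability (R * R)%type R |
      exists K : set (R^o * R^o), compact K /\ toC @` K `<=` E /\ mu K = 1%E]].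

Definition green_cap {R : realType} (E : set R[i]) : \bar R := ((green_V E)^-1)%E.

(* Main.v *)
Require Import Defs.
From HB Require Import structures.
From mathcomp Require Import all_boot all_order all_algebra.
From mathcomp Require Import all_classical all_reals all_analysis measurable_realfun.
From mathcomp Require Import complex ring lra zify.
Import Order.TTheory GRing.Theory Num.Theory.
Import numFieldNormedType.Exports.

Set Implicit Arguments.
Unset Strict Implicit.
Unset Printing Implicit Defensive.

Local Open Scope classical_set_scope.
Local Open Scope ring_scope.

(* Let [rho] be the pseudo-hyperbolic distance, so that the Green function is
   [- ln rho], and let [D n] be the supremum of the products of [rho] over all
   pairs of [n] points of [phi @` disk].

   Both bounds on [a n] are governed by the ratios [D n.+1 / D n].  Interpolating
   [f] at [n] almost extremal points (in the Takenaka-Malmquist basis, which needs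
   only Cauchy's formula and hence works for every [p]) leaves an error controlled
   by a Blaschke product that is at most [2 * D n.+1 / D n] on the image.
   Conversely, dropping one point among [n.+1] almost extremal ones gives bounded
   Lagrange functions, on whose span no operator of rank at most [n] can
   approximate the composition operator better than about [D n.+1 / D n].

   It remains to show [- ln (D n) = n ^+ 2 * V / 2 + o(n ^+ 2)] for the minimal
   energy [V].  A measure of energy below [I] yields points whose energy is at
   most ['C(n, 2) * I], by choosing them one by one below the mean.  Conversely
   [n] points yield a measure of almost the same energy by smearing each of them
   along a short curve of the image, which exists because a nonconstant image is
   connected and has more than one point.  When [phi] has sup-norm 1 one can
   choose points with pairwise distances close to 1, so [V = 0]; the upper bound
   by 1 is then Littlewood's subordination principle.  For constant [phi], [V] is
   infinite and the operator has rank one. *)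

(** * Modulus and complex differentiability *)

(** Control of [D n] up to exp(o(n^2)) says nothing about a single ratio [D n.+1 / D n]. It only
    shows that some index comparable to [N] has a ratio close to exp(- N V), up to a small
    exponential rate. This suffices because [a n] is nonincreasing: the lower bound takes such an
    index from [N] on, the upper bound one below [N]. Each estimate also loses a factor that has to
    be of small exponential rate. In the upper one the Blaschke product in the denominator is taken
    on a circle of radius s < 1, where it is only at least q^n; here q tends to 1 with s. In the
    lower one evaluation at x costs a factor 1 / (1 - |x|), so all points come from the image of a
    disk of radius r < 1 fixed before n, and the energy lost by this vanishes as r tends to 1. The
    lower estimate serves both cases of the theorem. The upper one belongs to the first case, where
    the circle can enclose the image. *)

Section Modulus.
Variable R : realType.
Implicit Types z w : R[i].

Lemma cabsE z : cabs z = Num.sqrt (complex.Re z ^+ 2 + complex.Im z ^+ 2).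
Proof. by case: z. Qed.

Lemma sqr_cabs z : cabs z ^+ 2 = complex.Re z ^+ 2 + complex.Im z ^+ 2.
Proof. by rewrite cabsE sqr_sqrtr// addr_ge0// sqr_ge0. Qed.

Lemma cabs_ge0 z : 0 <= cabs z.
Proof. by rewrite cabsE sqrtr_ge0. Qed.

Lemma cabs0 : cabs (0 : R[i]) = 0.
Proof. exact: Normc.normc0. Qed.

Lemma cabs1 : cabs (1 : R[i]) = 1.
Proof. exact: Normc.normc1. Qed.

Lemma cabs0_eq0 z : cabs z = 0 -> z = 0.
Proof. exact: Normc.eq0_normc. Qed.

Lemma cabs_eq0 z : (cabs z == 0) = (z == 0).
Proof. by apply/eqP/eqP => [/cabs0_eq0//|->]; rewrite cabs0. Qed.

Lemma cabs_gt0 z : (0 < cabs z) = (z != 0).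
Proof. by rewrite lt_def cabs_ge0 andbT cabs_eq0. Qed.

Lemma cabsM z w : cabs (z * w) = cabs z * cabs w.
Proof. exact: Normc.normcM. Qed.

Lemma cabsV z : cabs z^-1 = (cabs z)^-1.
Proof. exact: Normc.normcV. Qed.

Lemma cabs_div z w : cabs (z / w) = cabs z / cabs w.
Proof. by rewrite cabsM cabsV. Qed.

Lemma cabsN z : cabs (- z) = cabs z.
Proof. by rewrite !cabsE; case: z => a b /=; rewrite !sqrrN. Qed.

Lemma cabsBC z w : cabs (z - w) = cabs (w - z).
Proof. by rewrite -cabsN opprB. Qed.

Lemma cabsJ z : cabs (z^*)%C = cabs z.
Proof. by rewrite !cabsE; case: z => a b /=; rewrite sqrrN. Qed.

Lemma cabs_real (x : R) : cabs x%:C%C = `|x|.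
Proof. by rewrite cabsE/= expr0n/= addr0 sqrtr_sqr. Qed.

Lemma le_cabsD z w : cabs (z + w) <= cabs z + cabs w.
Proof. exact: le_normcD. Qed.

Lemma le_cabsB z w : cabs (z - w) <= cabs z + cabs w.
Proof. by rewrite -[cabs w]cabsN le_cabsD. Qed.

Lemma ge_cabsB z w : cabs z - cabs w <= cabs (z - w).
Proof. by rewrite lerBlDr -{1}[z](subrK w) le_cabsD. Qed.

Lemma le_Re_cabs z : `|complex.Re z| <= cabs z.
Proof.
rewrite cabsE -sqrtr_sqr ler_sqrt ?lerDl ?sqr_ge0//.
by rewrite addr_ge0// sqr_ge0.
Qed.

Lemma le_Im_cabs z : `|complex.Im z| <= cabs z.
Proof.
rewrite cabsE -sqrtr_sqr ler_sqrt ?lerDr ?sqr_ge0//.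
by rewrite addr_ge0// sqr_ge0.
Qed.

Lemma cabs_le_ReIm z : cabs z <= `|complex.Re z| + `|complex.Im z|.
Proof.
rewrite -(ler_pXn2r (ltn0Sn 1)) ?nnegrE ?addr_ge0 ?cabs_ge0// sqr_cabs sqrrD.
by rewrite !real_normK ?num_real// lerD2r lerDl mulrn_wge0// mulr_ge0.
Qed.

Lemma cabs_sum (I : Type) (r : seq I) (P : pred I) (F : I -> R[i]) :
  cabs (\sum_(i <- r | P i) F i) <= \sum_(i <- r | P i) cabs (F i).
Proof.
apply: (big_ind2 (fun a b => cabs a <= b)); rewrite ?cabs0// => a b c d ab cd.
by rewrite (le_trans (le_cabsD _ _))// lerD.
Qed.

Lemma cabs_prod (I : Type) (r : seq I) (P : pred I) (F : I -> R[i]) :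
  cabs (\prod_(i <- r | P i) F i) = \prod_(i <- r | P i) cabs (F i).
Proof. by apply: (big_morph _ cabsM cabs1). Qed.

Lemma mul_conjc z : z * (z^*)%C = (cabs z ^+ 2)%:C%C.
Proof.
by rewrite sqr_cabs; case: z => a b; apply/eqP; rewrite eq_complex/=;
  apply/andP; split; apply/eqP; ring.
Qed.

Lemma cabs_cexpi (t : R) : cabs (cexpi t) = 1.
Proof. by rewrite cabsE /= cos2Dsin2 sqrtr1. Qed.

Lemma cabs_circle (s t : R) : 0 <= s -> cabs (s%:C%C * cexpi t) = s.
Proof. by move=> s0; rewrite cabsM cabs_cexpi cabs_real mulr1 ger0_norm. Qed.

Lemma normCE z : `|z| = (cabs z)%:C%C.
Proof. by rewrite cabsE normc_def. Qed.

End Modulus.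

Section Holo.
Variable R : realType.
Let K : numFieldType := R[i].

(** In the partial order of [R[i]] every positive element is real, so that the radii of balls in [K]
    reduce to real ones. *)
Lemma pos_complexP (e : K) : 0 < e -> exists2 e' : R, 0 < e' & e = e'%:C%C.
Proof.
case: e => a b; rewrite ltcE/= => /andP[/eqP b0 a0]; exists a => //.
by rewrite b0.
Qed.

Lemma cvg_cabsP (T : Type) (F : set_system T) (FF : Filter F) (f : T -> K) (l : K) :
  f @ F --> l <-> forall e : R, 0 < e -> \forall x \near F, cabs (f x - l) < e.
Proof.
split=> [/cvgrPdistC_lt h e e0|h].
  have /h : 0 < (e%:C%C : K) by rewrite ltcR.
  by apply: filterS => x /=; rewrite normCE ltcR.
apply/cvgrPdistC_lt => e /pos_complexP[e' e0 ->].
by have := h _ e0; apply: filterS => x /=; rewrite normCE ltcR.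
Qed.

Lemma nbhs_cabsP (z : K) (P : set K) :
  nbhs z P <-> exists2 d : R, 0 < d & forall w, cabs (w - z) < d -> P w.
Proof.
split=> [/nbhs_ballP[e /= /pos_complexP[d d0 ->]] h|[d d0 h]].
  by exists d => // w wd; apply: h; rewrite -ball_normE/= distrC normCE ltcR.
apply/nbhs_ballP; exists (d%:C%C : K); rewrite /= ?ltcR// => w.
by rewrite -ball_normE/= distrC normCE ltcR; exact: h.
Qed.

Lemma dnbhs_cabsP (z : K) (P : set K) :
  z^' P <-> exists2 d : R, 0 < d & forall w, w != z -> cabs (w - z) < d -> P w.
Proof.
rewrite /dnbhs; split => [/nbhs_cabsP[d d0 h]|[d d0 h]].
  by exists d => // w wz wd; apply: h.
by apply/nbhs_cabsP; exists d => // w wd wz; apply: h.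
Qed.

(* A record rather than a definition: it stops unification from unfolding
   the topology of the complex numbers. *)
Record complex_derivable (f : R[i] -> R[i]) (z : R[i]) : Prop :=
  ComplexDerivable { complex_derivableW : derivable (f : K -> K) z 1 }.

Lemma complex_derivableP (f : R[i] -> R[i]) z : complex_derivable f z <->
  exists l : R[i], forall e : R, 0 < e ->
    exists d : R, 0 < d /\ forall h : R[i], 0 < cabs h < d ->
      cabs (f (z + h) - f z - l * h) <= e * cabs h.
Proof.
have E (l h : R[i]) : h != 0 ->
    cabs (h^-1 *: ((f \o shift z) (h *: (1 : K)) - f z) - l) * cabs h =
    cabs (f (z + h) - f z - l * h).
  move=> h0; rewrite -cabsM /= mulrBl; congr (cabs (_ - _)).
  rewrite /GRing.scale/= mulr1 [h + z]addrC mulrC mulrA.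
  by rewrite mulfV// mul1r.
split.
  move=> [/cvg_ex[l]]; rewrite cvg_cabsP => h; exists l => e e0.
  have /dnbhs_cabsP[d d0 hd] := h _ e0; exists d; split => // k /andP[k0 kd].
  rewrite -E -?cabs_gt0// ler_pM2r// ltW// hd ?subr0//.
  by rewrite -cabs_gt0.
case=> l h; split; apply/cvg_ex; exists l; apply/cvg_cabsP => e e0.
have e20 : 0 < e / 2 by rewrite divr_gt0.
have [d [d0 hd]] := h _ e20; apply/dnbhs_cabsP; exists d => // k k0.
rewrite subr0 => kd.
have ck : 0 < cabs k by rewrite cabs_gt0.
rewrite -(ltr_pM2r ck) E// (le_lt_trans (hd _ _)) ?ck//.
by rewrite ltr_pM2r// ltr_pdivrMr// ltr_pMr// ltr1n.
Qed.

Definition holo_in (q : R) (f : R[i] -> R[i]) :=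
  forall z, cabs z < q -> complex_derivable f z.

Lemma holo_on_diskP (f : R[i] -> R[i]) : holo_on_disk f <-> holo_in 1 f.
Proof. by split => h z z1; apply/complex_derivableP; apply: h. Qed.

Lemma complex_derivable_cst c z : complex_derivable (fun=> c) z.
Proof. by split; exact: derivable_cst. Qed.

Lemma complex_derivable_id z : complex_derivable id z.
Proof. by split; exact: derivable_id. Qed.

Lemma complex_derivableD f g z : complex_derivable f z ->
  complex_derivable g z -> complex_derivable (fun x => f x + g x) z.
Proof. by move=> [df] [dg]; split; exact: derivableD. Qed.

Lemma complex_derivableB f g z : complex_derivable f z ->
  complex_derivable g z -> complex_derivable (fun x => f x - g x) z.
Proof. by move=> [df] [dg]; split; exact: derivableB. Qed.

Lemma complex_derivableM f g z : complex_derivable f z ->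
  complex_derivable g z -> complex_derivable (fun x => f x * g x) z.
Proof. by move=> [df] [dg]; split; exact: derivableM. Qed.

Lemma complex_derivableV f z : f z != 0 -> complex_derivable f z ->
  complex_derivable (fun x => (f x)^-1) z.
Proof. by move=> f0 [df]; split; exact: derivableV. Qed.

Lemma complex_derivable_comp f g z : complex_derivable g z ->
  complex_derivable f (g z) -> complex_derivable (fun x => f (g x)) z.
Proof.
move=> [/derivable1_diffP dg] [/derivable1_diffP df]; split; apply/derivable1_diffP.
exact: (differentiable_comp dg df).
Qed.

Lemma complex_derivable_sum (I : Type) (r : seq I) (P : pred I)
    (F : I -> R[i] -> R[i]) z :
  (forall i, P i -> complex_derivable (F i) z) ->
  complex_derivable (fun x => \sum_(i <- r | P i) F i x) z.
Proof.
move=> h; elim: r => [|i r ih].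
  under eq_fun do rewrite big_nil.
  exact: complex_derivable_cst.
under eq_fun do rewrite big_cons.
case Pi : (P i); last exact: ih.
by apply: complex_derivableD ih; exact: h.
Qed.

Lemma complex_derivable_prod (I : Type) (r : seq I) (P : pred I)
    (F : I -> R[i] -> R[i]) z :
  (forall i, P i -> complex_derivable (F i) z) ->
  complex_derivable (fun x => \prod_(i <- r | P i) F i x) z.
Proof.
move=> h; elim: r => [|i r ih].
  under eq_fun do rewrite big_nil.
  exact: complex_derivable_cst.
under eq_fun do rewrite big_cons.
case Pi : (P i); last exact: ih.
by apply: complex_derivableM ih; exact: h.
Qed.

Lemma complex_derivable_continuous (f : K -> K) z : complex_derivable f z ->
  {for z, continuous f}.
Proof. by move=> [/derivable1_diffP/differentiable_continuous]. Qed.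

Lemma continuous_Re : continuous (@complex.Re R : K -> R).
Proof.
move=> z; apply/(@cvgrPdistC_lt _ _ _ (nbhs z)) => e e0; apply/nbhs_cabsP; exists e => // w.
by apply: le_lt_trans; have := le_Re_cabs (w - z); case: w z => a b [].
Qed.

Lemma continuous_Im : continuous (@complex.Im R : K -> R).
Proof.
move=> z; apply/(@cvgrPdistC_lt _ _ _ (nbhs z)) => e e0; apply/nbhs_cabsP; exists e => // w.
by apply: le_lt_trans; have := le_Im_cabs (w - z); case: w z => a b [].
Qed.

Lemma cvg_complex (T : Type) (F : set_system T) (FF : Filter F) (f g : T -> R) (a b : R) :
  f @ F --> a -> g @ F --> b ->
  (fun x => (f x +i* g x)%C : K) @ F --> ((a +i* b)%C : K).
Proof.
move=> /cvgrPdistC_lt fa /cvgrPdistC_lt gb; apply/cvg_cabsP => e e0.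
have e20 : 0 < e / 2 by rewrite divr_gt0.
have ha := fa _ e20; have hb := gb _ e20.
near=> x; rewrite (le_lt_trans (cabs_le_ReIm _))//= [e]splitr ltrD//.
- by near: x.
- by near: x.
Unshelve. all: by end_near. Qed.

Lemma continuous_cexpi : continuous (@cexpi R : R -> K).
Proof.
by move=> t; apply: cvg_complex; [exact: continuous_cos|exact: continuous_sin].
Qed.

Lemma continuous_cabs : continuous (@cabs R : K -> R).
Proof.
move=> z; apply/(@cvgrPdistC_lt _ _ _ (nbhs z)) => e e0; apply/nbhs_cabsP; exists e => // w.
apply: le_lt_trans; rewrite ler_norml ge_cabsB andbT lerNl opprB cabsBC.
exact: ge_cabsB.
Qed.

End Holo.

(** * Cauchy's formula *)

Section ComplexIntegral.
Variable R : realType.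
Let K : numFieldType := R[i].
Local Notation mu := (@lebesgue_measure R).

(** Continuity is two-sided even at the endpoints: every integrand is the restriction of a function
    on the line, and pointwise continuity composes directly. *)
Record ccont (a b : R) (f : R -> R[i]) : Prop := CCont { ccontW :
  forall t, a <= t <= b -> {for t, continuous (f : R -> K)} }.

Definition rcont (a b : R) (f : R -> R) :=
  forall t, a <= t <= b -> {for t, continuous f}.

Lemma rcont_integrable a b f : rcont a b f -> mu.-integrable `[a, b] (EFin \o f).
Proof.
move=> h; apply: continuous_compact_integrable; first exact: segment_compact.
apply: continuous_in_subspaceT => x; rewrite inE/= in_itv/=; exact: h.
Qed.

Lemma ccont_Re a b f : ccont a b f -> rcont a b (fun t => complex.Re (f t)).
Proof.
by move=> [h] t tab; apply: (continuous_comp (h _ tab)); exact: continuous_Re.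
Qed.

Lemma ccont_Im a b f : ccont a b f -> rcont a b (fun t => complex.Im (f t)).
Proof.
by move=> [h] t tab; apply: (continuous_comp (h _ tab)); exact: continuous_Im.
Qed.

Lemma ccont_cabs a b f : ccont a b f -> rcont a b (fun t => cabs (f t)).
Proof.
by move=> [h] t tab; apply: (continuous_comp (h _ tab)); exact: continuous_cabs.
Qed.

Lemma ccont_cst a b c : ccont a b (fun=> c).
Proof. by split=> t _; exact: cvg_cst. Qed.

Lemma ccontD a b f g : ccont a b f -> ccont a b g -> ccont a b (fun t => f t + g t).
Proof. by move=> [hf] [hg]; split=> t tab; apply: cvgD; [exact: hf|exact: hg]. Qed.

Lemma ccontB a b f g : ccont a b f -> ccont a b g -> ccont a b (fun t => f t - g t).
Proof. by move=> [hf] [hg]; split=> t tab; apply: cvgB; [exact: hf|exact: hg]. Qed.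

Lemma ccontM a b f g : ccont a b f -> ccont a b g -> ccont a b (fun t => f t * g t).
Proof.
by move=> [hf] [hg]; split=> t tab; apply: (@cvgM K); [exact: hf|exact: hg].
Qed.

Lemma ccontV a b f : (forall t, a <= t <= b -> f t != 0) -> ccont a b f ->
  ccont a b (fun t => (f t)^-1).
Proof.
by move=> f0 [hf]; split=> t tab; apply: (@cvgV K); [exact: f0|exact: hf].
Qed.

Lemma ccont_cexpi a b : ccont a b (@cexpi R).
Proof. by split=> t _; exact: continuous_cexpi. Qed.

Lemma ccont_real a b : ccont a b (fun t : R => t%:C%C).
Proof. by split=> t _; apply: cvg_complex; [exact: cvg_id|exact: cvg_cst]. Qed.

Definition cint (a b : R) (f : R -> R[i]) : R[i] :=
  (\int[mu]_(t in `[a, b]) complex.Re (f t) +i*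
   \int[mu]_(t in `[a, b]) complex.Im (f t))%C.

Lemma eq_cint a b f g : (forall t, a <= t <= b -> f t = g t) ->
  cint a b f = cint a b g.
Proof.
move=> fg; rewrite /cint; congr (_ +i* _)%C; apply: eq_Rintegral => t;
by rewrite inE/= in_itv/= => /fg ->.
Qed.

Lemma cintD a b f g : ccont a b f -> ccont a b g ->
  cint a b (fun t => f t + g t) = cint a b f + cint a b g.
Proof.
move=> hf hg; apply/eqP; rewrite eq_complex /=; apply/andP; split; apply/eqP;
  rewrite -RintegralD//=;
  try exact/rcont_integrable/ccont_Re; try exact/rcont_integrable/ccont_Im;
  by apply: eq_Rintegral => t _; case: (f t) (g t) => ? ? [].
Qed.

Lemma cintZ a b c f : ccont a b f ->
  cint a b (fun t => c * f t) = c * cint a b f.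
Proof.
move=> hf; have hr := rcont_integrable (ccont_Re hf).
have hi := rcont_integrable (ccont_Im hf).
have zr (k : R) g : mu.-integrable `[a, b] (EFin \o g) ->
    mu.-integrable `[a, b] (EFin \o (fun t => k * g t)).
  by move=> hg; have := @integrableZl _ _ _ mu _ (measurable_itv _) k _ hg.
case: c => c d; apply/eqP; rewrite eq_complex /=; apply/andP; split; apply/eqP.
  rewrite -!RintegralZl// -RintegralB//=; [|exact: zr|exact: zr].
  by apply: eq_Rintegral => t _; case: (f t).
rewrite -!RintegralZl// -RintegralD//=; [|exact: zr|exact: zr].
by apply: eq_Rintegral => t _; case: (f t).
Qed.

Lemma cintB a b f g : ccont a b f -> ccont a b g ->
  cint a b (fun t => f t - g t) = cint a b f - cint a b g.
Proof.
move=> hf hg; rewrite -[- cint a b g]mulN1r -cintZ// -cintD//; last first.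
  by apply: ccontM => //; exact: ccont_cst.
by apply: eq_cint => t _; rewrite mulN1r.
Qed.

Lemma Rintegral_itv_cst (a b k : R) : a <= b -> \int[mu]_(t in `[a, b]) k = k * (b - a).
Proof.
move=> ab; rewrite Rintegral_cst//= lebesgue_measure_itv/= lte_fin.
by case: ltgtP ab => //= -> _; rewrite subrr.
Qed.

Lemma cint_cst a b k : a <= b -> cint a b (fun=> k) = k * (b - a)%:C%C.
Proof.
move=> ab; rewrite /cint !Rintegral_itv_cst//; case: k => k l.
by apply/eqP; rewrite eq_complex/=; apply/andP; split; apply/eqP; ring.
Qed.

Lemma Rintegral_itv_cat a c b f : rcont a b f -> a <= c <= b ->
  \int[mu]_(t in `[a, b]) f t =
  \int[mu]_(t in `[a, c]) f t + \int[mu]_(t in `[c, b]) f t.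
Proof.
move=> hf /andP[ac cb].
have := @Rintegral_itvB R f (BLeft a) (BRight b) c (rcont_integrable hf).
rewrite !bnd_simp => /(_ ac cb).
rewrite (@Rintegral_itv_obnd_cbnd _ c (BRight b)).
  by move=> <-; rewrite addrC subrK.
apply: (integrableS _ _ _ (rcont_integrable hf)) => //.
by apply: subset_itvr; rewrite bnd_simp.
Qed.

Lemma cint_cat a c b f : ccont a b f -> a <= c <= b ->
  cint a b f = cint a c f + cint c b f.
Proof.
move=> hf acb; rewrite /cint (Rintegral_itv_cat (ccont_Re hf) acb).
by rewrite (Rintegral_itv_cat (ccont_Im hf) acb).
Qed.

(* Rotating so that the integral becomes a nonnegative real reduces the
   triangle inequality to that of real integrals. *)
Lemma cabs_cint a b f : ccont a b f ->
  cabs (cint a b f) <= \int[mu]_(t in `[a, b]) cabs (f t).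
Proof.
move=> hf; set I := cint a b f.
have [I0|I0] := eqVneq I 0.
  by rewrite I0 cabs0; apply: Rintegral_ge0 => *; exact: cabs_ge0.
have cI : 0 < cabs I by rewrite cabs_gt0.
pose u := (I^*)%C / (cabs I)%:C%C.
have cu : cabs u = 1.
  by rewrite cabs_div cabsJ cabs_real ger0_norm ?cabs_ge0// divff// gt_eqF.
have uI : cint a b (fun t => u * f t) = (cabs I)%:C%C.
  rewrite cintZ// -/I /u mulrAC [_ * I]mulrC mul_conjc expr2 rmorphM/=.
  by rewrite mulfK// -cabs_eq0 cabs_real ger0_norm ?cabs_ge0// gt_eqF.
have -> : cabs I = \int[mu]_(t in `[a, b]) complex.Re (u * f t).
  by have := congr1 (@complex.Re R) uI.
have huf : ccont a b (fun t => u * f t) by apply: ccontM => //; exact: ccont_cst.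
apply: le_Rintegral => //.
- exact: rcont_integrable (ccont_Re huf).
- exact: rcont_integrable (ccont_cabs hf).
- move=> t _; rewrite (le_trans (ler_norm _))// (le_trans (le_Re_cabs _))//.
  by rewrite cabsM cu mul1r.
Qed.

Lemma cabs_cint_le a b f M : a <= b -> ccont a b f ->
  (forall t, a <= t <= b -> cabs (f t) <= M) -> cabs (cint a b f) <= M * (b - a).
Proof.
move=> ab hf hM; rewrite (le_trans (cabs_cint hf))// -Rintegral_itv_cst//.
apply: le_Rintegral => //.
- exact: rcont_integrable (ccont_cabs hf).
- by apply: rcont_integrable => t _; exact: cvg_cst.
Qed.

(** The one explicit primitive used: it makes [cexpi] Lipschitz and evaluates the affine part of the
    homotopy integral. *)
Lemma cint_cexpi a b : a <= b ->
  cint a b (fun t => 'i%C * cexpi t) = cexpi b - cexpi a.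
Proof.
rewrite le_eqVlt => /predU1P[->|ab].
  rewrite subrr /cint; apply/eqP; rewrite eq_complex /=.
  by rewrite set_itv1 !Rintegral_set1 eqxx.
have FTC (F f : R -> R) : (forall x : R, is_derive x 1 F (f x)) -> continuous f ->
    \int[mu]_(t in `[a, b]) f t = F b - F a.
  move=> dF cf; rewrite /Rintegral (@continuous_FTC2 _ f F)//.
  - exact: continuous_subspaceT.
  - split.
    + by move=> x _; have [] := dF x.
    + apply: cvg_at_right_filter; apply: differentiable_continuous.
      by apply/derivable1_diffP; have [] := dF a.
    + apply: cvg_at_left_filter; apply: differentiable_continuous.
      by apply/derivable1_diffP; have [] := dF b.
  - by move=> x _; rewrite derive1E; have [] := dF x.
apply/eqP; rewrite eq_complex /=; apply/andP; split; apply/eqP.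
  rewrite -(FTC cos (fun x => - sin x)).
  - by apply: eq_Rintegral => t _; ring.
  - by move=> x; apply: cvgN; exact: continuous_sin.
rewrite -(FTC sin cos).
- by apply: eq_Rintegral => t _; ring.
- exact: continuous_cos.
Qed.

Lemma cabs_cexpiB a b : cabs (cexpi b - cexpi a : R[i]) <= `|b - a|.
Proof.
wlog ab : a b / a <= b.
  move=> h; have [/h//|/ltW ba] := leP a b.
  by rewrite cabsBC distrC h.
rewrite -cint_cexpi// (le_trans (@cabs_cint_le _ _ _ 1 ab _ _))//.
- by apply: ccontM; [exact: ccont_cst|exact: ccont_cexpi].
- move=> t _; rewrite cabsM cabs_cexpi mulr1 cabsE/= expr0n/= expr1n add0r sqrtr1//.
- by rewrite mul1r ler_norm.
Qed.

End ComplexIntegral.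

(** * Goursat's bisection for additive functions of rectangles *)

Section Bisection.
Variables (R : realType) (J : R -> R -> R -> R -> R[i]) (a b c d : R).
Hypothesis ab : a < b.
Hypothesis cd : c < d.
Hypothesis Jx : forall x1 x x2 y1 y2, a <= x1 -> x1 <= x -> x <= x2 -> x2 <= b ->
  c <= y1 -> y1 <= y2 -> y2 <= d -> J x1 x2 y1 y2 = J x1 x y1 y2 + J x x2 y1 y2.
Hypothesis Jy : forall x1 x2 y1 y y2, a <= x1 -> x1 <= x2 -> x2 <= b ->
  c <= y1 -> y1 <= y -> y <= y2 -> y2 <= d -> J x1 x2 y1 y2 = J x1 x2 y1 y + J x1 x2 y y2.
(** [J] is o(area) on cells that contain the given point and are similar to the whole rectangle,
    with ratio [h]. *)
Hypothesis Jloc : forall x0 y0, a <= x0 <= b -> c <= y0 <= d -> forall e : R, 0 < e ->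
  exists2 r : R, 0 < r & forall x y h, 0 < h < r ->
    a <= x <= x0 -> x0 <= x + h * (b - a) <= b ->
    c <= y <= y0 -> y0 <= y + h * (d - c) <= d ->
    cabs (J x (x + h * (b - a)) y (y + h * (d - c))) <= e * h ^+ 2.

Let X := b - a.
Let Y := d - c.
Let cell (x y h : R) := cabs (J x (x + h * X) y (y + h * Y)).
Let big (e x y h : R) := e * h ^+ 2 < cell x y h.
Let inside (x y h : R) := [&& 0 < h, a <= x, x + h * X <= b, c <= y & y + h * Y <= d].

Let next (e : R) (h : R) (p : R * R) : R * R :=
  let h' := h / 2 in let x' := p.1 + h' * X in let y' := p.2 + h' * Y in
  if big e p.1 p.2 h' then p else if big e x' p.2 h' then (x', p.2)
  else if big e p.1 y' h' then (p.1, y') else (x', y').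

Let seqp (e : R) := fix seqp (n : nat) : R * R :=
  if n is m.+1 then next e (2^-1 ^+ m) (seqp m) else (a, c).

(** Pigeonhole: [next] takes the fourth quarter by default, and if that one were small as well,
    additivity would make the parent cell small. *)
Let bigP e x y h : inside x y h -> big e x y h ->
  let p := next e h (x, y) in
  [/\ inside p.1 p.2 (h / 2), big e p.1 p.2 (h / 2),
   x <= p.1 /\ p.1 + h / 2 * X <= x + h * X &
   y <= p.2 /\ p.2 + h / 2 * Y <= y + h * Y].
Proof.
move=> /and5P[h0 ax xb cy yd] hb.
have X0 : 0 < X by rewrite subr_gt0.
have Y0 : 0 < Y by rewrite subr_gt0.
have hX : 0 < h / 2 * X by rewrite mulr_gt0// divr_gt0.
have hY : 0 < h / 2 * Y by rewrite mulr_gt0// divr_gt0.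
have hh : 0 < h / 2 by rewrite divr_gt0.
have EX : x + h * X = x + h / 2 * X + h / 2 * X by field.
have EY : y + h * Y = y + h / 2 * Y + h / 2 * Y by field.
move: hX hY EX EY xb yd; rewrite /next /inside /=.
set h' := h / 2; set x' := x + h' * X; set y' := y + h' * Y => hX hY EX EY.
rewrite EX EY => xb yd.
have xx' : x < x' by rewrite /x' ltrDl.
have yy' : y < y' by rewrite /y' ltrDl.
have xx'' : x' < x' + h' * X by rewrite ltrDl.
have yy'' : y' < y' + h' * Y by rewrite ltrDl.
case: ifPn => b1 /=.
  by split => //; [apply/and5P; split => //; lra|split; lra|split; lra].
case: ifPn => b2 /=.
  by split => //; [apply/and5P; split => //; lra|split; lra|split; lra].
case: ifPn => b3 /=.
  by split => //; [apply/and5P; split => //; lra|split; lra|split; lra].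
split; [by apply/and5P; split => //; lra| |split; lra|split; lra].
move: hb b1 b2 b3; rewrite /big /cell EX EY -/x' -/y' -!leNgt => hb b1 b2 b3.
rewrite ltNge; apply/negP => b4; move: hb; rewrite ltNge => /negP; apply.
have ax' : a <= x' by rewrite (le_trans ax)// ltW.
have x'b : x' <= b by rewrite (le_trans _ xb)// ltW.
have cy' : c <= y' by rewrite (le_trans cy)// ltW.
have y'd : y' <= d by rewrite (le_trans _ yd)// ltW.
have Ex y1 y2 : c <= y1 -> y1 <= y2 -> y2 <= d ->
    J x (x' + h' * X) y1 y2 = J x x' y1 y2 + J x' (x' + h' * X) y1 y2.
  by move=> *; apply: Jx => //; exact: ltW.
have Ey x1 x2 : a <= x1 -> x1 <= x2 -> x2 <= b ->
    J x1 x2 y (y' + h' * Y) = J x1 x2 y y' + J x1 x2 y' (y' + h' * Y).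
  by move=> *; apply: Jy => //; exact: ltW.
rewrite Ex ?(ltW (lt_trans yy' yy''))// Ey ?(ltW xx')// Ey ?(ltW xx'')//.
rewrite [X in _ <= X](_ : _ = e * h' ^+ 2 + e * h' ^+ 2 + (e * h' ^+ 2 + e * h' ^+ 2));
  last by rewrite /h'; field.
rewrite (le_trans (le_cabsD _ _))// lerD// (le_trans (le_cabsD _ _))// lerD//.
Qed.

Lemma bisection_eq0 : J a b c d = 0.
Proof.
(* Half of the modulus, so that the whole rectangle, of scale 1, violates the bound strictly. *)
apply: contrapT => /eqP J0; pose e := cabs (J a b c d) / 2.
have cJ : 0 < cabs (J a b c d) by rewrite cabs_gt0.
have e0 : 0 < e by rewrite divr_gt0.
pose h n : R := 2^-1 ^+ n.
have h0 n : 0 < h n by rewrite exprn_gt0// invr_gt0.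
have X0 : 0 < X by rewrite subr_gt0.
have Y0 : 0 < Y by rewrite subr_gt0.
have inv n : inside (seqp e n).1 (seqp e n).2 (h n) /\
             big e (seqp e n).1 (seqp e n).2 (h n).
  elim: n => [|n [ih1 ih2]] /=.
    split; first by rewrite /inside /h expr0 !mul1r /X /Y !lexx ltr01/= !subrKC !lexx.
    rewrite /big /cell /h expr0 expr1n mulr1 !mul1r /X /Y !subrKC /e.
    by rewrite ltr_pdivrMr// ltr_pMr// ltr1n.
  have -> : h n.+1 = h n / 2 by rewrite /h exprSr.
  have := bigP ih1 ih2; rewrite -surjective_pairing => -[? ? _ _]//.
have mono n : [/\ (seqp e n).1 <= (seqp e n.+1).1,
    (seqp e n.+1).1 + h n.+1 * X <= (seqp e n).1 + h n * X,
    (seqp e n).2 <= (seqp e n.+1).2 &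
    (seqp e n.+1).2 + h n.+1 * Y <= (seqp e n).2 + h n * Y].
  have [i1 i2] := inv n; have := bigP i1 i2.
  rewrite -surjective_pairing => -[_ _ [? ?] [? ?]].
  have -> : h n.+1 = h n / 2 by rewrite /h exprSr.
  by split.
have nested (u v : nat -> R) : (forall n, u n <= v n) ->
    (forall n, u n <= u n.+1) -> (forall n, v n.+1 <= v n) ->
    exists z, forall n, u n <= z <= v n.
  move=> uv u_ v_.
  have um : {homo u : m n / (m <= n)%N >-> m <= n}.
    by apply/nondecreasing_seqP.
  have vm m n : (m <= n)%N -> v n <= v m.
    by move: m n; apply/nonincreasing_seqP.
  have uv' m n : u m <= v n.
    have [mn|/ltnW nm] := leqP m n; first exact: le_trans (um _ _ mn) _.
    exact: le_trans (uv _) (vm _ _ nm).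
  exists (sup [set u n | n in setT]) => n; apply/andP; split.
    apply: ub_le_sup; first by exists (v 0%N) => _ [m _ <-].
    by exists n.
  by apply: ge_sup; [exists (u 0%N); exists 0%N|move=> _ [m _ <-]].
have [x0 hx0] := nested (fun n => (seqp e n).1) (fun n => (seqp e n).1 + h n * X)
  (fun n => ltac:(rewrite lerDl mulr_ge0// ltW//)) (fun n => ltac:(by have [] := mono n))
  (fun n => ltac:(by have [] := mono n)).
have [y0 hy0] := nested (fun n => (seqp e n).2) (fun n => (seqp e n).2 + h n * Y)
  (fun n => ltac:(rewrite lerDl mulr_ge0// ltW//)) (fun n => ltac:(by have [] := mono n))
  (fun n => ltac:(by have [] := mono n)).
have [_] := inv 0%N; have [/and5P[_ ax xb cy yd] _] := inv 0%N => _.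
have x0ab : a <= x0 <= b.
  by have /andP[? ?] := hx0 0%N; rewrite (le_trans ax)//= (le_trans _ xb).
have y0cd : c <= y0 <= d.
  by have /andP[? ?] := hy0 0%N; rewrite (le_trans cy)//= (le_trans _ yd).
have [r r0 hr] := Jloc x0ab y0cd e0.
have [n hn] : exists n, h n < r.
  have /cvgrPdist_lt/(_ _ r0)[n _ /(_ n (leqnn n))] : h @ \oo --> (0 : R).
    by apply: cvg_expr; rewrite ger0_norm ?invr_ge0// invf_lt1// ltr1n.
  by rewrite sub0r normrN ger0_norm ?ltW// => ?; exists n.
have [/and5P[_ axn xbn cyn ydn]] := inv n.
rewrite /big ltNge => /negP; apply; apply: hr.
- by rewrite h0.
- by rewrite axn; have /andP[] := hx0 n.
- by rewrite xbn andbT; have /andP[] := hx0 n.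
- by rewrite cyn; have /andP[] := hy0 n.
- by rewrite ydn andbT; have /andP[] := hy0 n.
Qed.

End Bisection.

(** * Contracting a circle to a point inside it *)

Section CauchyHomotopy.
Variables (R : realType) (s : R) (w : R[i]).
Hypothesis ws : cabs w < s.
Let K : numFieldType := R[i].

Let s0 : 0 < s. Proof. exact: le_lt_trans (cabs_ge0 _) ws. Qed.

Let zeta (t : R) : R[i] := s%:C%C * cexpi t.
(** The logarithmic derivative of [zeta - w]: along [Phi] the form dz / (z - w) pulls back to dl / l
    + [kap] dt. *)
Let kap (t : R) : R[i] := 'i%C * zeta t / (zeta t - w).
Let Phi (l t : R) : R[i] := w + l%:C%C * (zeta t - w).
Let L := s - cabs w.

Let L0 : 0 < L. Proof. by rewrite subr_gt0. Qed.

Let cabs_zeta t : cabs (zeta t) = s.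
Proof. exact: cabs_circle (ltW s0). Qed.

Let zetaw t : L <= cabs (zeta t - w).
Proof. by rewrite (le_trans _ (ge_cabsB _ _))// cabs_zeta. Qed.

Let zetaw_neq0 t : zeta t - w != 0.
Proof. by rewrite -cabs_gt0 (lt_le_trans L0). Qed.

Let zetaw_le t : cabs (zeta t - w) <= 2 * s.
Proof. by rewrite (le_trans (le_cabsB _ _))// cabs_zeta mulrDl !mul1r lerD2l ltW. Qed.

Let cabs_i : cabs ('i%C : R[i]) = 1.
Proof. by rewrite cabsE/= expr0n/= expr1n add0r sqrtr1. Qed.

Let kap_le t : cabs (kap t) <= s / L.
Proof.
rewrite cabs_div cabsM cabs_i mul1r cabs_zeta ler_pM2l// lef_pV2// posrE.
exact: lt_le_trans L0 _.
Qed.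

Let Phi_le l t : 0 <= l <= 1 -> cabs (Phi l t) <= s.
Proof.
move=> /andP[l0 l1]; rewrite /Phi.
have -> : w + l%:C%C * (zeta t - w) = (1 - l)%:C%C * w + l%:C%C * zeta t.
  by rewrite rmorphB/= rmorph1; ring.
rewrite (le_trans (le_cabsD _ _))// (cabsM _ w) (cabsM _ (zeta t)) !cabs_real.
rewrite cabs_zeta !ger0_norm ?subr_ge0//.
have : (1 - l) * cabs w <= (1 - l) * s by rewrite ler_wpM2l ?subr_ge0// ltW.
lra.
Qed.

Let ccont_zeta a b : ccont a b zeta.
Proof. by apply: ccontM; [exact: ccont_cst|exact: ccont_cexpi]. Qed.

Let ccont_kap a b : ccont a b kap.
Proof.
apply: ccontM.
  by apply: ccontM; [exact: ccont_cst|exact: ccont_zeta].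
apply: ccontV; first by move=> t _; exact: zetaw_neq0.
by apply: ccontB; [exact: ccont_zeta|exact: ccont_cst].
Qed.

Let ccont_Phi_t a b l : ccont a b (Phi l).
Proof.
apply: ccontD; first exact: ccont_cst.
apply: ccontM; first exact: ccont_cst.
by apply: ccontB; [exact: ccont_zeta|exact: ccont_cst].
Qed.

Let ccont_Phi_l a b t : ccont a b (Phi^~ t).
Proof.
apply: ccontD; first exact: ccont_cst.
by apply: ccontM; [exact: ccont_real|exact: ccont_cst].
Qed.

Record cont_ball (g : R[i] -> R[i]) : Prop := ContBall { cont_ballW :
  forall z, cabs z <= s -> {for z, continuous (g : K -> K)} }.

Let ccont_A g a b t : cont_ball g -> 0 < a -> b <= 1 ->
  ccont a b (fun l => g (Phi l t) / l%:C%C).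
Proof.
move=> [cg] a0 b1; apply: ccontM; last first.
  apply: ccontV; last exact: ccont_real.
  move=> l /andP[al _]; rewrite -cabs_eq0 cabs_real normr_eq0 gt_eqF//.
  exact: lt_le_trans al.
split=> l /andP[al lb]; have [cP] := ccont_Phi_l a b t.
apply: (@continuous_comp R K K); first by apply: cP; rewrite al.
by apply: cg; apply: Phi_le; rewrite (le_trans (ltW a0))//= (le_trans lb).
Qed.

Let ccont_B g a b l : cont_ball g -> 0 <= l <= 1 ->
  ccont a b (fun t => g (Phi l t) * kap t).
Proof.
move=> [cg] l01; apply: ccontM; last exact: ccont_kap.
split=> t tab; have [cP] := ccont_Phi_t a b l.
apply: (@continuous_comp R K K); first exact: cP.
by apply: cg; exact: Phi_le.
Qed.

(** The integral of g dz / (z - w), pulled back by [Phi], along the counterclockwise boundary of a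
    cell of the (l, t) plane. *)
Let J g x1 x2 y1 y2 : R[i] :=
  cint x1 x2 (fun l => g (Phi l y1) / l%:C%C - g (Phi l y2) / l%:C%C) +
  cint y1 y2 (fun t => g (Phi x2 t) * kap t - g (Phi x1 t) * kap t).

Let JD g1 g2 x1 x2 y1 y2 : 0 < x1 -> x1 <= x2 -> x2 <= 1 -> cont_ball g1 -> cont_ball g2 ->
  J (fun z => g1 z + g2 z) x1 x2 y1 y2 = J g1 x1 x2 y1 y2 + J g2 x1 x2 y1 y2.
Proof.
move=> x10 x12 x21 c1 c2.
have i1 : 0 <= x1 <= 1 by rewrite ltW//= (le_trans x12).
have i2 : 0 <= x2 <= 1 by rewrite x21 andbT (le_trans (ltW x10)).
rewrite /J addrACA -!cintD; first congr (_ + _).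
- by apply: eq_cint => t _; ring.
- by apply: eq_cint => t _; ring.
- by apply: ccontB; apply: ccont_B.
- by apply: ccontB; apply: ccont_B.
- by apply: ccontB; apply: ccont_A.
- by apply: ccontB; apply: ccont_A.
Qed.

(** The constant contributes equal terms on opposite sides, and on the linear part the form becomes
    [lam] dz, which is exact. *)
Let J_affine al lam x1 x2 y1 y2 : 0 < x1 -> x1 <= x2 -> y1 <= y2 ->
  J (fun z => al + lam * (z - w)) x1 x2 y1 y2 = 0.
Proof.
move=> x10 x12 y12; rewrite /J.
rewrite (@eq_cint _ x1 x2 _ (fun=> lam * (zeta y1 - zeta y2))); last first.
  move=> l /andP[xl _]; rewrite /Phi; field.
  by rewrite -cabs_eq0 cabs_real normr_eq0 gt_eqF// (lt_le_trans x10).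
rewrite cint_cst//.
rewrite (@eq_cint _ y1 y2 _ (fun t => lam * (x2 - x1)%:C%C * s%:C%C * ('i%C * cexpi t))).
  rewrite cintZ; first rewrite cint_cexpi//.
    by rewrite /zeta rmorphB/=; ring.
  by apply: ccontM; [exact: ccont_cst|exact: ccont_cexpi].
move=> t _; transitivity (lam * (x2 - x1)%:C%C * ('i%C * zeta t)); last by rewrite /zeta; ring.
rewrite /Phi /kap rmorphB/=; move: (zetaw_neq0 t); move: (zeta t) => z zw.
by field.
Qed.

Variables (q : R) (f : R[i] -> R[i]).
Hypothesis sq : s < q.
Hypothesis hf : holo_in q f.

Let cf : cont_ball f.
Proof.
split=> z zs; apply: complex_derivable_continuous; apply: hf.
exact: le_lt_trans sq.
Qed.

Let Phi_lip l t l' t' : 0 <= l <= 1 ->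
  cabs (Phi l t - Phi l' t') <= 2 * s * `|l - l'| + s * `|t - t'|.
Proof.
move=> /andP[l0 l1].
have -> : Phi l t - Phi l' t' =
   (l - l')%:C%C * (zeta t' - w) + l%:C%C * (s%:C%C * (cexpi t - cexpi t')).
  by rewrite /Phi /zeta rmorphB/=; ring.
rewrite (le_trans (le_cabsD _ _))// lerD// !cabsM !cabs_real.
  by rewrite mulrC ler_wpM2r.
rewrite (ger0_norm l0) (ger0_norm (ltW s0)).
have h : s * cabs (cexpi t - cexpi t' : R[i]) <= s * `|t - t'|.
  by rewrite ler_wpM2l ?(ltW s0)// cabs_cexpiB.
rewrite (le_trans _ h)// ler_piMl// mulr_ge0 ?cabs_ge0// ltW//.
Qed.

Let J_eq0 l0 b : 0 < l0 < 1 -> 0 < b -> J f l0 1 0 b = 0.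
Proof.
move=> /andP[l00 l01] b0; apply: bisection_eq0 => //.
- move=> x1 x x2 y1 y2 ax xx xx2 x2b cy yy yd.
  have x10 : 0 < x1 by apply: lt_le_trans ax.
  have x0 : 0 < x by apply: lt_le_trans xx.
  have x20 : 0 < x2 by apply: lt_le_trans xx2.
  have x1' : x <= 1 by apply: le_trans x2b.
  rewrite /J (@cint_cat _ x1 x x2) ?xx//; last by apply: ccontB; apply: ccont_A.
  have -> : cint y1 y2 (fun t => f (Phi x2 t) * kap t - f (Phi x1 t) * kap t) =
      cint y1 y2 (fun t => f (Phi x t) * kap t - f (Phi x1 t) * kap t) +
      cint y1 y2 (fun t => f (Phi x2 t) * kap t - f (Phi x t) * kap t).
    rewrite -cintD.
    - by apply: eq_cint => t _; ring.
    - by apply: ccontB; apply: ccont_B => //; apply/andP; split; lra.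
    - by apply: ccontB; apply: ccont_B => //; apply/andP; split; lra.
  by rewrite addrACA.
- move=> x1 x2 y1 y y2 ax xx2 x2b cy yy yy2 yd.
  have x10 : 0 < x1 by apply: lt_le_trans ax.
  rewrite /J (@cint_cat _ y1 y y2) ?yy//; last first.
    by apply: ccontB; apply: ccont_B => //; apply/andP; split; lra.
  have -> : cint x1 x2 (fun l => f (Phi l y1) / l%:C%C - f (Phi l y2) / l%:C%C) =
      cint x1 x2 (fun l => f (Phi l y1) / l%:C%C - f (Phi l y) / l%:C%C) +
      cint x1 x2 (fun l => f (Phi l y) / l%:C%C - f (Phi l y2) / l%:C%C).
    rewrite -cintD.
    - by apply: eq_cint => t _; ring.
    - by apply: ccontB; apply: ccont_A.
    - by apply: ccontB; apply: ccont_A.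
  by rewrite addrACA.
- move=> x0 y0 x0ab y0cd e e0.
  have x0i : 0 <= x0 <= 1.
    by move: x0ab => /andP[? ?]; apply/andP; split => //; lra.
  set X := 1 - l0; set Y := b - 0; set z0 := Phi x0 y0.
  have X0 : 0 < X by rewrite subr_gt0.
  have Y0 : 0 < Y by rewrite /Y subr0.
  have /complex_derivableP[l hl] : complex_derivable f z0.
    by apply: hf; apply: le_lt_trans sq; apply: Phi_le.
  pose C1 := 2 * s * X + s * Y.
  have C10 : 0 < C1 by rewrite addr_gt0// mulr_gt0// mulr_gt0.
  (* [C1 * h] bounds the diameter of the image of a cell of scale [h]; [2 / l0] and [2 * (s / L)]
     bound the weights dl / l and [kap] dt over each pair of opposite sides. Hence the Taylor error
     [e / M] gives [J] at most [e * h ^+ 2]. *)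
  pose M := C1 * (2 / l0) * X + C1 * (2 * (s / L)) * Y.
  have M0 : 0 < M by rewrite addr_gt0// !mulr_gt0// invr_gt0.
  have eM : 0 < e / M by rewrite divr_gt0.
  have [d [d0 hd]] := hl _ eM.
  exists (d / C1); first by rewrite divr_gt0.
  move=> x y h /andP[h0 hr] /andP[ax xx0] /andP[x0x xb] /andP[ay yy0] /andP[y0y yb].
  (* The first-order Taylor remainder at [z0], with the affine part written around [w] so that
     [J_affine] removes it. *)
  pose r z := f z - (f z0 - l * (z0 - w) + l * (z - w)).
  have ca z : complex_derivable (fun z => f z0 - l * (z0 - w) + l * (z - w)) z.
    apply: complex_derivableD; first exact: complex_derivable_cst.
    apply: complex_derivableM; first exact: complex_derivable_cst.
    by apply: complex_derivableB; [exact: complex_derivable_id|exact: complex_derivable_cst].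
  have cr : cont_ball r.
    split=> z zs; apply: complex_derivable_continuous; rewrite /r.
    by apply: complex_derivableB (ca z); apply: hf; exact: le_lt_trans sq.
  have {}ca : cont_ball (fun z => f z0 - l * (z0 - w) + l * (z - w)).
    by split=> z zs; apply: complex_derivable_continuous; exact: ca.
  have hX : 0 < h * X by rewrite mulr_gt0.
  have hY : 0 < h * Y by rewrite mulr_gt0.
  have x_gt0 : 0 < x by apply: lt_le_trans ax.
  have xle : x <= x + h * X by rewrite lerDl ltW.
  have yle : y <= y + h * Y by rewrite lerDl ltW.
  have -> : J f x (x + h * X) y (y + h * Y) = J r x (x + h * X) y (y + h * Y).
    rewrite -[RHS]addr0 -(J_affine (f z0 - l * (z0 - w)) l x_gt0 xle yle) -JD//.
    rewrite /J; congr (_ + _); apply: eq_cint => t _; rewrite /r; ring.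
  have rle l' t' : x <= l' <= x + h * X -> y <= t' <= y + h * Y ->
      cabs (r (Phi l' t')) <= e / M * (C1 * h).
    move=> /andP[xl lx] /andP[yt ty].
    have PP : cabs (Phi l' t' - z0) <= C1 * h.
      have l'01 : 0 <= l' <= 1 by apply/andP; split; lra.
      have s20 : 0 < 2 * s by rewrite mulr_gt0.
      rewrite (le_trans (Phi_lip _ _ _ l'01))// /C1 (mulrDl (2 * s * X)) -(mulrA (2 * s) X h) -(mulrA s Y h).
      rewrite lerD// ?ler_pM2l//.
        by rewrite [X * h]mulrC ler_norml; apply/andP; split; lra.
      by rewrite [Y * h]mulrC ler_norml; apply/andP; split; lra.
    have -> : r (Phi l' t') = f (z0 + (Phi l' t' - z0)) - f z0 - l * (Phi l' t' - z0).
      by rewrite subrKC /r; ring.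
    have [->|Pz] := eqVneq (Phi l' t' - z0) 0.
      rewrite addr0 mulr0 subr0 subrr cabs0 mulr_ge0// ?(ltW eM)//.
      by rewrite mulr_ge0// ltW.
    rewrite (le_trans (hd _ _))// ?ler_pM2l//.
    rewrite cabs_gt0 Pz (le_lt_trans PP)// mulrC -ltr_pdivlMr//.
  have -> : e * h ^+ 2 = e / M * (C1 * h) * (2 / l0) * (h * X) +
                         e / M * (C1 * h) * (2 * (s / L)) * (h * Y).
    transitivity (e / M * M * h ^+ 2); first by rewrite divfK// gt_eqF.
    by rewrite {2}/M; ring.
  have P0 : 0 <= e / M * (C1 * h).
    by rewrite mulr_ge0 ?(ltW eM)// mulr_ge0 ?ltW.
  rewrite /J (le_trans (le_cabsD _ _))// lerD//.
    rewrite (le_trans (@cabs_cint_le _ _ _ _ (e / M * (C1 * h) * (2 / l0)) _ _ _))//.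
    - by apply: ccontB; apply: ccont_A.
    - move=> l' l'x; rewrite -mulrBl cabs_div cabs_real.
      have l'0 : l0 <= l' by move: l'x => /andP[? _]; apply: le_trans ax _.
      have l'00 : 0 < l' by apply: lt_le_trans l'0.
      rewrite (gtr0_norm l'00) (_ : e / M * (C1 * h) * (2 / l0) = (e / M * (C1 * h) + e / M * (C1 * h)) / l0); last by ring.
      rewrite ler_pM ?cabs_ge0 ?invr_ge0 ?(ltW l'00)//.
        by rewrite (le_trans (le_cabsB _ _))// lerD// rle// ?lexx ?yle.
      by rewrite lef_pV2.
    - by rewrite addrAC subrr add0r.
  rewrite (le_trans (@cabs_cint_le _ _ _ _ (e / M * (C1 * h) * (2 * (s / L))) _ _ _))//.
  - by apply: ccontB; apply: ccont_B => //; apply/andP; split; lra.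
  - move=> t ty; rewrite -mulrBl cabsM.
    rewrite (_ : e / M * (C1 * h) * (2 * (s / L)) =
      (e / M * (C1 * h) + e / M * (C1 * h)) * (s / L)); last by ring.
    rewrite ler_pM ?cabs_ge0//.
    by rewrite (le_trans (le_cabsB _ _))// lerD// rle// ?lexx ?xle.
  - by rewrite addrAC subrr add0r.
Qed.

Let Phi0E l : Phi l (2 * pi) = Phi l 0.
Proof.
rewrite /Phi /zeta /cexpi; congr (_ + _ * (_ * _ - _)).
by rewrite -[2 * pi]add0r mulr_natl cosD2pi sinD2pi.
Qed.

(** The sides at the angles 0 and [2 * pi] coincide, so the vanishing boundary integral leaves only
    the two circles. *)
Let B_const l0 : 0 < l0 < 1 ->
  cint 0 (2 * pi) (fun t => f (Phi 1 t) * kap t) =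
  cint 0 (2 * pi) (fun t => f (Phi l0 t) * kap t).
Proof.
move=> l0i; have p0 : 0 < 2 * pi :> R by rewrite mulr_gt0// pi_gt0.
have := J_eq0 l0i p0; rewrite /J (@eq_cint _ l0 1 _ (fun=> 0)); last first.
  by move=> t _; rewrite Phi0E subrr.
move: l0i => /andP[l00 l01].
rewrite cint_cst ?(ltW l01)// mul0r add0r cintB.
- by move/eqP; rewrite subr_eq0 => /eqP.
- by apply: ccont_B => //; rewrite ler01 lexx.
- by apply: ccont_B => //; rewrite !ltW.
Qed.

(* The circle is contracted to [w] along [Phi]; each small cell of the
   contraction contributes [o(area)], and the inner circle tends to [f w]. *)
Lemma cint_homotopy :
  cint 0 (2 * pi) (fun t => f (s%:C%C * cexpi t) *
     ('i%C * (s%:C%C * cexpi t) / (s%:C%C * cexpi t - w))) =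
  f w * cint 0 (2 * pi) (fun t => 'i%C * (s%:C%C * cexpi t) / (s%:C%C * cexpi t - w)).
Proof.
have p0 : 0 < 2 * pi :> R by rewrite mulr_gt0// pi_gt0.
rewrite -/kap (@eq_cint _ 0 (2 * pi) _ (fun t => f (Phi 1 t) * kap t)); last first.
  by move=> t _; rewrite /Phi mul1r subrKC.
apply/eqP; rewrite -subr_eq0 -cabs_eq0 eq_le cabs_ge0 andbT.
apply/ler_addgt0Pl => e e0; rewrite addr0.
pose M := s / L * (2 * pi).
have M0 : 0 < M by rewrite mulr_gt0// divr_gt0.
have eM : 0 < e / M by rewrite divr_gt0.
have /cvg_cabsP/(_ _ eM)/nbhs_cabsP[d d0 hd] := @complex_derivable_continuous _ _ _ (hf (lt_trans ws sq)).
(* The points of the outer circle lie within [2 * s] of [w], so the inner circle stays within [d] of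
   [w]. *)
pose l0 := Num.min (2^-1) (d / (4 * s)).
have l00 : 0 < l0 by rewrite lt_min invr_gt0 ltr0n/= divr_gt0// mulr_gt0.
have l01 : l0 < 1 by rewrite gt_min invf_lt1// ltr1n.
have l0d : l0 * (4 * s) <= d.
  by rewrite -ler_pdivlMr ?mulr_gt0// ge_min lexx orbT.
rewrite (@B_const l0) ?l00// -cintZ; last exact: ccont_kap.
rewrite -cintB; last 2 first.
- by apply: ccont_B => //; rewrite !ltW.
- by apply: ccontM; [exact: ccont_cst|exact: ccont_kap].
rewrite (le_trans (@cabs_cint_le _ _ _ _ (e / M * (s / L)) _ _ _))//.
- exact: ltW.
- apply: ccontB; first by apply: ccont_B => //; rewrite !ltW.
  by apply: ccontM; [exact: ccont_cst|exact: ccont_kap].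
- move=> t _; rewrite -mulrBl cabsM ler_pM ?cabs_ge0// ltW// hd//.
  rewrite /Phi addrAC subrr add0r cabsM cabs_real gtr0_norm//.
  rewrite (lt_le_trans _ l0d)// ltr_pM2l// (le_lt_trans (zetaw_le _))//.
  by rewrite ltr_pM2r// ltr_nat.
- by rewrite subr0 -(mulrA (e / M)) -/M divfK// gt_eqF.
Qed.

End CauchyHomotopy.

Section Cauchy.
Variable R : realType.
Local Notation circ s t := (s%:C%C * cexpi t).

Lemma conjcB (z w : R[i]) : ((z - w)^*)%C = (z^*)%C - (w^*)%C.
Proof. exact: rmorphB. Qed.

Lemma conjcM (z w : R[i]) : ((z * w)^*)%C = (z^*)%C * (w^*)%C.
Proof. exact: rmorphM. Qed.

Lemma conj_1BM (z w : R[i]) : ((1 - z * w)^*)%C = 1 - (z^*)%C * (w^*)%C.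
Proof. by rewrite conjcB conjcM; congr (_ - _); exact: conjc1. Qed.

Lemma cint_conj a b (f : R -> R[i]) : ccont a b f ->
  cint a b (fun t => (f t)^*)%C = ((cint a b f)^*)%C.
Proof.
move=> hf; apply/eqP; rewrite eq_complex/=; apply/andP; split; apply/eqP.
  by apply: eq_Rintegral => t _; case: (f t).
rewrite -mulN1r -RintegralZl//; last exact: rcont_integrable (ccont_Im hf).
by apply: eq_Rintegral => t _; rewrite mulN1r; case: (f t).
Qed.

Lemma ccont_circle q s (f : R[i] -> R[i]) a b : 0 <= s -> s < q -> holo_in q f ->
  ccont a b (fun t => f (circ s t)).
Proof.
move=> s0 sq hf; split=> t _.
apply: (@continuous_comp R (R[i] : numFieldType) (R[i] : numFieldType)).
  have : ccont t t (fun t : R => circ s t).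
    by apply: ccontM; [exact: ccont_cst|exact: ccont_cexpi].
  by move=> [h]; apply: h; rewrite lexx.
by apply: complex_derivable_continuous; apply: hf; rewrite cabs_circle.
Qed.

(** At the centre the kernel of [cint_homotopy] is the constant ['i%C]. *)
Lemma mean_value q s (f : R[i] -> R[i]) : 0 < s -> s < q -> holo_in q f ->
  cint 0 (2 * pi) (fun t => f (circ s t)) = f 0 * (2 * pi)%:C%C.
Proof.
move=> s0 sq hf.
have p0 : 0 <= 2 * pi :> R by rewrite mulr_ge0// pi_ge0.
have w0 : cabs (0 : R[i]) < s by rewrite cabs0.
have := cint_homotopy w0 sq hf.
have E (t : R) : 'i%C * circ s t / (circ s t - 0) = 'i%C :> R[i].
  rewrite subr0 mulfK// -cabs_gt0 cabs_circle// ltW//.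
rewrite (@eq_cint _ _ _ _ (fun t => 'i%C * f (circ s t))); last first.
  by move=> t _; rewrite E mulrC.
rewrite [in RHS](@eq_cint _ _ _ _ (fun t => 'i%C)); last by move=> t _; rewrite E.
rewrite cintZ; last exact: (ccont_circle _ _ (ltW s0) sq hf).
rewrite cint_cst// subr0 mulrCA => /mulfI; apply.
by rewrite eq_complex/= oner_eq0 andbF.
Qed.

(** For [f = 1] the homotopy identity is void, so the kernel is integrated separately. On the circle
    its conjugate is 1 / (1 - v z) with v = w^* / s^2, which is holomorphic in z, and the mean value
    property applies. *)
Lemma cint_cauchy_kernel s (w : R[i]) : cabs w < s ->
  cint 0 (2 * pi) (fun t => circ s t / (circ s t - w)) = (2 * pi)%:C%C.
Proof.
move=> ws; have s0 : 0 < s by rewrite (le_lt_trans (cabs_ge0 w)).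
pose v : R[i] := (w^*)%C / (s ^+ 2)%:C%C.
have cv : cabs v = cabs w / s ^+ 2.
  by rewrite cabs_div cabsJ cabs_real ger0_norm// sqr_ge0.
have hv : cabs v * s < 1.
  by rewrite cv expr2 invfM mulrA divfK ?gt_eqF// ltr_pdivrMr// mul1r.
pose g (z : R[i]) := (1 - v * z)^-1.
(* The pole 1 / v lies outside the circle since |v| s = |w| / s < 1; for [v = 0] any radius beyond
   [s] will do. *)
pose q := if v == 0 then s + 1 else (cabs v)^-1.
have sq : s < q.
  rewrite /q; case: ifPn => [_|v0]; first by rewrite ltrDl.
  by rewrite -[ltRHS]mul1r ltr_pdivlMr ?cabs_gt0// mulrC.
have g0 z : cabs z < q -> 1 - v * z != 0.
  move=> zq; apply/eqP => /eqP; rewrite subr_eq0 => /eqP /(congr1 (@cabs R)).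
  rewrite cabs1 cabsM => /eqP; apply/negP; rewrite eq_sym lt_eqF//.
  move: zq; rewrite /q; case: ifPn => [/eqP->|v0]; first by rewrite cabs0 mul0r ltr01.
  by rewrite -[ltRHS]mul1r ltr_pdivlMr ?cabs_gt0// mulrC.
have hg : holo_in q g.
  move=> z zq; apply: complex_derivableV; first exact: g0.
  apply: complex_derivableB; first exact: complex_derivable_cst.
  by apply: complex_derivableM; [exact: complex_derivable_cst|exact: complex_derivable_id].
have := mean_value s0 sq hg; rewrite {2}/g mulr0 subr0 invr1 mul1r => mv.
have cg := ccont_circle 0 (2 * pi) (ltW s0) sq hg.
have := cint_conj cg; rewrite mv conjc_real => <-.
apply: eq_cint => t _; rewrite /g conjc_inv conj_1BM.
have nz : circ s t != 0 by rewrite -cabs_gt0 cabs_circle// ltW.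
have nzw : circ s t - w != 0.
  by rewrite -cabs_gt0 (lt_le_trans _ (ge_cabsB _ _))// cabs_circle ?subr_gt0// ltW.
have -> : (v^*)%C * ((circ s t)^*)%C = w / circ s t.
  have -> : (v^*)%C = w / (s ^+ 2)%:C%C.
    by rewrite /v conjcM conjcK conjc_inv conjc_real.
  have -> : ((circ s t)^*)%C = (s ^+ 2)%:C%C / circ s t.
    apply: (mulfI nz); rewrite mul_conjc cabs_circle ?ltW// mulrC.
    by rewrite divfK.
  rewrite mulrA divfK// -cabs_gt0 cabs_real gtr0_norm// exprn_gt0//.
have nz1 : 1 - w / circ s t != 0.
  apply: contraNN nzw => /eqP h.
  have -> : circ s t - w = circ s t * (1 - w / circ s t).
    by rewrite mulrBr mulr1 mulrCA divff// mulr1.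
  by rewrite h mulr0.
apply: (mulfI nz1); rewrite mulfV// mulrA.
have -> : (1 - w / circ s t) * circ s t = circ s t - w.
  by rewrite mulrBl mul1r divfK.
by rewrite divff.
Qed.

Theorem cauchy_formula q s (f : R[i] -> R[i]) (w : R[i]) :
  cabs w < s -> s < q -> holo_in q f ->
  cint 0 (2 * pi) (fun t => f (circ s t) * (circ s t / (circ s t - w))) =
  f w * (2 * pi)%:C%C.
Proof.
move=> ws sq hf; have s0 : 0 < s by rewrite (le_lt_trans (cabs_ge0 w)).
have ck : ccont 0 (2 * pi) (fun t : R => circ s t / (circ s t - w)).
  have cz a b : ccont a b (fun t : R => circ s t).
    by apply: ccontM; [exact: ccont_cst|exact: ccont_cexpi].
  apply: ccontM; first exact: cz.
  apply: ccontV; last by apply: ccontB; [exact: cz|exact: ccont_cst].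
  move=> t _; rewrite -cabs_gt0 (lt_le_trans _ (ge_cabsB _ _))//.
  by rewrite cabs_circle ?subr_gt0// ltW.
have := cint_homotopy ws sq hf.
rewrite (@eq_cint _ _ _ _ (fun t => 'i%C * (f (circ s t) * (circ s t / (circ s t - w)))));
  last by move=> t _; ring.
rewrite cintZ; last by apply: ccontM => //; exact: (ccont_circle _ _ (ltW s0) sq hf).
under [in RHS]eq_cint do rewrite -mulrA.
rewrite cintZ// cint_cauchy_kernel// mulrCA => /mulfI; apply.
by rewrite eq_complex/= oner_eq0 andbF.
Qed.

End Cauchy.

(** * Hardy norms and subordination *)

Section CircleMean.
Variable R : realType.
Local Notation mu := (@lebesgue_measure R).
Local Notation circ s t := (s%:C%C * cexpi t).
Implicit Types (u v : R -> R).

Lemma twopi_gt0 : 0 < 2 * pi :> R.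
Proof. by rewrite mulr_gt0// pi_gt0. Qed.

Lemma rcont_cst a b (c : R) : rcont a b (fun=> c).
Proof. by move=> t _; exact: cvg_cst. Qed.

Lemma rcontD a b u v : rcont a b u -> rcont a b v -> rcont a b (fun t => u t + v t).
Proof. by move=> hu hv t tab; apply: cvgD; [exact: hu|exact: hv]. Qed.

Lemma rcontM a b u v : rcont a b u -> rcont a b v -> rcont a b (fun t => u t * v t).
Proof. by move=> hu hv t tab; apply: cvgM; [exact: hu|exact: hv]. Qed.

Lemma rcontV a b u : (forall t, a <= t <= b -> u t != 0) -> rcont a b u ->
  rcont a b (fun t => (u t)^-1).
Proof. by move=> u0 hu t tab; apply: cvgV; [exact: u0|exact: hu]. Qed.

(** At [a = 0], where the derivative of the power is not at hand, x^p <= x for 0 <= x <= 1 gives the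
    limit. *)
Lemma cvg_powR (T : Type) (F : set_system T) (FF : Filter F) (f : T -> R) (a p : R) :
  1 <= p -> (forall x, 0 <= f x) -> 0 <= a -> f @ F --> a ->
  (fun x => f x `^ p) @ F --> a `^ p.
Proof.
move=> p1 f0; rewrite le_eqVlt => /predU1P[<-|a0] fa.
  have p0 : p != 0 by rewrite gt_eqF// (lt_le_trans _ p1).
  rewrite powR0//; apply/cvgrPdist_lt => e e0.
  have m0 : 0 < Num.min e 1 by rewrite lt_min e0 ltr01.
  move/cvgrPdist_lt : fa => /(_ _ m0); apply: filterS => x.
  rewrite !sub0r !normrN ger0_norm// ger0_norm ?powR_ge0// lt_min => /andP[fe f1].
  apply: le_lt_trans fe; have [->|fx] := eqVneq (f x) 0; first by rewrite powR0.
  by apply: ge1r_powR => //; rewrite lt_def fx f0 ltW.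
have ca : {for a, continuous (@powR R ^~ p)}.
  apply: differentiable_continuous; apply/derivable1_diffP; apply: derivable_powR.
  by rewrite in_itv/= a0.
exact: cvg_comp fa ca.
Qed.

Lemma rcont_powR a b u p : 1 <= p -> (forall t, 0 <= u t) -> rcont a b u ->
  rcont a b (fun t => u t `^ p).
Proof. by move=> p1 u0 hu t tab; apply: cvg_powR => //; exact: hu. Qed.

Definition circle_mean u : R := (2 * pi)^-1 * \int[mu]_(t in `[0, 2 * pi]) u t.
Local Notation per u := (rcont 0 (2 * pi) u).

Lemma eq_circle_mean u v : (forall t, u t = v t) -> circle_mean u = circle_mean v.
Proof. by move=> uv; rewrite /circle_mean; congr (_ * _); apply: eq_Rintegral => t _. Qed.

Lemma circle_meanD u v : per u -> per v ->
  circle_mean (fun t => u t + v t) = circle_mean u + circle_mean v.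
Proof.
move=> /rcont_integrable hu /rcont_integrable hv.
by rewrite /circle_mean (RintegralD _ hu hv)// mulrDr.
Qed.

Lemma circle_meanZ k u : per u -> circle_mean (fun t => k * u t) = k * circle_mean u.
Proof.
move=> /rcont_integrable hu.
by rewrite /circle_mean (RintegralZl _ _ hu)// mulrCA.
Qed.

Lemma circle_mean_cst k : circle_mean (fun=> k) = k.
Proof.
rewrite /circle_mean Rintegral_itv_cst ?(ltW twopi_gt0)// subr0 mulrCA.
by rewrite mulVf ?mulr1// gt_eqF// twopi_gt0.
Qed.

Lemma le_circle_mean u v : per u -> per v ->
  (forall t, 0 <= t <= 2 * pi -> u t <= v t) -> circle_mean u <= circle_mean v.
Proof.
move=> hu hv uv; rewrite /circle_mean ler_pM2l ?invr_gt0 ?twopi_gt0//.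
by apply: le_Rintegral => //; try exact: rcont_integrable.
Qed.

Lemma circle_mean_ge0 u : (forall t, 0 <= u t) -> 0 <= circle_mean u.
Proof.
move=> u0; rewrite /circle_mean mulr_ge0 ?invr_ge0 ?(ltW twopi_gt0)//.
by apply: Rintegral_ge0.
Qed.

(** Young's inequality for the product [x * 1], with exponents [p] and p / (p - 1); hence the
    separate case [p = 1]. *)
Lemma bernoulli_powR (p x : R) : 1 <= p -> 0 <= x -> 1 + p * (x - 1) <= x `^ p.
Proof.
rewrite le_eqVlt => /predU1P[<-|p1] x0; first by rewrite mul1r powRr1// subrKC.
have p0 : 0 < p by rewrite (lt_trans _ p1).
pose q := p / (p - 1).
have q0 : 0 < q by rewrite divr_gt0// subr_gt0.
have pq : p^-1 + q^-1 = 1.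
  by rewrite /q invf_div; field; rewrite gt_eqF.
have := conjugate_powR x0 (@ler01 R) p0 q0 pq; rewrite powR1 mulr1 mul1r.
have -> : q^-1 = 1 - p^-1 by rewrite -pq addrC addKr.
rewrite -(ler_pM2l p0) => h; rewrite (le_trans _ (_ : p * (x `^ p / p + (1 - p^-1)) - (p - 1) <= _)) //.
  by lra.
by rewrite mulrDr mulrCA divff ?gt_eqF// mulr1 mulrBr divff ?gt_eqF// mulr1; lra.
Qed.

(* The tangent line of [x `^ p] at the mean lies below the graph. *)
Lemma jensen_powR p u v : 1 <= p -> per u -> per v ->
  (forall t, 0 <= u t) -> (forall t, 0 <= v t) -> circle_mean v = 1 ->
  circle_mean (fun t => u t * v t) `^ p <= circle_mean (fun t => u t `^ p * v t).
Proof.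
move=> p1 hu hv u0 v0 v1; set m := circle_mean (fun t => u t * v t).
have p0 : 0 < p by rewrite (lt_le_trans _ p1).
have m0 : 0 <= m by apply: circle_mean_ge0 => t; rewrite mulr_ge0.
have hup := rcont_powR p1 u0 hu.
have [->|mn0] := eqVneq m 0.
  rewrite powR0 ?gt_eqF//; apply: circle_mean_ge0 => t; rewrite mulr_ge0//.
  exact: powR_ge0.
have mp : 0 < m by rewrite lt_def mn0.
pose A := m `^ p * (1 - p); pose B := m `^ p * p / m.
have tl t : 0 <= t <= 2 * pi -> A * v t + B * (u t * v t) <= u t `^ p * v t.
  move=> _; rewrite mulrA -mulrDl ler_wpM2r//.
  have -> : u t = m * (u t / m) by rewrite mulrC divfK.
  have y0 : 0 <= u t / m by rewrite divr_ge0.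
  rewrite (powRM _ m0 y0) (_ : A + _ = m `^ p * (1 + p * (u t / m - 1))).
    by rewrite ler_wpM2l ?powR_ge0// bernoulli_powR.
  by rewrite /A /B; field.
have := @le_circle_mean (fun t => A * v t + B * (u t * v t)) (fun t => u t `^ p * v t).
have huv := rcontM hu hv.
rewrite circle_meanD ?circle_meanZ// -/m ?v1; last 2 first.
- by apply: rcontM => //; exact: rcont_cst.
- by apply: rcontM => //; exact: rcont_cst.
rewrite (_ : A * 1 + B * m = m `^ p); last by rewrite /A /B; field.
apply => //.
- by apply: rcontD; apply: rcontM => //; exact: rcont_cst.
- exact: rcontM.
Qed.

Lemma ccont_circ a b s : ccont a b (fun t : R => circ s t).
Proof. by apply: ccontM; [exact: ccont_cst|exact: ccont_cexpi]. Qed.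

Definition poisson (s : R) (w : R[i]) (t : R) : R :=
  (s ^+ 2 - cabs w ^+ 2) / cabs (circ s t - w) ^+ 2.

Section Poisson.
Variables (s : R) (w : R[i]).
Hypothesis ws : cabs w < s.
Let s0 : 0 < s. Proof. exact: le_lt_trans (cabs_ge0 w) ws. Qed.

Let zw_gt0 t : 0 < cabs (circ s t - w).
Proof.
by rewrite (lt_le_trans _ (ge_cabsB _ _))// cabs_circle ?(ltW s0)// subr_gt0.
Qed.

Lemma poisson_ge0 t : 0 <= poisson s w t.
Proof.
rewrite divr_ge0 ?sqr_ge0// subr_ge0 ler_pXn2r ?nnegrE ?cabs_ge0 ?(ltW s0)//.
exact: ltW.
Qed.

Lemma poisson_le t : poisson s w t <= (s + cabs w) / (s - cabs w).
Proof.
have d0 : 0 < s - cabs w by rewrite subr_gt0.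
rewrite /poisson ler_pdivrMr ?exprn_gt0// subr_sqr.
rewrite [leRHS](_ : _ = (s + cabs w) * (cabs (circ s t - w) ^+ 2 / (s - cabs w))); last by ring.
rewrite mulrC ler_pM2l ?ltr_wpDr ?cabs_ge0// ler_pdivlMr// -expr2.
rewrite ler_pXn2r ?nnegrE ?cabs_ge0 ?(ltW d0)//.
by rewrite (le_trans _ (ge_cabsB _ _))// cabs_circle// ltW.
Qed.

Lemma rcont_poisson a b : rcont a b (poisson s w).
Proof.
apply: rcontM; first exact: rcont_cst.
apply: rcontV; first by move=> t _; rewrite gt_eqF// exprn_gt0.
have h : rcont a b (fun t => cabs (circ s t - w)).
  by apply: ccont_cabs; apply: ccontB; [exact: ccont_circ|exact: ccont_cst].
exact: rcontM.
Qed.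

Lemma ccont_poisson a b : ccont a b (fun t => (poisson s w t)%:C%C).
Proof.
split=> t tab; apply: cvg_complex; last exact: cvg_cst.
exact: (@rcont_poisson a b).
Qed.

(** The Cauchy kernel plus a term that is holomorphic in the circle variable and vanishes at 0.
    Against a holomorphic [f] the first term reproduces [f w], and the second has mean 0. *)
Lemma poissonE t : (poisson s w t)%:C%C =
  circ s t / (circ s t - w) + (w^*)%C * circ s t / ((s ^+ 2)%:C%C - (w^*)%C * circ s t).
Proof.
set z := circ s t; have cz : cabs z = s by rewrite cabs_circle// ltW.
have zn : z != 0 by rewrite -cabs_gt0 cz.
have zw0 : z - w != 0 by rewrite -cabs_gt0; exact: zw_gt0.
have zzb : z * (z^*)%C = (s ^+ 2)%:C%C by rewrite mul_conjc cz.
have wwb : w * (w^*)%C = (cabs w ^+ 2)%:C%C by rewrite mul_conjc.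
have e1 : (s ^+ 2)%:C%C - (w^*)%C * z = z * ((z - w)^*)%C.
  by rewrite -zzb conjcB; ring.
have zwb0 : ((z - w)^*)%C != 0 by rewrite -cabs_gt0 cabsJ cabs_gt0.
rewrite e1 /poisson rmorphM fmorphV/= -/z rmorphB/= -wwb -(mul_conjc (z - w)) -zzb.
move: zwb0; rewrite conjcB => zwb0.
move: zn zw0 zwb0; move: z (z^*)%C (w^*)%C {cz zzb wwb e1} => z zb wb zn zw0 zwb0.
by field; rewrite zn zw0 zwb0.
Qed.

Variables (q : R) (f : R[i] -> R[i]).
Hypothesis sq : s < q.
Hypothesis hf : holo_in q f.

Lemma poisson_formula :
  cint 0 (2 * pi) (fun t => f (circ s t) * (poisson s w t)%:C%C) = f w * (2 * pi)%:C%C.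
Proof.
pose g z := f z * ((w^*)%C * z / ((s ^+ 2)%:C%C - (w^*)%C * z)).
(* The pole of the second term has modulus s^2 / |w| > s and is excluded by shrinking the disk. *)
pose q' := if w == 0 then q else Num.min q (s ^+ 2 / cabs w).
have sq' : s < q'.
  rewrite /q'; case: ifPn => // w0; rewrite lt_min sq/= ltr_pdivlMr ?cabs_gt0// expr2.
  by rewrite ltr_pM2l.
have q'q : q' <= q by rewrite /q'; case: ifPn => // _; rewrite ge_min lexx.
have g0 z : cabs z < q' -> (s ^+ 2)%:C%C - (w^*)%C * z != 0.
  move=> zq; apply/eqP => /eqP; rewrite subr_eq0 => /eqP /(congr1 (@cabs R)).
  rewrite cabsM cabsJ cabs_real ger0_norm ?sqr_ge0// => /eqP; apply/negP.
  rewrite gt_eqF//; move: zq; rewrite /q'; case: ifPn => [/eqP-> _|w0].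
    by rewrite cabs0 mul0r exprn_gt0.
  by rewrite lt_min ltr_pdivlMr ?cabs_gt0// mulrC => /andP[].
have hg : holo_in q' g.
  move=> z zq; apply: complex_derivableM.
    by apply: hf; exact: lt_le_trans zq q'q.
  apply: complex_derivableM.
    by apply: complex_derivableM; [exact: complex_derivable_cst|exact: complex_derivable_id].
  apply: complex_derivableV; first exact: g0.
  apply: complex_derivableB; first exact: complex_derivable_cst.
  by apply: complex_derivableM; [exact: complex_derivable_cst|exact: complex_derivable_id].
have := mean_value s0 sq' hg; rewrite {2}/g mulr0 mul0r mulr0 mul0r => mv.
rewrite -(cauchy_formula ws sq hf) -[RHS]addr0 -mv -cintD.
- by apply: eq_cint => t _; rewrite poissonE /g; ring.
- apply: ccontM; first exact: (ccont_circle _ _ (ltW s0) sq hf).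
  apply: ccontM; first exact: ccont_circ.
  apply: ccontV; first by move=> t _; rewrite -cabs_gt0.
  by apply: ccontB; [exact: ccont_circ|exact: ccont_cst].
- exact: (ccont_circle _ _ (ltW s0) sq' hg).
Qed.

End Poisson.

Lemma cabs_twopi : cabs ((2 * pi : R)%:C%C) = 2 * pi.
Proof. by rewrite cabs_real gtr0_norm// twopi_gt0. Qed.

Lemma poisson_mean s w : cabs w < s -> circle_mean (poisson s w) = 1.
Proof.
move=> ws.
have h1 : holo_in (s + 1) (fun=> 1 : R[i]) by move=> z _; exact: complex_derivable_cst.
have s1 : s < s + 1 by rewrite ltrDl.
have /(congr1 (@complex.Re R)) := poisson_formula ws s1 h1.
rewrite mul1r/= /circle_mean => h; apply: (mulfI (_ : 2 * pi != 0)).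
  by rewrite gt_eqF// twopi_gt0.
rewrite mulrA divff ?gt_eqF ?twopi_gt0// mul1r mulr1; apply: etrans h.
by apply: eq_Rintegral => t _; ring.
Qed.

Lemma cabs_le_poisson q s w f : cabs w < s -> s < q -> holo_in q f ->
  cabs (f w) <= circle_mean (fun t => cabs (f (circ s t)) * poisson s w t).
Proof.
move=> ws sq hf; have s0 : 0 < s by rewrite (le_lt_trans (cabs_ge0 w)).
rewrite /circle_mean mulrC ler_pdivlMr ?twopi_gt0// -[X in _ * X <= _]cabs_twopi -cabsM.
rewrite -(poisson_formula ws sq hf).
have cf := ccont_circle 0 (2 * pi) (ltW s0) sq hf.
rewrite (le_trans (cabs_cint (ccontM cf (ccont_poisson ws _ _))))// le_eqVlt.
apply/orP; left; apply/eqP; apply: eq_Rintegral => t _.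
by rewrite cabsM cabs_real ger0_norm// poisson_ge0.
Qed.

Lemma powR_cabs_le_poisson p q s w f : 1 <= p -> cabs w < s -> s < q -> holo_in q f ->
  cabs (f w) `^ p <= circle_mean (fun t => cabs (f (circ s t)) `^ p * poisson s w t).
Proof.
move=> p1 ws sq hf; have s0 : 0 < s by rewrite (le_lt_trans (cabs_ge0 w)).
have cf := ccont_cabs (ccont_circle 0 (2 * pi) (ltW s0) sq hf).
have cp := @rcont_poisson _ _ ws 0 (2 * pi).
have u0 t : 0 <= cabs (f (circ s t)) by exact: cabs_ge0.
apply: le_trans (jensen_powR p1 cf cp u0 (poisson_ge0 ws) (poisson_mean ws)).
apply: ge0_ler_powR; rewrite ?nnegrE ?cabs_ge0 ?(le_trans _ p1)//.
  by apply: circle_mean_ge0 => t; rewrite mulr_ge0// poisson_ge0.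
exact: cabs_le_poisson hf.
Qed.

Lemma powR_cabs_le_mean p q s w f : 1 <= p -> cabs w < s -> s < q -> holo_in q f ->
  cabs (f w) `^ p <=
    (s + cabs w) / (s - cabs w) * circle_mean (fun t => cabs (f (circ s t)) `^ p).
Proof.
move=> p1 ws sq hf; have s0 : 0 < s by rewrite (le_lt_trans (cabs_ge0 w)).
have cf := ccont_cabs (ccont_circle 0 (2 * pi) (ltW s0) sq hf).
have cfp : rcont 0 (2 * pi) (fun t => cabs (f (circ s t)) `^ p).
  by apply: rcont_powR => // t; exact: cabs_ge0.
have cp := @rcont_poisson _ _ ws 0 (2 * pi).
rewrite (le_trans (powR_cabs_le_poisson p1 ws sq hf))// -circle_meanZ//.
apply: le_circle_mean.
- exact: rcontM.
- by apply: rcontM => //; exact: rcont_cst.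
- by move=> t _; rewrite mulrC ler_wpM2r ?powR_ge0// poisson_le.
Qed.

Lemma max_modulus q s w f (M : R) : cabs w < s -> s < q -> holo_in q f ->
  (forall t, 0 <= t <= 2 * pi -> cabs (f (circ s t)) <= M) -> cabs (f w) <= M.
Proof.
move=> ws sq hf hM; have s0 : 0 < s by rewrite (le_lt_trans (cabs_ge0 w)).
have cf := ccont_cabs (ccont_circle 0 (2 * pi) (ltW s0) sq hf).
have cp := @rcont_poisson _ _ ws 0 (2 * pi).
rewrite (le_trans (cabs_le_poisson ws sq hf))//.
rewrite -[leRHS]mulr1 -(poisson_mean ws) -circle_meanZ//.
apply: le_circle_mean.
- exact: rcontM.
- by apply: rcontM => //; exact: rcont_cst.
- by move=> t t2; rewrite ler_wpM2r ?poisson_ge0 ?hM.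
Qed.

End CircleMean.

(** * Hardy norms through circle means *)

Section HardyNorm.
Variable R : realType.
Local Notation mu := (@lebesgue_measure R).
Local Notation circ s t := (s%:C%C * cexpi t).
Implicit Types (f g : R[i] -> R[i]) (p r : R).

Lemma rcont_hardy p r f a b : 1 <= p -> 0 <= r < 1 -> holo_in 1 f ->
  rcont a b (fun t => cabs (f (circ r t)) `^ p).
Proof.
move=> p1 /andP[r0 r1] hf; apply: rcont_powR => //; first by move=> t; exact: cabs_ge0.
by apply: ccont_cabs; exact: (ccont_circle _ _ r0 r1 hf).
Qed.

Lemma Mp_powE p r f : 1 <= p -> 0 <= r < 1 -> holo_in 1 f ->
  Mp_pow p r f = (circle_mean (fun t => cabs (f (circ r t)) `^ p))%:E.
Proof.
move=> p1 r01 hf; rewrite /Mp_pow /circle_mean EFinM; congr (_ * _)%E.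
rewrite /Rintegral fineK//; apply: integrable_fin_num => //.
exact/rcont_integrable/rcont_hardy.
Qed.

Lemma hp_norm_leP p f (N : R) : 1 <= p -> 0 <= N -> holo_in 1 f ->
  (hp_norm p f <= N%:E)%E <->
  (forall r, 0 <= r < 1 -> circle_mean (fun t => cabs (f (circ r t)) `^ p) <= N `^ p).
Proof.
move=> p1 N0 hf; have p0 : 0 < p by rewrite (lt_le_trans _ p1).
have E r : 0 <= r < 1 -> (poweR (Mp_pow p r f) p^-1 <= N%:E)%E <->
    circle_mean (fun t => cabs (f (circ r t)) `^ p) <= N `^ p.
  move=> r01; rewrite Mp_powE// poweR_EFin lee_fin.
  set m := circle_mean _.
  have m0 : 0 <= m by apply: circle_mean_ge0 => t; exact: powR_ge0.
  have pK x : 0 <= x -> (x `^ p) `^ p^-1 = x.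
    by move=> x0; rewrite -powRrM mulfV ?gt_eqF// powRr1.
  have pVK x : 0 <= x -> (x `^ p^-1) `^ p = x.
    by move=> x0; rewrite -powRrM mulVf ?gt_eqF// powRr1.
  split=> h.
    rewrite -(pVK m)//; apply: ge0_ler_powR; rewrite ?nnegrE ?(ltW p0)//.
    exact: powR_ge0.
  rewrite -(pK N)//; apply: ge0_ler_powR; rewrite ?nnegrE ?invr_ge0 ?(ltW p0)//.
  exact: powR_ge0.
split=> [h r r01|h].
  by apply/E => //; apply: le_trans h; apply: ereal_sup_ubound; exists r.
by apply: ge_ereal_sup => _ [r r01 <-]; apply/E => //; exact: h.
Qed.

Lemma hp_norm_le p f (M : R) : 1 <= p -> 0 <= M -> holo_in 1 f ->
  (forall z, cabs z < 1 -> cabs (f z) <= M) -> (hp_norm p f <= M%:E)%E.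
Proof.
move=> p1 M0 hf hM; apply/hp_norm_leP => // r r01.
rewrite -[leRHS]circle_mean_cst; apply: le_circle_mean.
- exact: rcont_hardy.
- exact: rcont_cst.
- move=> t _; apply: ge0_ler_powR; rewrite ?nnegrE ?cabs_ge0 ?(le_trans _ p1)//.
  by apply: hM; move: r01 => /andP[r0 r1]; rewrite cabs_circle.
Qed.

Lemma hp_norm_ge0 p f : (0 <= hp_norm p f)%E.
Proof.
apply: (@le_trans _ _ (poweR (Mp_pow p 0 f) p^-1)); first exact: poweR_ge0.
by apply: ereal_sup_ubound; exists 0 => //=; rewrite lexx ltr01.
Qed.

Lemma powR_le_cancel p (x y : R) : 0 < p -> 0 <= x -> 0 <= y -> x `^ p <= y `^ p -> x <= y.
Proof.
move=> p0 x0 y0; rewrite leNgt => h; rewrite leNgt; apply: contra h => yx.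
by apply: gt0_ltr_powR; rewrite ?nnegrE.
Qed.

Lemma cabs_le_hp_norm p f (r N : R) w : 1 <= p -> 0 <= N -> holo_in 1 f ->
  r < 1 -> cabs w <= r -> (hp_norm p f <= N%:E)%E -> cabs (f w) <= 4 / (1 - r) * N.
Proof.
move=> p1 N0 hf r1 wr /(hp_norm_leP p1 N0 hf) h.
have p0 : 0 < p by rewrite (lt_le_trans _ p1).
have r0 : 0 <= r by rewrite (le_trans (cabs_ge0 w)).
have d0 : 0 < 1 - r by rewrite subr_gt0.
(* With [s] midway between [r] and 1, (s + |w|) / (s - |w|) is at most 2 / ((1 - r) / 2). Being
   applied to p-th powers this would enter through its p-th root, which is dropped since the
   constant is at least 1. *)
pose s := (1 + r) / 2.
have rs : r < s by rewrite /s; lra.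
have s1 : s < 1 by rewrite /s; lra.
have ws : cabs w < s by rewrite (le_lt_trans wr).
have C1 : 1 <= 4 / (1 - r) by rewrite ler_pdivlMr// mul1r; lra.
apply: (@powR_le_cancel p) => //; first exact: cabs_ge0.
  by rewrite mulr_ge0// (le_trans _ C1).
rewrite (le_trans _ (le1r_powRZ C1 N0 p1))//.
rewrite (le_trans (powR_cabs_le_mean p1 ws s1 hf))//.
have sw : 0 < s - cabs w by rewrite subr_gt0.
apply: ler_pM.
- by rewrite divr_ge0 ?(ltW sw)// addr_ge0 ?cabs_ge0// (le_trans (cabs_ge0 _) (ltW ws)).
- by apply: circle_mean_ge0 => t; exact: powR_ge0.
- rewrite ler_pdivlMr// mulrAC ler_pdivrMr//.
  have : (s + cabs w) * (1 - r) <= 2 * (1 - r).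
    by rewrite ler_pM2r//; lra.
  have : (1 - r) / 2 <= s - cabs w by rewrite /s; lra.
  lra.
- by apply: h; rewrite (le_trans (cabs_ge0 w) (ltW ws)).
Qed.

(** Jensen's inequality with weight 1: the mean of |f| is all that the interpolation error involves,
    whatever [p]. *)
Lemma circle_mean_cabs_le p f (s N : R) : 1 <= p -> 0 <= N -> holo_in 1 f ->
  0 <= s < 1 -> (hp_norm p f <= N%:E)%E ->
  circle_mean (fun t => cabs (f (circ s t))) <= N.
Proof.
move=> p1 N0 hf s01 /(hp_norm_leP p1 N0 hf) h.
have p0 : 0 < p by rewrite (lt_le_trans _ p1).
apply: (@powR_le_cancel p) => //.
  by apply: circle_mean_ge0 => t; exact: cabs_ge0.
apply: le_trans (h _ s01); move: s01 => /andP[s0 s1].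
have cf := ccont_cabs (ccont_circle 0 (2 * pi) s0 s1 hf).
have := @jensen_powR _ p (fun t => cabs (f (circ s t))) (fun=> 1) p1 cf.
move=> /(_ (@rcont_cst _ _ _ _)) /(_ (fun t => cabs_ge0 _)) /(_ (fun t => ler01)).
rewrite circle_mean_cst => /(_ erefl).
by under eq_circle_mean do rewrite mulr1; under [leRHS]eq_circle_mean do rewrite mulr1.
Qed.

End HardyNorm.

(** * Herglotz integrals and subordination *)

Section Subordination.
Variable R : realType.
Local Notation mu := (@lebesgue_measure R).
Local Notation circ s t := (s%:C%C * cexpi t).

Lemma Re_cayley (z w : R[i]) : z != w ->
  complex.Re ((z + w) / (z - w)) = (cabs z ^+ 2 - cabs w ^+ 2) / cabs (z - w) ^+ 2.
Proof.
move=> zw; have d0 : cabs (z - w) ^+ 2 != 0.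
  by rewrite expf_neq0// cabs_eq0 subr_eq0.
have dc : (cabs (z - w) ^+ 2)%:C%C != 0 :> R[i].
  by rewrite -cabs_eq0 cabs_real normr_eq0.
have -> : (z + w) / (z - w) = (z + w) * ((z - w)^*)%C * ((cabs (z - w) ^+ 2)^-1)%:C%C.
  rewrite fmorphV/=; apply: (mulIf dc); rewrite divfK// -mul_conjc.
  by rewrite mulrA divfK// subr_eq0.
rewrite !sqr_cabs; move: (_^-1) => k; case: z w {zw d0 dc} => a b [c d] /=.
by ring.
Qed.

Section Herglotz.
Variables (s : R) (A : R -> R).
Hypothesis cA : rcont 0 (2 * pi) A.
Hypothesis A0 : forall t, 0 <= A t.

Let ccA : ccont 0 (2 * pi) (fun t => (A t)%:C%C).
Proof. by split=> t tab; apply: cvg_complex; [exact: cA|exact: cvg_cst]. Qed.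

Definition herglotz (w : R[i]) : R[i] :=
  cint 0 (2 * pi) (fun t => (A t)%:C%C * ((circ s t + w) / (circ s t - w))).

Let zw (w : R[i]) t : cabs w < s -> s - cabs w <= cabs (circ s t - w).
Proof.
move=> ws; have s0 : 0 <= s by rewrite (le_trans (cabs_ge0 w)) ?ltW.
by rewrite (le_trans _ (ge_cabsB _ _))// cabs_circle.
Qed.

Let zw0 (w : R[i]) t : cabs w < s -> circ s t - w != 0.
Proof. by move=> ws; rewrite -cabs_gt0 (lt_le_trans _ (zw _ ws))// subr_gt0. Qed.

Let ccont_kernel (w : R[i]) : cabs w < s ->
  ccont 0 (2 * pi) (fun t => (A t)%:C%C * ((circ s t + w) / (circ s t - w))).
Proof.
move=> ws; apply: ccontM => //; apply: ccontM.
  by apply: ccontD; [exact: ccont_circ|exact: ccont_cst].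
apply: ccontV; first by move=> t _; exact: zw0.
by apply: ccontB; [exact: ccont_circ|exact: ccont_cst].
Qed.

Lemma Re_herglotz (w : R[i]) : cabs w < s ->
  complex.Re (herglotz w) = 2 * pi * circle_mean (fun t => A t * poisson s w t).
Proof.
move=> ws; have s0 : 0 <= s by rewrite (le_trans (cabs_ge0 w)) ?ltW.
rewrite /circle_mean mulrA divff ?gt_eqF ?twopi_gt0// mul1r /herglotz/=.
apply: eq_Rintegral => t _.
have -> : poisson s w t = complex.Re ((circ s t + w) / (circ s t - w)).
  by rewrite Re_cayley ?cabs_circle// -subr_eq0 zw0.
move: (_ / _) => k; case: k => a b /=.
by rewrite mul0r subr0.
Qed.

Lemma holo_herglotz : holo_in s herglotz.
Proof.
move=> w ws; apply/complex_derivableP.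
have s0 : 0 < s by rewrite (le_lt_trans (cabs_ge0 w)).
(* The derivative of (z + w) / (z - w) with respect to [w] is 2 z / (z - w)^2. *)
pose D t := (A t)%:C%C * (2 * circ s t / (circ s t - w) ^+ 2).
have cD : ccont 0 (2 * pi) D.
  apply: ccontM => //; apply: ccontM.
    by apply: ccontM; [exact: ccont_cst|exact: ccont_circ].
  apply: ccontV; first by move=> t _; rewrite expf_neq0// zw0.
  by apply: ccontM; apply: ccontB; by [exact: ccont_circ|exact: ccont_cst].
exists (cint 0 (2 * pi) D) => e e0.
pose L := s - cabs w; have L0 : 0 < L by rewrite subr_gt0.
pose IA := \int[mu]_(t in `[0, 2 * pi]) A t.
have IA0 : 0 <= IA by exact: Rintegral_ge0.
(* The kernel remainder is 2 z h^2 / ((z - w)^2 (z - w - h)), whose denominator is at least L^3 / 2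
   for |h| <= L / 2. The [+ 1] keeps [C] positive. *)
pose C := 4 * s / L ^+ 3 * IA + 1.
have C0 : 0 < C.
  by rewrite ltr_wpDl// mulr_ge0// divr_ge0 ?exprn_ge0 ?mulr_ge0// ltW.
exists (Num.min (L / 2) (e / C)); split; first by rewrite lt_min !divr_gt0.
move=> h /andP[h0]; rewrite lt_min => /andP[hL he].
have whs : cabs (w + h) < s.
  rewrite (le_lt_trans (le_cabsD _ _))//; move: hL; rewrite /L; lra.
rewrite /herglotz [_ * h]mulrC -cintZ// -cintB; [|exact: ccont_kernel|exact: ccont_kernel].
rewrite -cintB; last 2 first.
- by apply: ccontB; exact: ccont_kernel.
- by apply: ccontM => //; exact: ccont_cst.
rewrite (@eq_cint _ _ _ _ (fun t => (A t)%:C%C *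
    (2 * circ s t * h ^+ 2 / ((circ s t - w) ^+ 2 * (circ s t - (w + h)))))); last first.
  move=> t _; rewrite /D; move: (zw0 t ws) (zw0 t whs); move: (circ s t) => z z1 z2.
  by field; rewrite z1 z2.
have cE : ccont 0 (2 * pi) (fun t => (A t)%:C%C *
    (2 * circ s t * h ^+ 2 / ((circ s t - w) ^+ 2 * (circ s t - (w + h))))).
  apply: ccontM => //; apply: ccontM.
    apply: ccontM; last exact: ccont_cst.
    by apply: ccontM; [exact: ccont_cst|exact: ccont_circ].
  apply: ccontV; first by move=> t _; rewrite mulf_neq0 ?expf_neq0 ?zw0.
  apply: ccontM; last by apply: ccontB; [exact: ccont_circ|exact: ccont_cst].
  by apply: ccontM; apply: ccontB; by [exact: ccont_circ|exact: ccont_cst].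
rewrite (le_trans (cabs_cint cE))//.
have k0 : 0 <= 4 * s / L ^+ 3 * cabs h ^+ 2.
  by rewrite mulr_ge0 ?sqr_ge0// divr_ge0 ?exprn_ge0 ?mulr_ge0// ltW.
apply: (@le_trans _ _ (4 * s / L ^+ 3 * cabs h ^+ 2 * IA)).
  rewrite /IA -RintegralZl//; last exact: rcont_integrable.
  apply: le_Rintegral => //.
  - by apply: rcont_integrable; apply: ccont_cabs.
  - by apply: rcont_integrable; apply: rcontM => //; exact: rcont_cst.
  - move=> t _; rewrite cabsM cabs_real ger0_norm// mulrC ler_wpM2r//.
    have w1 := zw t ws; have w2 := zw t whs.
    have := @cabs_circle R s t (ltW s0); move: (circ s t) w1 w2 => z w1 w2 cz.
    rewrite cabs_div !cabsM cz.
    have c2 : cabs (2 : R[i]) = 2.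
      by rewrite -(rmorph_nat (real_complex R)) cabs_real ger0_norm.
    have w3 : L / 2 <= cabs (z - (w + h)).
      rewrite (le_trans _ w2)//; have := le_cabsD w h; move: hL; rewrite /L; lra.
    have D1 : 0 < L ^+ 2 * (L / 2) by rewrite mulr_gt0 ?exprn_gt0 ?divr_gt0.
    have D2 : L ^+ 2 * (L / 2) <= cabs (z - w) * cabs (z - w) * cabs (z - (w + h)).
      rewrite -expr2 ler_pM ?exprn_ge0 ?divr_ge0 ?(ltW L0)//.
      by rewrite ler_pXn2r ?nnegrE ?cabs_ge0 ?(ltW L0).
    rewrite c2 [leRHS](_ : _ = 2 * s * cabs h ^+ 2 * (L ^+ 2 * (L / 2))^-1); last first.
      by field; rewrite gt_eqF.
    rewrite -expr2 ler_wpM2l ?mulr_ge0 ?sqr_ge0 ?cabs_ge0 ?(ltW s0)//.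
    by rewrite lef_pV2 ?posrE// (lt_le_trans D1).
have hC : C * cabs h <= e by rewrite mulrC -ler_pdivlMr// ltW.
rewrite (le_trans _ (ler_wpM2r (cabs_ge0 h) hC))//.
rewrite [leLHS](_ : _ = 4 * s / L ^+ 3 * IA * (cabs h * cabs h)); last by ring.
rewrite -(mulrA C) ler_wpM2r ?mulr_ge0 ?cabs_ge0//.
by rewrite /C lerDl.
Qed.

End Herglotz.

(** On the compact circle the maximum of |phi| is attained, hence below 1; the maximum modulus
    principle carries the bound inside. *)
Lemma cabs_lt1_on_disk (phi : R[i] -> R[i]) (q : R) : holo_in 1 phi ->
  (forall z, cabs z < 1 -> cabs (phi z) < 1) -> 0 < q < 1 ->
  exists2 m, m < 1 & forall z, cabs z < q -> cabs (phi z) <= m.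
Proof.
move=> hphi phi1 /andP[q0 q1].
have cphi := ccont_cabs (ccont_circle 0 (2 * pi) (ltW q0) q1 hphi).
have [|c _ hc] := @EVT_max R (fun t => cabs (phi (circ q t))) 0 (2 * pi) (ltW (twopi_gt0 R)).
  by apply: continuous_in_subspaceT => x; rewrite inE/= in_itv/=; exact: cphi.
exists (cabs (phi (circ q c))); first by apply: phi1; rewrite cabs_circle ?ltW.
move=> z zq; apply: (max_modulus zq q1 hphi) => t t2.
by apply: hc; rewrite in_itv.
Qed.

(* Littlewood's subordination principle: the Poisson integral of [|f|^p] is the
   real part of a holomorphic function, so its composition with [phi] has the
   mean value property. *)
Lemma hp_norm_compo p (phi f : R[i] -> R[i]) : 1 <= p -> holo_in 1 phi ->
  (forall z, cabs z < 1 -> cabs (phi z) < 1) -> holo_in 1 f ->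
  (hp_norm p f <= 1)%E -> (hp_norm p (compo phi f) <= (4 / (1 - cabs (phi 0)))%:E)%E.
Proof.
move=> p1 hphi phi1 hf f1.
have c01 : cabs (0 : R[i]) < 1 by rewrite cabs0.
have a1 := phi1 _ c01; set a := cabs (phi 0) in a1 *.
have a0 : 0 <= a by exact: cabs_ge0.
have d0 : 0 < 1 - a by rewrite subr_gt0.
have hfphi : holo_in 1 (compo phi f).
  by move=> z z1; apply: complex_derivable_comp; [exact: hphi|apply: hf; exact: phi1].
have C1 : 1 <= 4 / (1 - a) by rewrite ler_pdivlMr// mul1r; lra.
apply/hp_norm_leP => //; first by rewrite (le_trans _ C1).
move=> r /andP[r0 r1].
rewrite (le_trans _ (le1r_powR C1 p1))//.
pose q := (1 + r) / 2.
have rq : r < q by rewrite /q; lra.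
have q1 : q < 1 by rewrite /q; lra.
have q0 : 0 < q by apply: le_lt_trans rq.
have q01 : 0 < q < 1 by rewrite q0.
have [m m1 hm] := cabs_lt1_on_disk hphi phi1 q01.
have am : a <= m by apply: hm; rewrite cabs0.
pose s := (1 + m) / 2.
have ms : m < s by rewrite /s; lra.
have s1 : s < 1 by rewrite /s; lra.
have as_ : a < s by apply: le_lt_trans ms.
have s0 : 0 <= s by rewrite (le_trans a0)// ltW.
pose A t := cabs (f (circ s t)) `^ p.
have s01 : 0 <= s < 1 by rewrite s0.
have cA : rcont 0 (2 * pi) A by exact: rcont_hardy.
have A0 t : 0 <= A t by exact: powR_ge0.
have hh : holo_in q (fun z => herglotz s A (phi z)).
  move=> z zq; apply: complex_derivable_comp; first by apply: hphi; exact: lt_trans q1.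
  apply: holo_herglotz => //; apply: le_lt_trans ms; exact: hm.
have rlt t : cabs (phi (circ r t)) < s.
  by apply: le_lt_trans ms; apply: hm; rewrite cabs_circle.
have ch := ccont_circle 0 (2 * pi) r0 rq hh.
pose u t := (2 * pi)^-1 * complex.Re (herglotz s A (phi (circ r t))).
have cu : rcont 0 (2 * pi) u.
  by apply: rcontM; [exact: rcont_cst|exact: (ccont_Re ch)].
have le_u t : 0 <= t <= 2 * pi -> cabs (compo phi f (circ r t)) `^ p <= u t.
  move=> _; rewrite /u Re_herglotz// mulrA mulVf ?gt_eqF ?twopi_gt0// mul1r.
  exact: (powR_cabs_le_poisson p1 (rlt t) s1 hf).
have r01 : 0 <= r < 1 by rewrite r0.
apply: (le_trans (le_circle_mean (rcont_hardy p1 r01 hfphi) cu le_u)).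
have mu_ : circle_mean u = circle_mean (fun t => A t * poisson s (phi 0) t).
  move: r0; rewrite le_eqVlt => /predU1P[r0|r0].
    rewrite -[RHS]circle_mean_cst; apply: eq_circle_mean => t.
    by rewrite /u -r0 mul0r Re_herglotz// mulrA mulVf ?gt_eqF ?twopi_gt0// mul1r.
  have /(congr1 (@complex.Re R)) := mean_value r0 rq hh.
  rewrite [LHS]/=.
  have -> : complex.Re (herglotz s A (phi 0) * (2 * pi)%:C%C) =
      2 * pi * complex.Re (herglotz s A (phi 0)).
    by case: (herglotz _ _ _) => x y /=; rewrite mulr0 subr0 mulrC.
  rewrite Re_herglotz// /u => E; rewrite circle_meanZ; last exact: (ccont_Re ch).
  by rewrite {1}/circle_mean E 2?mulKf// gt_eqF// twopi_gt0.
rewrite mu_.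
have Am : circle_mean A <= 1.
  by have /(hp_norm_leP p1 ler01 hf) := f1; rewrite powR1; apply.
apply: (@le_trans _ _ (4 / (1 - a) * circle_mean A)); last first.
  by rewrite ler_piMr// (le_trans _ C1).
rewrite -circle_meanZ//; apply: le_circle_mean.
- by apply: rcontM => //; exact: rcont_poisson.
- by apply: rcontM => //; exact: rcont_cst.
- move=> t _; rewrite mulrC ler_wpM2r// (le_trans (poisson_le as_ t))// -/a.
  have sa : 0 < s - a by rewrite subr_gt0.
  rewrite ler_pdivlMr// mulrAC ler_pdivrMr//.
  have : (s + a) * (1 - a) <= 2 * (1 - a) by rewrite ler_pM2r//; lra.
  have : (1 - a) / 2 <= s - a by rewrite /s; lra.
  lra.
Qed.

End Subordination.

(** * Pseudo-hyperbolic distance and Fekete products *)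

Section PseudoHyperbolic.
Variable R : realType.
Implicit Types a z w : R[i].

Definition rho z w : R := cabs (z - w) / cabs (1 - (w^*)%C * z).

Lemma cabs_1BM_ge z w : 1 - cabs w * cabs z <= cabs (1 - (w^*)%C * z).
Proof. by rewrite (le_trans _ (ge_cabsB _ _))// cabs1 cabsM cabsJ. Qed.

Lemma mul_cabs_lt1 z w : cabs z < 1 -> cabs w < 1 -> cabs w * cabs z < 1.
Proof.
move=> z1 w1; rewrite (le_lt_trans _ w1)// ler_piMr ?cabs_ge0//.
exact: ltW.
Qed.

Lemma cabs_1BM_gt0 z w : cabs z < 1 -> cabs w < 1 -> 0 < cabs (1 - (w^*)%C * z).
Proof.
move=> z1 w1; rewrite (lt_le_trans _ (cabs_1BM_ge _ _))// subr_gt0.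
exact: mul_cabs_lt1.
Qed.

Lemma oneBM_neq0 z w : cabs z < 1 -> cabs w < 1 -> 1 - (w^*)%C * z != 0.
Proof. by move=> z1 w1; rewrite -cabs_gt0 cabs_1BM_gt0. Qed.

Lemma rho_ge0 z w : 0 <= rho z w.
Proof. by rewrite divr_ge0// cabs_ge0. Qed.

Lemma rhoC z w : rho z w = rho w z.
Proof.
rewrite /rho cabsBC; congr (_ / _).
by rewrite -[LHS]cabsJ conj_1BM conjcK mulrC.
Qed.

Lemma rho_gt0 z w : cabs z < 1 -> cabs w < 1 -> z != w -> 0 < rho z w.
Proof.
by move=> z1 w1 zw; rewrite divr_gt0 ?cabs_1BM_gt0// cabs_gt0 subr_eq0.
Qed.

Lemma rhozz z : rho z z = 0.
Proof. by rewrite /rho subrr cabs0 mul0r. Qed.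

Lemma sqr_1BM_sub z w : cabs (1 - (w^*)%C * z) ^+ 2 - cabs (z - w) ^+ 2 =
  (1 - cabs z ^+ 2) * (1 - cabs w ^+ 2).
Proof. by rewrite !sqr_cabs; case: z w => a b [c d] /=; ring. Qed.

Lemma oneB_sqr_rho z w : cabs z < 1 -> cabs w < 1 ->
  1 - rho z w ^+ 2 = (1 - cabs z ^+ 2) * (1 - cabs w ^+ 2) / cabs (1 - (w^*)%C * z) ^+ 2.
Proof.
move=> z1 w1; have d0 := cabs_1BM_gt0 z1 w1.
by rewrite -sqr_1BM_sub /rho expr_div_n mulrBl divff// expf_neq0// gt_eqF.
Qed.

Lemma oneB_sqr_gt0 z : cabs z < 1 -> 0 < 1 - cabs z ^+ 2.
Proof. by move=> z1; rewrite subr_gt0 expr_lt1// cabs_ge0. Qed.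

Lemma rho_lt1 z w : cabs z < 1 -> cabs w < 1 -> rho z w < 1.
Proof.
move=> z1 w1; rewrite -(@expr_lt1 _ 2) ?rho_ge0// -subr_gt0 oneB_sqr_rho//.
by rewrite divr_gt0 ?exprn_gt0 ?cabs_1BM_gt0// mulr_gt0 ?oneB_sqr_gt0.
Qed.

Lemma rho_le1 z w : cabs z < 1 -> cabs w < 1 -> rho z w <= 1.
Proof. by move=> z1 w1; rewrite ltW// rho_lt1. Qed.

(** For given moduli 1 - rho^2 decreases in |1 - w^* z|, so the distance is least when [z] and [w]
    lie on one ray. *)
Lemma rho_ge_cabs z w : cabs z < 1 -> cabs w < 1 ->
  `|cabs z - cabs w| / (1 - cabs w * cabs z) <= rho z w.
Proof.
move=> z1 w1; set x := cabs z; set y := cabs w.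
have x0 : 0 <= x by exact: cabs_ge0.
have y0 : 0 <= y by exact: cabs_ge0.
have yx : 0 < 1 - y * x by rewrite subr_gt0 mul_cabs_lt1.
have d0 := cabs_1BM_gt0 z1 w1.
rewrite -(@ler_pXn2r _ 2) ?nnegrE ?rho_ge0 ?divr_ge0 ?(ltW yx)//.
rewrite -[leRHS](subKr 1) oneB_sqr_rho// expr_div_n real_normK ?num_real//.
rewrite lerBrDr -lerBrDl.
have -> : 1 - (x - y) ^+ 2 / (1 - y * x) ^+ 2 = (1 - x ^+ 2) * (1 - y ^+ 2) / (1 - y * x) ^+ 2.
  by field; rewrite gt_eqF.
rewrite ler_wpM2l ?mulr_ge0 ?(ltW (oneB_sqr_gt0 _))//.
rewrite lef_pV2 ?posrE ?exprn_gt0// ler_pXn2r ?nnegrE ?(ltW yx) ?cabs_ge0//.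
exact: cabs_1BM_ge.
Qed.

Lemma rho_ge_dist z w : cabs z < 1 -> cabs w < 1 -> `|cabs z - cabs w| <= rho z w.
Proof.
move=> z1 w1; rewrite (le_trans _ (rho_ge_cabs z1 w1))// ler_pdivlMr.
  by rewrite ler_piMr// lerBlDr lerDl mulr_ge0 ?cabs_ge0.
by rewrite subr_gt0 mul_cabs_lt1.
Qed.

Definition moebius a z : R[i] := (z - a) / (1 - (a^*)%C * z).

Lemma cabs_moebius a z : cabs (moebius a z) = rho z a.
Proof. by rewrite cabs_div. Qed.

Lemma complex_derivable_moebius a z : cabs a < 1 -> cabs z < 1 ->
  complex_derivable (moebius a) z.
Proof.
move=> a1 z1; apply: complex_derivableM.
  by apply: complex_derivableB; [exact: complex_derivable_id|exact: complex_derivable_cst].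
apply: complex_derivableV; first exact: oneBM_neq0.
apply: complex_derivableB; first exact: complex_derivable_cst.
by apply: complex_derivableM; [exact: complex_derivable_cst|exact: complex_derivable_id].
Qed.

Lemma moebiusB a z w : cabs a < 1 -> cabs z < 1 -> cabs w < 1 ->
  moebius a z - moebius a w =
  (z - w) * (1 - a * (a^*)%C) / ((1 - (a^*)%C * z) * (1 - (a^*)%C * w)).
Proof.
move=> a1 z1 w1; rewrite /moebius.
move: (oneBM_neq0 z1 a1) (oneBM_neq0 w1 a1); move: (a^*)%C => b h1 h2.
by field; rewrite h1 h2.
Qed.

Lemma rho_moebius a z w : cabs a < 1 -> cabs z < 1 -> cabs w < 1 ->
  rho (moebius a z) (moebius a w) = rho z w.
Proof.
move=> a1 z1 w1; have za := oneBM_neq0 z1 a1; have wa := oneBM_neq0 w1 a1.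
have az := oneBM_neq0 a1 z1; have aw := oneBM_neq0 a1 w1.
have zw := oneBM_neq0 z1 w1.
have aa : 1 - a * (a^*)%C != 0 by rewrite mulrC oneBM_neq0.
have E : 1 - ((moebius a w)^*)%C * moebius a z =
   (1 - a * (a^*)%C) * (1 - (w^*)%C * z) / ((1 - (w^*)%C * a) * (1 - (a^*)%C * z)).
  rewrite /moebius conjcM conjc_inv conjcB conj_1BM conjcK.
  move: aw za; rewrite [(w^*)%C * a]mulrC; move: (a^*)%C (w^*)%C => b v h1 h2.
  by field; rewrite h1 h2.
rewrite /rho E moebiusB// !cabs_div !cabsM.
have -> : cabs (1 - (w^*)%C * a) = cabs (1 - (a^*)%C * w).
  by rewrite -[LHS]cabsJ conj_1BM conjcK mulrC.
move: za wa zw aa; rewrite -!cabs_eq0.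
move: (cabs (1 - (a^*)%C * z)) (cabs (1 - (a^*)%C * w)) (cabs (1 - (w^*)%C * z)).
move: (cabs (1 - a * (a^*)%C)) => k l m n h1 h2 h3 h4.
by field; rewrite h1 h2 h3 h4.
Qed.

(** Invariance under [moebius a] moves [a] to 0, where [rho] is the modulus and [rho_ge_dist]
    applies. *)
Lemma rho_dist a z w : cabs a < 1 -> cabs z < 1 -> cabs w < 1 ->
  `|rho z a - rho w a| <= rho z w.
Proof.
move=> a1 z1 w1; rewrite -(rho_moebius a1 z1 w1) -(cabs_moebius a z) -(cabs_moebius a w).
by apply: rho_ge_dist; rewrite cabs_moebius rho_lt1.
Qed.

Lemma rho_triangle a z w : cabs a < 1 -> cabs z < 1 -> cabs w < 1 ->
  rho z w <= rho z a + rho a w.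
Proof.
move=> a1 z1 w1; have := rho_dist w1 z1 a1.
by rewrite ler_norml lerBlDr => /andP[].
Qed.

End PseudoHyperbolic.

Section FeketeProducts.
Variable R : realType.
Implicit Types (z : nat -> R[i]) (E : set R[i]).

Definition fekete_prod (n : nat) z : R := \prod_(i < n) \prod_(j < i) rho (z i) (z j).

Lemma fekete_prodS n z :
  fekete_prod n.+1 z = fekete_prod n z * \prod_(j < n) rho (z n) (z j).
Proof. by rewrite /fekete_prod big_ord_recr. Qed.

Lemma fekete_prod_le1 n z : (forall i, (i < n)%N -> cabs (z i) < 1) -> fekete_prod n z <= 1.
Proof.
move=> z1; apply: prodr_ile1 => i _; apply/andP; split.
  by apply: prodr_ge0 => j _; exact: rho_ge0.
apply: prodr_ile1 => j _; rewrite rho_ge0 rho_le1 ?z1//.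
exact: ltn_trans (ltn_ord j) (ltn_ord i).
Qed.

Lemma eq_fekete_prod n z z' : (forall i, (i < n)%N -> z i = z' i) ->
  fekete_prod n z = fekete_prod n z'.
Proof.
move=> zz; apply: eq_bigr => i _; apply: eq_bigr => j _; rewrite !zz//.
exact: ltn_trans (ltn_ord j) (ltn_ord i).
Qed.

Lemma prod_bump n j (F : nat -> R) : (j <= n)%N ->
  \prod_(i < n.+1) F i = F j * \prod_(i < n) F (bump j i).
Proof.
by move=> jn; rewrite (@bigD1_ord _ _ _ _ (Ordinal (jn : (j < n.+1)%N)) xpredT).
Qed.

(** [z \o bump j] is the family without its [j]-th point. *)
Lemma fekete_prod_remove n j z : (j <= n)%N -> fekete_prod n.+1 z =
  fekete_prod n (z \o bump j) * \prod_(i < n) rho (z j) (z (bump j i)).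
Proof.
elim: n => [|n ih]; first by rewrite fekete_prodS /fekete_prod !big_ord0.
rewrite leq_eqVlt => /predU1P[->|]; last rewrite ltnS => jn.
  have b i : (i < n.+1)%N -> bump n.+1 i = i by move=> i1; rewrite /bump leqNgt i1.
  rewrite fekete_prodS; congr (_ * _).
    by apply: eq_fekete_prod => i i1 /=; rewrite b.
  by apply: eq_bigr => i _; rewrite b.
rewrite fekete_prodS ih// (prod_bump (fun i => rho (z n.+1) (z i)) jn).
rewrite fekete_prodS big_ord_recr/=.
have -> : bump j n = n.+1 by rewrite /bump jn.
by rewrite [rho (z j) (z n.+1)]rhoC; ring.
Qed.

Definition fekete_set n E : set R :=
  [set fekete_prod n z | z in [set z | forall i, (i < n)%N -> E (z i)]].

Definition fekete n E : R := sup (fekete_set n E).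

Section Fekete.
Variable E : set R[i].
Hypothesis E1 : E `<=` disk.

Let Eub n : has_ubound (fekete_set n E).
Proof.
by exists 1 => _ [z hz <-]; apply: fekete_prod_le1 => i /hz /E1.
Qed.

Lemma fekete_prod_le n z : (forall i, (i < n)%N -> E (z i)) -> fekete_prod n z <= fekete n E.
Proof. by move=> hz; apply: ub_le_sup => //; exists z. Qed.

(** [E] need not be closed, so the supremum need not be attained; the factor 2 disappears in the
    n-th root. Positivity excludes the empty family, whose [sup] is 0 by convention. *)
Lemma fekete_near n : 0 < fekete n E ->
  exists2 z, forall i, (i < n)%N -> E (z i) & fekete n E / 2 < fekete_prod n z.
Proof.
move=> D0; have h2 : 0 < fekete n E / 2 by rewrite divr_gt0.
have hs : has_sup (fekete_set n E).
  split => //; apply: contrapT => /set0P/negP/negPn/eqP h.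
  by move: D0; rewrite /fekete h sup0 ltxx.
have [_ [z hz <-] lt] := sup_adherent h2 hs; exists z => //.
by move: lt; rewrite -/(fekete n E) {1}[fekete n E]splitr addrK.
Qed.

(** Adjoining [w] to an almost extremal family gives [n.+1] points, whose product is at most
    [fekete n.+1 E]. *)
Lemma blaschke_small n z w : fekete n E / 2 < fekete_prod n z -> 0 < fekete n E ->
  (forall i, (i < n)%N -> E (z i)) -> E w ->
  \prod_(j < n) rho w (z j) <= 2 * (fekete n.+1 E / fekete n E).
Proof.
move=> nz D0 hz Ew; pose z' i := if (i < n)%N then z i else w.
have : fekete_prod n.+1 z' <= fekete n.+1 E.
  apply: fekete_prod_le => i; rewrite ltnS leq_eqVlt /z' => /predU1P[->|i1].
    by rewrite ltnn.
  by rewrite i1; exact: hz.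
rewrite fekete_prodS (@eq_fekete_prod n z' z); last by move=> i i1; rewrite /z' i1.
rewrite (_ : \prod_(j < n) _ = \prod_(j < n) rho w (z j)); last first.
  by apply: eq_bigr => j _; rewrite /z' ltnn ltn_ord.
set b := \prod_(j < n) _ => h.
have b0 : 0 <= b by apply: prodr_ge0 => j _; exact: rho_ge0.
rewrite mulrA ler_pdivlMr//.
have : fekete n E / 2 * b <= fekete n.+1 E by rewrite (le_trans _ h)// ler_wpM2r// ltW.
lra.
Qed.

(** The [n] points left after removing [z j] have product at most [fekete n E], so the removed
    factor cannot be small. *)
Lemma fekete_separated n z j : fekete n.+1 E / 2 < fekete_prod n.+1 z ->
  0 < fekete n E -> (forall i, (i < n.+1)%N -> E (z i)) -> (j <= n)%N ->
  fekete n.+1 E / fekete n E / 2 <= \prod_(i < n) rho (z j) (z (bump j i)).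
Proof.
move=> nz D0 hz jn; set b := \prod_(i < n) _.
have b0 : 0 <= b by apply: prodr_ge0 => i _; exact: rho_ge0.
rewrite mulrAC ler_pdivrMr// (le_trans (ltW nz))// (fekete_prod_remove _ jn) mulrC.
rewrite ler_wpM2l//; apply: fekete_prod_le => i i_n; apply: hz => /=.
by rewrite /bump; case: (j <= i)%N; rewrite ?add1n ?add0n ?ltnS// ltnW.
Qed.

End Fekete.
End FeketeProducts.

(** * Approximation numbers and Blaschke products *)

Section TakenakaMalmquist.
Variable R : realType.
Implicit Types (z : nat -> R[i]) (w x : R[i]).

Definition blaschke (n : nat) z w : R[i] := \prod_(j < n) moebius (z j) w.

Lemma cabs_blaschke n z w : cabs (blaschke n z w) = \prod_(j < n) rho w (z j).
Proof. by rewrite cabs_prod; apply: eq_bigr => j _; rewrite cabs_moebius. Qed.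

Lemma blaschkeS n z w : blaschke n.+1 z w = blaschke n z w * moebius (z n) w.
Proof. by rewrite /blaschke big_ord_recr. Qed.

Lemma complex_derivable_blaschke n z w : (forall j, (j < n)%N -> cabs (z j) < 1) ->
  cabs w < 1 -> complex_derivable (blaschke n z) w.
Proof.
move=> z1 w1; apply: complex_derivable_prod => j _.
by apply: complex_derivable_moebius => //; exact: z1.
Qed.

Lemma cabs_blaschke_le1 n z w : (forall j, (j < n)%N -> cabs (z j) < 1) ->
  cabs w < 1 -> cabs (blaschke n z w) <= 1.
Proof.
move=> z1 w1; rewrite cabs_blaschke; apply: prodr_ile1 => j _.
by rewrite rho_ge0 rho_le1 ?z1.
Qed.

(** The Takenaka-Malmquist function of index [k], scaled so that with [tm_dual] it expands the
    Cauchy kernel. *)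
Definition tm_fun (k : nat) z w : R[i] :=
  blaschke k z w * (1 - z k * (z k)^*%C) / (1 - (z k)^*%C * w).

Definition tm_dual (k : nat) z x : R[i] := (blaschke k z x * (x - z k))^-1.

(** The sum telescopes: its term of index k is the difference of the remainders B_k(w) / (B_k(x) (x
    - w)) at k and k + 1, where B_k is [blaschke k z]. *)
Lemma tm_expansion n z x w : (forall j, (j < n)%N -> cabs (z j) < 1) ->
  cabs w < 1 -> cabs x < 1 -> x != w -> (forall j, (j < n)%N -> x != z j) ->
  (x - w)^-1 - \sum_(k < n) tm_fun k z w * tm_dual k z x =
  blaschke n z w / blaschke n z x / (x - w).
Proof.
move=> + w1 x1 xw; elim: n => [|n ih] z1 xz.
  by rewrite big_ord0 subr0 /blaschke !big_ord0 divr1 mul1r.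
rewrite big_ord_recr/= opprD addrA ih; last 2 first.
- by move=> j jn; apply: z1; rewrite ltnS ltnW.
- by move=> j jn; apply: xz; rewrite ltnS ltnW.
have zn := z1 n (ltnSn n); have xn := xz n (ltnSn n).
have B0 : blaschke n z x != 0.
  rewrite -cabs_gt0 cabs_blaschke; apply: prodr_gt0 => j _.
  by rewrite rho_gt0// ?z1 ?xz// ltnS ltnW.
rewrite /tm_fun /tm_dual !blaschkeS /moebius.
move: (oneBM_neq0 w1 zn) (oneBM_neq0 x1 zn) xw xn B0.
rewrite -!(subr_eq0 x).
move: (blaschke n z x) (blaschke n z w) (z n) => B C a h1 h2 h3 h4 h5.
move: h1 h2; move: (a^*)%C => b h1 h2.
by field; rewrite h1 h2 h3 h4 h5.
Qed.

End TakenakaMalmquist.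

(** * Upper estimate by interpolation *)

Section UpperBound.
Variables (R : realType) (p : R) (phi : R[i] -> R[i]) (r0 s : R) (n : nat) (z : nat -> R[i]).
Hypothesis p1 : 1 <= p.
Hypothesis hphi : holo_in 1 phi.
Hypothesis phi_le : forall x, cabs x < 1 -> cabs (phi x) <= r0.
Hypothesis z_le : forall j, (j < n)%N -> cabs (z j) <= r0.
Hypothesis r0s : r0 < s.
Hypothesis s1 : s < 1.
Local Notation circ s t := (s%:C%C * cexpi t).
Local Notation mu := (@lebesgue_measure R).

Let r00 : 0 <= r0.
Proof. by apply: le_trans (cabs_ge0 _) (phi_le (_ : cabs 0 < 1)); rewrite cabs0. Qed.
Let s0 : 0 < s. Proof. exact: le_lt_trans r0s. Qed.
Let r01 : r0 < 1. Proof. exact: lt_trans s1. Qed.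

Let z1 j : (j < n)%N -> cabs (z j) < 1.
Proof. by move=> jn; rewrite (le_lt_trans (z_le jn)). Qed.

Let phi1 x : cabs x < 1 -> cabs (phi x) < 1.
Proof. by move=> x1; rewrite (le_lt_trans (phi_le x1)). Qed.

Let circ_gt w t : cabs w <= r0 -> circ s t - w != 0.
Proof.
move=> wr; rewrite -cabs_gt0 (lt_le_trans _ (ge_cabsB _ _))// cabs_circle ?(ltW s0)//.
by rewrite subr_gt0 (le_lt_trans wr).
Qed.

(** The pseudo-hyperbolic distance from the circle of radius [s] to the disk of radius [r0], which
    contains the image and the nodes. *)
Let sig := (s - r0) / (1 - s * r0).

Let sig_gt0 : 0 < sig.
Proof. by rewrite divr_gt0 ?subr_gt0// mulr_ilt1// ltW. Qed.

Let rho_circ w t : cabs w <= r0 -> sig <= rho (circ s t) w.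
Proof.
move=> wr; have w1 : cabs w < 1 by rewrite (le_lt_trans wr).
have cc : cabs (circ s t) = s by rewrite cabs_circle// ltW.
have c1 : cabs (circ s t) < 1 by rewrite cc.
rewrite (le_trans _ (rho_ge_cabs c1 w1))// cc.
have sw : 0 <= s - cabs w by rewrite subr_ge0 (le_trans wr)// ltW.
have d1 : 0 < 1 - s * r0 by rewrite subr_gt0 mulr_ilt1// ltW.
have d2 : 0 < 1 - cabs w * s by rewrite subr_gt0 mulr_ilt1 ?cabs_ge0// ltW.
rewrite ger0_norm// /sig ler_pdivrMr// mulrAC ler_pdivlMr//.
rewrite -subr_ge0 (_ : _ - _ = (1 - s ^+ 2) * (r0 - cabs w)); last by ring.
by rewrite mulr_ge0 ?subr_ge0// expr_le1 ?ltW// ltW.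
Qed.

Let blaschke_circ k t : (k <= n)%N -> sig ^+ k <= cabs (blaschke k z (circ s t)).
Proof.
move=> kn; rewrite cabs_blaschke -[k in sig ^+ k]card_ord -prodr_const.
apply: ler_prod => j _; rewrite (ltW sig_gt0) rho_circ// z_le//.
exact: leq_trans (ltn_ord j) kn.
Qed.

Let blaschke_circ_neq0 k t : (k <= n)%N -> blaschke k z (circ s t) != 0.
Proof. by move=> kn; rewrite -cabs_gt0 (lt_le_trans _ (blaschke_circ t kn))// exprn_gt0. Qed.

Let ccont_blaschke k a b : (k <= n)%N -> ccont a b (fun t => blaschke k z (circ s t)).
Proof.
move=> kn; apply: (@ccont_circle R 1) => //; first exact: ltW.
move=> x x1; apply: complex_derivable_blaschke => // j jk.
by apply: z1; exact: leq_trans jk kn.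
Qed.

Let ccont_dual k a b : (k < n)%N -> ccont a b (fun t => tm_dual k z (circ s t)).
Proof.
move=> kn; apply: ccontV.
  by move=> t _; rewrite mulf_neq0 ?blaschke_circ_neq0 ?circ_gt ?z_le// ltnW.
apply: ccontM; first by apply: ccont_blaschke; exact: ltnW.
by apply: ccontB; [exact: ccont_circ|exact: ccont_cst].
Qed.

Let coef (f : R[i] -> R[i]) k : R[i] :=
  ((2 * pi)^-1)%:C%C * cint 0 (2 * pi) (fun t => f (circ s t) * (circ s t * tm_dual k z (circ s t))).

(** Cauchy's formula for [f (phi x)] with the kernel cut after [n] terms of its expansion; the error
    then carries the factor [blaschke n z (phi x)]. *)
Let S (f : R[i] -> R[i]) (x : R[i]) : R[i] := \sum_(k < n) coef f k * tm_fun k z (phi x).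

Let ccont_f f a b : holo_in 1 f -> ccont a b (fun t => f (circ s t)).
Proof. by move=> hf; apply: (@ccont_circle R 1) => //; exact: ltW. Qed.

Let ccont_coef f k a b : holo_in 1 f -> (k < n)%N ->
  ccont a b (fun t => f (circ s t) * (circ s t * tm_dual k z (circ s t))).
Proof.
move=> hf kn; apply: ccontM; first exact: ccont_f.
by apply: ccontM; [exact: ccont_circ|exact: ccont_dual].
Qed.

Let holo_tm k : (k < n)%N -> holo_in 1 (fun x => tm_fun k z (phi x)).
Proof.
move=> kn x x1; apply: (@complex_derivable_comp _ (tm_fun k z)); first exact: hphi.
apply: complex_derivableM; last first.
  apply: complex_derivableV; first by apply: oneBM_neq0; [exact: phi1|exact: z1].
  apply: complex_derivableB; first exact: complex_derivable_cst.
  by apply: complex_derivableM; [exact: complex_derivable_cst|exact: complex_derivable_id].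
apply: complex_derivableM; last exact: complex_derivable_cst.
apply: complex_derivable_blaschke; last exact: phi1.
by move=> j jk; apply: z1; exact: ltn_trans jk kn.
Qed.

Let tm_le k x : (k < n)%N -> cabs x < 1 -> cabs (tm_fun k z (phi x)) <= 2 / (1 - r0).
Proof.
move=> kn x1; have d0 : 0 < 1 - r0 by rewrite subr_gt0.
have h : 1 - r0 <= cabs (1 - (z k)^*%C * phi x).
  rewrite (le_trans _ (cabs_1BM_ge _ _))// lerD2l lerN2.
  rewrite -[leRHS]mulr1 ler_pM ?cabs_ge0 ?z_le//.
  by rewrite ltW// phi1.
rewrite /tm_fun cabs_div cabsM ler_pM ?mulr_ge0 ?cabs_ge0 ?invr_ge0 ?cabs_ge0//; last first.
  by rewrite lef_pV2 ?posrE// (lt_le_trans d0).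
rewrite -[leRHS]mul1r ler_pM ?cabs_ge0//.
  apply: cabs_blaschke_le1; last exact: phi1.
  by move=> j jk; apply: z1; exact: ltn_trans jk kn.
rewrite (le_trans (le_cabsB _ _))// cabs1 cabsM cabsJ.
have : cabs (z k) * cabs (z k) <= 1 by rewrite mulr_ile1 ?cabs_ge0// ltW// z1.
lra.
Qed.

Let holo_S f : holo_in 1 (S f).
Proof.
move=> x x1; apply: complex_derivable_sum => k _.
by apply: complex_derivableM; [exact: complex_derivable_cst|exact: holo_tm].
Qed.

Let hardy_bounded f M : holo_in 1 f -> (forall x, cabs x < 1 -> cabs (f x) <= M) -> hardy p f.
Proof.
move=> hf hM; split; first exact/holo_on_diskP.
have M0 : 0 <= M by apply: le_trans (hM 0 _); rewrite ?cabs_ge0// cabs0.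
exact: le_lt_trans (hp_norm_le p1 M0 hf hM) (ltry _).
Qed.

Let S_rank : linear_rank_lt p S n.+1.
Proof.
split=> [f [/holo_on_diskP hf _]|].
  apply: (@hardy_bounded _ (\sum_(k < n) cabs (coef f k) * (2 / (1 - r0)))) => //.
  move=> x x1; rewrite (le_trans (cabs_sum _ _ _))//; apply: ler_sum => k _.
  by rewrite cabsM ler_wpM2l ?cabs_ge0// tm_le.
split.
  move=> a f g [/holo_on_diskP hf _] [/holo_on_diskP hg _] x x1.
  rewrite /S mulr_sumr -big_split/=; apply: eq_bigr => k _.
  rewrite mulrA -mulrDl; congr (_ * _); rewrite /coef mulrCA -mulrDr; congr (_ * _).
  rewrite -cintZ; last exact: ccont_coef.
  rewrite -cintD; last 2 first.
  - by apply: ccontM; [exact: ccont_cst|exact: ccont_coef].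
  - exact: ccont_coef.
  by apply: eq_cint => t _; ring.
exists n; split => //; exists (fun k x => tm_fun k z (phi x)); split.
  by move=> k; apply: (@hardy_bounded _ (2 / (1 - r0))) => [|x x1]; [exact: holo_tm|exact: tm_le].
by move=> f _; exists (fun k => coef f k).
Qed.

Let S_error f x : holo_in 1 f -> cabs x < 1 ->
  f (phi x) - S f x = ((2 * pi)^-1)%:C%C * cint 0 (2 * pi) (fun t => f (circ s t) *
    (circ s t * (blaschke n z (phi x) / blaschke n z (circ s t) / (circ s t - phi x)))).
Proof.
move=> hf x1; have wr := phi_le x1; set w := phi x in wr *.
have ws : cabs w < s by rewrite (le_lt_trans wr).
have pn0 : (2 * pi)%:C%C != 0 :> R[i] by rewrite -cabs_gt0 cabs_twopi twopi_gt0.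
have -> : f w = ((2 * pi)^-1)%:C%C *
    cint 0 (2 * pi) (fun t => f (circ s t) * (circ s t / (circ s t - w))).
  by rewrite (cauchy_formula ws s1 hf) fmorphV/= mulrCA mulVf ?mulr1.
have ck : ccont 0 (2 * pi) (fun t => f (circ s t) * (circ s t / (circ s t - w))).
  apply: ccontM; first exact: ccont_f.
  apply: ccontM; first exact: ccont_circ.
  apply: ccontV; first by move=> t _; exact: circ_gt.
  by apply: ccontB; [exact: ccont_circ|exact: ccont_cst].
(* Additivity of [cint] requires continuous summands, so continuity of the partial sums is carried
   through the induction. *)
have csum m : (m <= n)%N -> ccont 0 (2 * pi) (fun t => \sum_(k < m)
      tm_fun k z w * (f (circ s t) * (circ s t * tm_dual k z (circ s t)))) /\
    cint 0 (2 * pi) (fun t => \sum_(k < m)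
      tm_fun k z w * (f (circ s t) * (circ s t * tm_dual k z (circ s t)))) =
    \sum_(k < m) tm_fun k z w *
      cint 0 (2 * pi) (fun t => f (circ s t) * (circ s t * tm_dual k z (circ s t))).
  elim: m => [_|m ih mn].
    split.
      by under eq_fun do rewrite big_ord0; exact: ccont_cst.
    rewrite big_ord0 (@eq_cint _ _ _ _ (fun=> 0)); last by move=> t _; rewrite big_ord0.
    by rewrite cint_cst ?mul0r// ltW// twopi_gt0.
  have [c1 c2] := ih (ltnW mn).
  have c3 : ccont 0 (2 * pi) (fun t =>
      tm_fun m z w * (f (circ s t) * (circ s t * tm_dual m z (circ s t)))).
    by apply: ccontM; [exact: ccont_cst|exact: ccont_coef].
  split; first by under eq_fun do rewrite big_ord_recr; exact: ccontD.
  rewrite big_ord_recr/= -c2 -cintZ; last exact: ccont_coef.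
  rewrite -cintD//.
  by apply: eq_cint => t _; rewrite big_ord_recr.
have [cs E] := csum n (leqnn n).
have -> : S f x = ((2 * pi)^-1)%:C%C * \sum_(k < n) tm_fun k z w *
    cint 0 (2 * pi) (fun t => f (circ s t) * (circ s t * tm_dual k z (circ s t))).
  by rewrite /S mulr_sumr; apply: eq_bigr => k _; rewrite /coef -/w; ring.
rewrite -E -mulrBr -cintB//; congr (_ * _); apply: eq_cint => t _.
have c1 : cabs (circ s t) < 1 by rewrite cabs_circle// ltW.
rewrite -(tm_expansion z1 (phi1 x1) c1) -/w; last 2 first.
- by rewrite -subr_eq0 circ_gt.
- by move=> j jn; rewrite -subr_eq0 circ_gt// z_le.
rewrite !mulrBr; congr (_ - _); rewrite !mulr_sumr; apply: eq_bigr => k _.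
by ring.
Qed.

(** The remainder kernel has a numerator of at most [beta], a Blaschke product of at least
    [sig ^+ n] on the circle, and a distance of at least [s - r0] from the circle to the image. *)
Lemma approx_num_le (beta : R) :
  (forall x, cabs x < 1 -> \prod_(j < n) rho (phi x) (z j) <= beta) ->
  (approx_num p (compo phi) n.+1 <=
    (beta / ((s - r0) / (1 - s * r0)) ^+ n / (s - r0))%:E)%E.
Proof.
move=> hb; have sr : 0 < s - r0 by rewrite subr_gt0.
have b0 : 0 <= beta.
  apply: le_trans (hb 0 _); last by rewrite cabs0.
  by apply: prodr_ge0 => j _; exact: rho_ge0.
set M := beta / _ / _.
have M0 : 0 <= M by rewrite !divr_ge0// ?exprn_ge0 ?(ltW sr) ?(ltW sig_gt0).
apply: (@le_trans _ _ (opnorm_diff p (compo phi) S)).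
  by apply: ereal_inf_lbound; exists S.
apply: ge_ereal_sup => _ [f [[/holo_on_diskP hf _] f1] <-].
have hfphi : holo_in 1 (fun x => compo phi f x - S f x).
  move=> x x1; apply: complex_derivableB; last exact: holo_S.
  by apply: complex_derivable_comp; [exact: hphi|apply: hf; exact: phi1].
apply: hp_norm_le => // x x1; rewrite S_error//.
have cK : ccont 0 (2 * pi) (fun t => f (circ s t) *
    (circ s t * (blaschke n z (phi x) / blaschke n z (circ s t) / (circ s t - phi x)))).
  apply: ccontM; first exact: ccont_f.
  apply: ccontM; first exact: ccont_circ.
  apply: ccontM; last first.
    apply: ccontV; first by move=> t _; apply: circ_gt; exact: phi_le.
    by apply: ccontB; [exact: ccont_circ|exact: ccont_cst].
  apply: ccontM; first exact: ccont_cst.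
  by apply: ccontV; [move=> t _; exact: blaschke_circ_neq0|exact: ccont_blaschke].
have p0 := twopi_gt0 R.
have s01 : 0 <= s < 1 by rewrite s1 ltW.
have fm := circle_mean_cabs_le p1 ler01 hf s01 f1.
rewrite cabsM cabs_real ger0_norm ?invr_ge0 ?(ltW p0)//.
apply: (@le_trans _ _ (circle_mean (fun t => M * cabs (f (circ s t))))); last first.
  rewrite circle_meanZ; last by apply: ccont_cabs; exact: ccont_f.
  by rewrite ler_piMr.
rewrite /circle_mean ler_pM2l ?invr_gt0// (le_trans (cabs_cint cK))//.
apply: le_Rintegral => //.
- exact/rcont_integrable/ccont_cabs.
- apply: rcont_integrable; apply: rcontM; first exact: rcont_cst.
  by apply: ccont_cabs; exact: ccont_f.
- move=> t _; rewrite cabsM mulrC ler_wpM2r ?cabs_ge0//.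
  have cc : cabs (circ s t) = s by rewrite cabs_circle// ltW.
  rewrite cabsM cc !cabs_div cabs_blaschke.
  have dw : s - r0 <= cabs (circ s t - phi x).
    rewrite (le_trans _ (ge_cabsB _ _))// cc lerD2l lerN2.
    exact: phi_le.
  have db := blaschke_circ t (leqnn n).
  have sn : 0 < sig ^+ n by rewrite exprn_gt0.
  rewrite -[leRHS]mul1r ler_pM ?(ltW s0) ?(ltW s1)//.
    rewrite !mulr_ge0 ?invr_ge0 ?cabs_ge0//.
    by apply: prodr_ge0 => j _; exact: rho_ge0.
  rewrite /M -/sig ler_pM ?invr_ge0 ?cabs_ge0//.
  + by rewrite mulr_ge0 ?invr_ge0 ?cabs_ge0//; apply: prodr_ge0 => j _; exact: rho_ge0.
  + rewrite ler_pM ?invr_ge0 ?cabs_ge0//.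
    * by apply: prodr_ge0 => j _; exact: rho_ge0.
    * exact: hb.
    * by rewrite lef_pV2 ?posrE// (lt_le_trans sn).
  + by rewrite lef_pV2 ?posrE// (lt_le_trans sr).
Qed.

End UpperBound.

(** * Lower estimate by Lagrange functions *)

Section LowerBound.
Variables (R : realType) (p : R) (phi : R[i] -> R[i]) (r del : R) (n : nat) (c : nat -> R[i]).
Hypothesis p1 : 1 <= p.
Hypothesis hphi : holo_in 1 phi.
Hypothesis phi1 : forall x, cabs x < 1 -> cabs (phi x) < 1.
Hypothesis r1 : r < 1.
Hypothesis c_le : forall j, (j <= n)%N -> cabs (c j) <= r.
Hypothesis del0 : 0 < del.
Let z j := phi (c j).
Hypothesis sep : forall j, (j <= n)%N -> del <= \prod_(i < n) rho (z j) (z (bump j i)).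

Let z1 j : (j <= n)%N -> cabs (z j) < 1.
Proof. by move=> jn; apply: phi1; rewrite (le_lt_trans (c_le jn)). Qed.

Let zb j i : (i < n)%N -> cabs (z (bump j i)) < 1.
Proof.
by move=> i_n; apply: z1; rewrite /bump; case: (j <= i)%N; rewrite ?add1n ?add0n// ltnW.
Qed.

(** Blaschke products replace polynomials in Lagrange interpolation: they are bounded by 1 on the
    disk, so the [L j] are bounded by [del^-1]. *)
Let B j w := blaschke n (z \o bump j) w.
Let L (j : 'I_n.+1) w := B j w / B j (z j).

Let Bz j : (j <= n)%N -> del <= cabs (B j (z j)).
Proof. by move=> jn; rewrite /B cabs_blaschke; exact: sep. Qed.

Let L_le j w : cabs w < 1 -> cabs (L j w) <= del^-1.
Proof.
move=> w1; rewrite cabs_div -[leRHS]mul1r ler_pM ?invr_ge0 ?cabs_ge0//.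
  by apply: cabs_blaschke_le1 => // i i_n; exact: zb.
have h := Bz (leq_ord j); rewrite lef_pV2 ?posrE// (lt_le_trans del0)//.
Qed.

Let holo_L j : holo_in 1 (L j).
Proof.
move=> w w1; apply: complex_derivableM; last exact: complex_derivable_cst.
by apply: complex_derivable_blaschke => // i i_n; exact: zb.
Qed.

Let L_same j : L j (z j) = 1.
Proof.
by rewrite /L divff// -cabs_gt0 (lt_le_trans del0)// Bz// leq_ord.
Qed.

Let L_other j (k : 'I_n.+1) : k != j -> L j (z k) = 0.
Proof.
rewrite eq_sym => /unlift_some[i -> _].
have m0 : moebius (z (bump j i)) (z (bump j i)) = 0 by rewrite /moebius subrr mul0r.
by rewrite /L /B /blaschke (bigD1 i)//= m0 !mul0r.
Qed.

Let hardy_sum (v : 'I_n.+1 -> R[i]) (s : seq 'I_n.+1) :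
  hardy p (fun w => \sum_(j <- s) v j * L j w).
Proof.
have hs : holo_in 1 (fun w => \sum_(j <- s) v j * L j w).
  move=> w w1; apply: complex_derivable_sum => j _.
  by apply: complex_derivableM; [exact: complex_derivable_cst|exact: holo_L].
split; first exact/holo_on_diskP.
have M0 : 0 <= \sum_(j <- s) cabs (v j) * del^-1.
  by apply: sumr_ge0 => j _; rewrite mulr_ge0 ?cabs_ge0// invr_ge0 ltW.
apply: le_lt_trans (hp_norm_le p1 M0 hs _) (ltry _) => w w1.
rewrite (le_trans (cabs_sum _ _ _))//; apply: ler_sum => j _.
by rewrite cabsM ler_wpM2l ?cabs_ge0// L_le.
Qed.

Let S_sum (S : (R[i] -> R[i]) -> R[i] -> R[i]) m (v : 'I_n.+1 -> R[i]) (s : seq 'I_n.+1) x :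
  linear_rank_lt p S m -> cabs x < 1 ->
  S (fun w => \sum_(j <- s) v j * L j w) x = \sum_(j <- s) v j * S (L j) x.
Proof.
move=> [_ [lin _]] x1.
have hL j : hardy p (L j).
  have := hardy_sum (fun=> 1) [:: j].
  by under eq_fun do rewrite big_cons big_nil addr0 mul1r.
elim: s => [|j s ih].
  under eq_fun do rewrite big_nil; rewrite big_nil.
  have h0 : hardy p (fun=> 0).
    by have := hardy_sum (fun=> 1) [::]; under eq_fun do rewrite big_nil.
  (* Linearity is given for [a * f + g] only; applied to 1 * 0 + 0 it yields that [S] kills 0. *)
  have := lin 1 _ _ h0 h0 x x1; under [X in S X]eq_fun do rewrite mulr0 addr0.
  by rewrite mul1r => /eqP; rewrite -subr_eq0 opprD addNKr oppr_eq0 => /eqP.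
rewrite big_cons -ih -lin//.
by under eq_fun do rewrite big_cons.
Qed.

(* Some nonzero combination of the [n.+1] interpolating functions [L j] is killed
   by an operator of rank at most [n]; it is large at one of the points [z j]. *)
Lemma approx_num_ge :
  ((del / n.+1%:R * ((1 - r) / 4))%:E <= approx_num p (compo phi) n.+1)%E.
Proof.
apply: le_ereal_inf_tmp => _ [S rkS <-].
have [hS [lin [m [mn [gs [hgs rk]]]]]] := rkS.
have hL j : hardy p (L j).
  have := hardy_sum (fun=> 1) [:: j].
  by under eq_fun do rewrite big_cons big_nil addr0 mul1r.
have [cc hcc] := @choice 'I_n.+1 ('I_m -> R[i]) (fun j cj => forall x, cabs x < 1 ->
  S (L j) x = \sum_(i < m) cj i * gs i x) (fun j => rk _ (hL j)).
pose A : 'M[R[i]]_(n.+1, m) := \matrix_(j, i) cc j i.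
have : kermx A != 0.
  rewrite -mxrank_eq0 mxrank_ker subn_eq0 -ltnNge.
  by rewrite (leq_ltn_trans (rank_leq_col A)).
move=> /rowV0Pn[v0 /sub_kermxP v0A v0n].
have [j1 hj1] : exists j, v0 0 j != 0.
  apply/existsP; rewrite -negb_forall; apply: contra v0n => /forallP h.
  by apply/eqP/rowP => j; rewrite mxE; apply/eqP; have := h j; rewrite ?negbK.
pose j0 := [arg max_(j > j1) cabs (v0 0 j)]%O.
have hj0 j : cabs (v0 0 j) <= cabs (v0 0 j0).
  by rewrite /j0; case: arg_maxP => // k _; apply.
have M0 : 0 < cabs (v0 0 j0) by rewrite (lt_le_trans _ (hj0 j1))// cabs_gt0.
(* The largest coefficient becomes [del / n.+1%:R], so each of the [n.+1] terms of [f] is at most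
   [n.+1%:R^-1], and [f] has norm at most 1. *)
pose t := del / n.+1%:R / cabs (v0 0 j0).
have n0 : 0 < n.+1%:R :> R by rewrite ltr0n.
have dn0 : 0 < del / n.+1%:R by rewrite divr_gt0.
have t0 : 0 < t by rewrite divr_gt0.
pose v j := t%:C%C * v0 0 j.
have vj0 : cabs (v j0) = del / n.+1%:R.
  by rewrite cabsM cabs_real gtr0_norm// divfK// gt_eqF.
have v_le j : cabs (v j) <= del / n.+1%:R.
  by rewrite -vj0 !cabsM ler_wpM2l ?cabs_ge0.
pose f w := \sum_j v j * L j w.
have hf : hardy p f by exact: hardy_sum.
have f1 : (hp_norm p f <= 1)%E.
  have /holo_on_diskP hof := hf.1.
  apply: (@hp_norm_le _ p f 1) => // w w1; rewrite (le_trans (cabs_sum _ _ _))//.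
  apply: (@le_trans _ _ (\sum_(j : 'I_n.+1) n.+1%:R^-1)).
    apply: ler_sum => j _; rewrite cabsM.
    have -> : n.+1%:R^-1 = del / n.+1%:R * del^-1 :> R by rewrite mulrAC divff ?mul1r// gt_eqF.
    by rewrite ler_pM ?cabs_ge0// L_le.
  by rewrite sumr_const card_ord -[_ *+ _]mulr_natr mulVf// pnatr_eq0.
have Sf x : cabs x < 1 -> S f x = 0.
  move=> x1; rewrite (S_sum _ _ rkS x1).
  under eq_bigr do rewrite hcc// mulr_sumr.
  rewrite exchange_big/= big1// => i _.
  have := congr1 (fun X : 'rV[R[i]]_m => X 0 i) v0A; rewrite !mxE => E.
  rewrite (_ : \sum_(j < n.+1) _ = t%:C%C * gs i x * (\sum_j v0 0 j * A j i)).
    by rewrite E mulr0.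
  by rewrite mulr_sumr; apply: eq_bigr => j _; rewrite /v mxE; ring.
have fz : f (z j0) = v j0.
  rewrite /f (bigD1 j0)//= L_same mulr1 big1 ?addr0// => j jj0.
  by rewrite L_other ?mulr0// eq_sym.
apply: (@le_trans _ _ (hp_norm p (fun x => compo phi f x - S f x))); last first.
  by apply: ereal_sup_ubound; exists f.
have /holo_on_diskP hof := hf.1.
have hg : holo_in 1 (fun x => compo phi f x - S f x).
  move=> x x1; apply: complex_derivableB.
    by apply: complex_derivable_comp; [exact: hphi|apply: hof; exact: phi1].
  by have /holo_on_diskP h := (hS _ hf).1; exact: h.
have := hp_norm_ge0 p (fun x => compo phi f x - S f x).
case E : (hp_norm _ _) => [N| |]//; last by move=> _; rewrite leey.
rewrite lee_fin => N0; rewrite lee_fin.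
have cj := c_le (leq_ord j0).
have := cabs_le_hp_norm p1 N0 hg r1 cj; rewrite E => /(_ (lexx _)).
rewrite Sf ?(le_lt_trans cj)// subr0 /compo -/(z j0) fz vj0.
have d0 : 0 < 1 - r by rewrite subr_gt0.
rewrite -ler_pdivrMl ?divr_gt0// invf_div => h.
by rewrite mulrC.
Qed.

End LowerBound.

(** * Green energy and Fekete products *)

Section MeasurableGreen.
Context {d : measure_display} {T : measurableType d} {R : realType}.
Implicit Types f g : T -> R[i].

Record cmeas f : Prop := CMeas {
  cmeas_Re : measurable_fun setT (fun x => complex.Re (f x)) ;
  cmeas_Im : measurable_fun setT (fun x => complex.Im (f x)) }.

Lemma cmeasB f g : cmeas f -> cmeas g -> cmeas (fun x => f x - g x).
Proof.
move=> [f1 f2] [g1 g2]; split.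
  rewrite (_ : (fun x => _) = (fun x => complex.Re (f x) - complex.Re (g x))).
    exact: measurable_funB.
  by apply/funext => x; case: (f x) (g x) => ? ? [].
rewrite (_ : (fun x => _) = (fun x => complex.Im (f x) - complex.Im (g x))).
  exact: measurable_funB.
by apply/funext => x; case: (f x) (g x) => ? ? [].
Qed.

Lemma cmeas_1BM f g : cmeas f -> cmeas g -> cmeas (fun x => 1 - (g x)^*%C * f x).
Proof.
move=> [f1 f2] [g1 g2]; split.
  rewrite (_ : (fun x => _) = (fun x => 1 - (complex.Re (g x) * complex.Re (f x) +
      complex.Im (g x) * complex.Im (f x)))).
    apply: measurable_funB; first exact: measurable_cst.
    by apply: measurable_funD; exact: measurable_funM.
  by apply/funext => x; case: (f x) (g x) => a b [c e] /=; ring.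
rewrite (_ : (fun x => _) = (fun x => complex.Im (g x) * complex.Re (f x) -
    complex.Re (g x) * complex.Im (f x))).
  by apply: measurable_funB; exact: measurable_funM.
by apply/funext => x; case: (f x) (g x) => a b [c e] /=; ring.
Qed.

Lemma measurable_cabs f : cmeas f -> measurable_fun setT (fun x => cabs (f x)).
Proof.
move=> [f1 f2]; rewrite (_ : (fun x => _) = (fun x =>
    (complex.Re (f x) ^+ 2 + complex.Im (f x) ^+ 2) `^ 2^-1)); last first.
  by apply/funext => x; rewrite cabsE powR12_sqrt// addr_ge0// sqr_ge0.
apply: (measurableT_comp (measurable_powR _)).
by apply: measurable_funD; exact: measurable_funX.
Qed.

Lemma measurable_cabs_lt1 f : cmeas f -> measurable_fun setT (fun x => cabs (f x) < 1).
Proof.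
by move=> mf; apply: measurable_fun_ltr; [exact: measurable_cabs|exact: measurable_cst].
Qed.

Lemma measurable_green f g : cmeas f -> cmeas g ->
  measurable_fun setT (fun x => green (f x) (g x)).
Proof.
move=> mf mg; apply: measurable_fun_ifT.
- under eq_fun do rewrite eq_complex.
  apply: measurable_and; apply: measurable_fun_eqr.
  + exact: cmeas_Re. + exact: cmeas_Re. + exact: cmeas_Im. + exact: cmeas_Im.
- exact: measurable_cst.
- apply/measurable_EFinP; apply: (measurableT_comp (@measurable_ln R)).
  rewrite (_ : (fun x => _) = (fun x =>
    cabs (1 - (g x)^*%C * f x) * cabs (f x - g x) `^ (-1))); last first.
    by apply/funext => x; rewrite powR_inv1// cabs_ge0.
  apply: measurable_funM; first by apply: measurable_cabs; exact: cmeas_1BM.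
  apply: (measurableT_comp (measurable_powR _)).
  by apply: measurable_cabs; exact: cmeasB.
Qed.

End MeasurableGreen.

Section DiskGreen.
Variable R : realType.
Implicit Types z w : R[i].

(** Green's function cut off outside the disk is nonnegative everywhere, so Tonelli's theorem and
    monotone comparison apply to it. *)
Definition disk_green z w : \bar R :=
  if (cabs z < 1) && (cabs w < 1) then green z w else 0%E.

Lemma greenE z w : cabs z < 1 -> cabs w < 1 -> z != w -> green z w = (- ln (rho z w))%:E.
Proof.
move=> z1 w1 zw; rewrite /green (negbTE zw) -lnV ?posrE ?rho_gt0//.
by rewrite /rho invf_div.
Qed.

Lemma disk_green_ge0 z w : (0 <= disk_green z w)%E.
Proof.
rewrite /disk_green; case: ifPn => // /andP[z1 w1].
have [->|zw] := eqVneq z w; first by rewrite /green eqxx leey.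
by rewrite greenE// lee_fin oppr_ge0 ln_le0// rho_le1.
Qed.

Lemma measurable_disk_green d (T : measurableType d) (f g : T -> R[i]) :
  cmeas f -> cmeas g -> measurable_fun setT (fun x => disk_green (f x) (g x)).
Proof.
move=> mf mg; apply: measurable_fun_ifT.
- by apply: measurable_and; exact: measurable_cabs_lt1.
- exact: measurable_green.
- exact: measurable_cst.
Qed.

Lemma cmeas_toC d (T : measurableType d) (f : T -> R * R) :
  measurable_fun setT f -> cmeas (fun x => toC (f x)).
Proof.
by move=> mf; split => /=;
  [exact: (measurableT_comp measurable_fst)|exact: (measurableT_comp measurable_snd)].
Qed.

Lemma cmeas_toC_cst d (T : measurableType d) (z : R[i]) : cmeas (fun _ : T => z).
Proof. by split; exact: measurable_cst. Qed.

(** [R * R] carries the product sigma-algebra; the complement of [C] is a countable union of squares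
    with rational centres and sides. *)
Lemma closed_measurable_prod (C : set (R^o * R^o)) : closed C ->
  measurable (C : set (R * R)).
Proof.
move=> clC; rewrite -[C]setCK; apply: measurableC.
pose sq (a b : rat) (n : nat) : set (R * R) :=
  ball (ratr a : R) n.+1%:R^-1 `*` ball (ratr b : R) n.+1%:R^-1.
have -> : ~` C = \bigcup_a \bigcup_b \bigcup_n
    (if `[< sq a b n `<=` ~` C >] then sq a b n else set0).
  apply/seteqP; split => [x nCx|x [a _ [b _ [n _]]]]; last first.
    by case: ifPn => // /asboolP; exact.
  have /nbhs_ballP[e /= e0 he] : nbhs (x : R^o * R^o) (~` C).
    by apply: open_nbhs_nbhs; split => //; exact: closed_openC.
  have e20 : 0 < e / 2 by rewrite divr_gt0.
  have [n _ /(_ n (leqnn n)) /= ne] := near_infty_natSinv_lt (PosNum e20).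
  have n0 : 0 < n.+1%:R^-1 :> R by rewrite invr_gt0.
  have rat_near (y : R) : exists q : rat, `|ratr q - y| < n.+1%:R^-1.
    have [q] : exists q : rat, ratr q \in `]y - n.+1%:R^-1, y + n.+1%:R^-1[.
      by apply: rat_in_itvoo; rewrite ltrD2l gt0_cp.
    by rewrite in_itv/= => h; exists q; rewrite ltr_distl.
  have [a ha] := rat_near x.1; have [b hb] := rat_near x.2.
  exists a => //; exists b => //; exists n => //.
  have sqx : sq a b n x by split; rewrite /= -ball_normE.
  rewrite ifT//; apply/asboolP => y [hy1 hy2]; apply: he.
  have ee : n.+1%:R^-1 + n.+1%:R^-1 < e.
    by rewrite [e]splitr ltrD.
  rewrite -ball_normE/= in hy1; rewrite -ball_normE/= in hy2.
  split; rewrite /= -ball_normE/=; apply: le_lt_trans ee.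
    rewrite (le_trans (ler_distD (ratr a) _ _))// lerD// ltW//.
    by rewrite distrC.
  rewrite (le_trans (ler_distD (ratr b) _ _))// lerD// ltW//.
  by rewrite distrC.
apply: bigcupT_measurable_rat => a; apply: bigcupT_measurable_rat => b.
apply: bigcupT_measurable => n; case: ifPn => // _.
by apply: measurableX; exact: measurable_ball.
Qed.

Lemma compact_measurable_prod (K : set (R^o * R^o)) : compact K ->
  measurable (K : set (R * R)).
Proof.
by move=> cK; apply: closed_measurable_prod; apply: compact_closed cK; exact: norm_hausdorff.
Qed.

Definition disk_energy (mu : probability (R * R)%type R) : \bar R :=
  (\int[mu]_u \int[mu]_v disk_green (toC u) (toC v))%E.

Lemma measurable_disk_green_snd (z : R[i]) :
  measurable_fun setT (fun v : R * R => disk_green z (toC v)).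
Proof. by apply: measurable_disk_green; [exact: cmeas_toC_cst|exact: cmeas_toC]. Qed.

Lemma measurable_disk_potential (mu : probability (R * R)%type R) :
  measurable_fun setT (fun u : R * R => \int[mu]_v disk_green (toC u) (toC v))%E.
Proof.
apply: (@measurable_fun_fubini_tonelli_F _ _ _ _ _ mu
  (fun x : (R * R) * (R * R) => disk_green (toC x.1) (toC x.2))).
  by apply: measurable_disk_green; apply: cmeas_toC.
by move=> x; exact: disk_green_ge0.
Qed.

(** The kernels agree on [K], which carries all the mass. The sign of [green] varies off the disk,
    so measurability of its potential goes through positive and negative parts. *)
Lemma energyE (mu : probability (R * R)%type R) (K : set (R^o * R^o)) :
  compact K -> toC @` K `<=` disk -> mu K = 1%E -> energy mu = disk_energy mu.
Proof.
move=> cK K1 muK; have mK := compact_measurable_prod cK.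
have K1' u : K u -> cabs (toC u) < 1 by move=> Ku; apply: K1; exists u.
have muCK : mu (~` K) = 0%E by rewrite probability_setC// muK subee.
have inner u : K u -> (\int[mu]_v green (toC u) (toC v) =
    \int[mu]_v disk_green (toC u) (toC v))%E.
  move=> Ku; apply: ae_eq_integral => //.
  - by apply: measurable_green; [exact: cmeas_toC_cst|exact: cmeas_toC].
  - exact: measurable_disk_green_snd.
  - exists (~` K); split => //; first exact: measurableC.
    by move=> v /= h Kv; apply: h => _; rewrite /disk_green (K1' _ Ku) (K1' _ Kv).
have mF : measurable_fun setT (fun u : R * R => \int[mu]_v green (toC u) (toC v))%E.
  pose h (x : (R * R) * (R * R)) := green (toC x.1) (toC x.2).
  have mh : measurable_fun setT h by apply: measurable_green; apply: cmeas_toC.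
  rewrite (_ : (fun u => _) = (fun u => \int[mu]_v (h^\+ (u, v)) -
      \int[mu]_v (h^\- (u, v)))%E); last first.
    apply/funext => u; rewrite integralE; congr (_ - _)%E; apply: eq_integral => v _.
      by rewrite !funeposE.
    by rewrite !funenegE.
  apply: emeasurable_funB.
    apply: (@measurable_fun_fubini_tonelli_F _ _ _ _ _ mu (h^\+)%E) => //.
    exact: measurable_funepos.
  apply: (@measurable_fun_fubini_tonelli_F _ _ _ _ _ mu (h^\-)%E) => //.
  exact: measurable_funeneg.
apply: ae_eq_integral => //; first exact: measurable_disk_potential.
exists (~` K); split => //; first exact: measurableC.
by move=> u /= h Ku; apply: h => _; exact: inner.
Qed.

End DiskGreen.

Section Mixture.
Context {d : measure_display} {T : measurableType d} {R : realType}.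
Variables (n : nat) (m : nat -> probability T R).

Definition mixture : set T -> \bar R :=
  mscale (n.+1%:R^-1)%:nng (msum (fun i => m i : {measure set T -> \bar R}) n.+1).

HB.instance Definition _ := Measure.on mixture.

Let mixture_setT : mixture setT = 1%E.
Proof.
rewrite /mixture /mscale/= /msum.
rewrite (eq_bigr (fun=> 1%E)); last by move=> i _; exact: probability_setT.
by rewrite sumEFin sumr_const card_ord -EFinM mulVf// pnatr_eq0.
Qed.

HB.instance Definition _ := Measure_isProbability.Build _ _ _ mixture mixture_setT.

Lemma ge0_integral_mixture (f : T -> \bar R) : measurable_fun setT f ->
  (forall x, 0 <= f x)%E ->
  (\int[mixture]_x f x = (n.+1%:R^-1)%:E * \sum_(i < n.+1) \int[m i]_x f x)%E.
Proof.
move=> mf f0; rewrite ge0_integral_mscale//; congr (_ * _)%E.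
by rewrite ge0_integral_measure_sum.
Qed.

Lemma mixture_eq1 (A : set T) : (forall i, (i <= n)%N -> m i A = 1%E) -> mixture A = 1%E.
Proof.
move=> h; rewrite /mixture /mscale/= /msum.
rewrite (eq_bigr (fun=> 1%E)); last by move=> i _; apply: h; exact: leq_ord.
by rewrite sumEFin sumr_const card_ord -EFinM mulVf// pnatr_eq0.
Qed.

End Mixture.

(** * Integrating the logarithmic singularity *)

Section LogSingularity.
Variable R : realType.
Local Notation mu := (@lebesgue_measure R).

(* [- ln |c - t|] is dominated by the number of dyadic intervals around [c]
   that contain [t]. *)
Definition dyadic_count (c t : R) : \bar R :=
  (\sum_(0 <= k <oo) (\1_(`[c - 2^-1 ^+ k, c + 2^-1 ^+ k]) t)%:E)%E.

Let ind_ge0 (c t : R) k : (0 <= (\1_(`[c - 2^-1 ^+ k, c + 2^-1 ^+ k]) t : R)%:E)%E.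
Proof. by rewrite lee_fin. Qed.

Lemma dyadic_count_ge (c t : R) N : (forall k, (k < N)%N -> `|c - t| <= 2^-1 ^+ k) ->
  (N%:R%:E <= dyadic_count c t)%E.
Proof.
move=> h; apply: (@le_trans _ _ (\sum_(0 <= k < N) (\1_(`[c - 2^-1 ^+ k, c + 2^-1 ^+ k]) t)%:E)%E).
  rewrite (eq_big_nat _ _ (F2 := fun=> 1%E)).
    by rewrite sumEFin big_const_nat iter_addr subn0 addr0.
  move=> k /andP[_ kN]; rewrite indicE mem_set//= in_itv/=.
  by have := h _ kN; rewrite ler_distlC => /andP[-> ->].
by apply: nneseries_lim_ge => k _ _; exact: ind_ge0.
Qed.

Lemma dyadic_count_ge0 (c t : R) : (0 <= dyadic_count c t)%E.
Proof. exact: (@dyadic_count_ge c t 0). Qed.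

Lemma dyadic_count_eq0 (c : R) : dyadic_count c c = +oo%E.
Proof.
apply/eqyP => A A0.
apply: le_trans (@dyadic_count_ge c c (Num.bound A) _).
  by rewrite lee_fin ltW// archi_boundP// ltW.
by move=> k _; rewrite subrr normr0 exprn_ge0// invr_ge0.
Qed.

Lemma expr_half_lt (y : R) : 0 < y -> exists N, 2^-1 ^+ N < y.
Proof.
move=> y0; have /cvgrPdist_lt/(_ _ y0)[n _ /(_ n (leqnn n))] :
    (fun n => 2^-1 ^+ n) @ \oo --> (0 : R).
  by apply: cvg_expr; rewrite ger0_norm ?invr_ge0// invf_lt1// ltr1n.
by rewrite sub0r normrN ger0_norm ?exprn_ge0 ?invr_ge0// => ?; exists n.
Qed.

(** For the least [N] with 2^-N < |c - t|, the point [t] lies in the first [N] intervals, while - ln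
    |c - t| is at most N ln 2 <= N. *)
Lemma ln_le_dyadic_count (c t : R) : c != t -> ((- ln `|c - t|)%:E <= dyadic_count c t)%E.
Proof.
move=> ct; have y0 : 0 < `|c - t| by rewrite normr_gt0 subr_eq0.
have [N hN Nmin] := ex_minnP (expr_half_lt y0).
apply: le_trans (@dyadic_count_ge c t N _).
  rewrite lee_fin -[leRHS]opprK lerN2.
  apply: (@le_trans _ _ (ln (2^-1 ^+ N : R))); last first.
    by rewrite ler_ln ?posrE ?exprn_gt0 ?invr_gt0// ltW.
  have ln2 : ln 2 <= 1 :> R by apply: (@le_ln1Dx R 1); rewrite (lt_trans (ltrN10 R)).
  by rewrite lnXn ?invr_gt0// lnV ?posrE// mulNrn lerN2 lerMn2r ln2 orbT.
by move=> k kN; rewrite leNgt; apply/negP => /Nmin; rewrite leqNgt kN.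
Qed.

(** The lengths 2 * 2^-k of the intervals sum to 4, whatever the centre [c]. *)
Lemma integral_dyadic_count (c : R) :
  (\int[mu]_(t in `[0%R, 1%R]) dyadic_count c t <= 4%:R%:E)%E.
Proof.
have mI k : measurable_fun (`[0%R, 1%R] : set (measurableTypeR R))
    (fun t => (\1_(`[c - 2^-1 ^+ k, c + 2^-1 ^+ k]) t : R)%:E).
  by apply/measurable_EFinP; exact: measurable_indic.
rewrite /dyadic_count (integral_nneseries mu _ mI)//.
  apply: lime_le.
    by apply: is_cvg_nneseries => k _ _; apply: integral_ge0 => t _; exact: ind_ge0.
  apply: nearW => n.
  apply: (@le_trans _ _ (\sum_(0 <= k < n) (2 * 2^-1 ^+ k)%:E)%E).
    apply: lee_sum => k _.
    rewrite integral_indic//.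
    apply: (@le_trans _ _ (mu `[c - 2^-1 ^+ k, c + 2^-1 ^+ k])).
      by apply: le_measure; rewrite ?inE//=; exact: measurableI.
    rewrite lebesgue_measure_itv/= lte_fin ifT; last first.
      by rewrite ltrD2l gt0_cp// exprn_gt0// invr_gt0.
    by rewrite -EFinD lee_fin opprD opprK addrACA subrr add0r -mulr2n mulr_natl.
  rewrite sumEFin lee_fin.
  have -> : \sum_(0 <= k < n) (2 * 2^-1 ^+ k : R) = 4 * (1 - 2^-1 ^+ n).
    elim: n => [|n ih]; first by rewrite big_geq// expr0 subrr mulr0.
    by rewrite big_nat_recr//= ih exprS; field.
  by rewrite ler_piMr// lerBlDr lerDl exprn_ge0// invr_ge0.
Qed.

Lemma measurable_dyadic_count (c : R) : measurable_fun setT (dyadic_count c).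
Proof.
apply: ge0_emeasurable_sum => [k t _ _|k _]; first exact: ind_ge0.
by apply/measurable_EFinP; exact: measurable_indic.
Qed.

End LogSingularity.

(** * Curves in the image *)

Section Curve.
Variables (R : realType) (phi : R[i] -> R[i]).
Hypothesis hphi : holo_in 1 phi.
Hypothesis phi1 : forall x, cabs x < 1 -> cabs (phi x) < 1.
Let K : numFieldType := R[i].

(** Freezes the parameter outside [0, 1], so that the curve is defined and continuous on the whole
    line. *)
Let clamp (t : R) : R := Num.max 0 (Num.min t 1).

Let clamp01 t : 0 <= clamp t <= 1.
Proof. by rewrite /clamp le_max lexx/= ge_max ler01 ge_min lexx orbT. Qed.

Let clampE t : 0 <= t <= 1 -> clamp t = t.
Proof. by move=> /andP[t0 t1]; rewrite /clamp (min_l t1) (max_r t0). Qed.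

Let clamp_mono : {homo clamp : x y / x <= y}.
Proof.
move=> x y xy; rewrite /clamp ge_max le_max lexx/= le_max; apply/orP; right.
by rewrite le_min ge_min xy/= ge_min lexx orbT.
Qed.

Let continuous_clamp : continuous clamp.
Proof.
move=> t; apply: (@continuous_max R R (fun=> 0) (fun t => Num.min t 1)).
  exact: cvg_cst.
apply: (@continuous_min R R id (fun=> 1)); first exact: cvg_id.
exact: cvg_cst.
Qed.

(* Parametrising the image of a segment by the pseudo-hyperbolic distance to its
   origin; the first hitting time is monotone, hence measurable. *)
Lemma radial_curve (c b : R[i]) (k : R) : cabs c < 1 -> cabs b < 1 -> 0 < k ->
  k <= rho (phi b) (phi c) ->
  exists2 G : R -> R * R, measurable_fun setT G &
    (exists Q : set (R^o * R^o), [/\ compact Q, toC @` Q `<=` phi @` disk & forall t, Q (G t)]) /\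
    forall t, 0 <= t <= 1 -> rho (toC (G t)) (phi c) = k * t.
Proof.
move=> c1 b1 k0 kb.
pose gam t : R[i] := c + (clamp t)%:C%C * (b - c).
have gam1 t : cabs (gam t) < 1.
  have /andP[t0 t1] := clamp01 t.
  have -> : gam t = (1 - clamp t)%:C%C * c + (clamp t)%:C%C * b.
    by rewrite /gam rmorphB/= rmorph1; ring.
  rewrite (le_lt_trans (le_cabsD _ _))// !cabsM !cabs_real !ger0_norm ?subr_ge0//.
  have h1 : (1 - clamp t) * cabs c <= (1 - clamp t) * Num.max (cabs c) (cabs b).
    by rewrite ler_wpM2l ?subr_ge0// le_max lexx.
  have h2 : clamp t * cabs b <= clamp t * Num.max (cabs c) (cabs b).
    by rewrite ler_wpM2l// le_max lexx orbT.
  have m1 : Num.max (cabs c) (cabs b) < 1 by rewrite gt_max c1.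
  lra.
have cgam : continuous (fun t => phi (gam t) : K).
  move=> t; apply: (@continuous_comp R K K gam phi).
    apply: cvgD; first exact: cvg_cst.
    apply: (@cvgM K); last exact: cvg_cst.
    by apply: cvg_complex; [exact: continuous_clamp|exact: cvg_cst].
  by apply: complex_derivable_continuous; apply: hphi.
pose X t : R := complex.Re (phi (gam t)); pose Y t : R := complex.Im (phi (gam t)).
have cX : continuous X.
  by move=> t; apply: (continuous_comp (cgam t)); exact: continuous_Re.
have cY : continuous Y.
  by move=> t; apply: (continuous_comp (cgam t)); exact: continuous_Im.
have XY t : toC (X t, Y t) = phi (gam t) by rewrite /toC/= /X /Y; case: (phi _).
pose h t := rho (phi (gam t)) (phi c).
have ch : continuous h.
  move=> t; apply: cvgM.
    apply: (@continuous_comp R K R (fun t => phi (gam t) - phi c) (@cabs R)).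
      by apply: cvgB; [exact: cgam|exact: cvg_cst].
    exact: continuous_cabs.
  apply: cvgV.
    by rewrite gt_eqF// cabs_1BM_gt0//; exact: phi1.
  apply: (@continuous_comp R K R (fun t => 1 - (phi c)^*%C * phi (gam t)) (@cabs R)).
    apply: cvgB; first exact: cvg_cst.
    by apply: (@cvgM K); [exact: cvg_cst|exact: cgam].
  exact: continuous_cabs.
have h0 : h 0 = 0.
  by rewrite /h /gam clampE ?lexx ?ler01// mul0r addr0 rhozz.
have h1 : k <= h 1.
  by rewrite /h /gam clampE ?lexx ?ler01// mul1r subrKC.
pose hit s := [set t | 0 <= t <= 1 /\ k * clamp s <= h t].
have hit1 s : hit s 1.
  split; first by rewrite ler01 lexx.
  by rewrite (le_trans _ h1)// ler_piMr ?(ltW k0)//; have /andP[] := clamp01 s.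
have hlb s : has_lbound (hit s) by exists 0 => t [/andP[]].
pose tau s := inf (hit s).
have hinf s : has_inf (hit s) by split; [exists 1|].
have tau01 s : 0 <= tau s <= 1.
  apply/andP; split; last exact: ge_inf.
  by apply: lb_le_inf; [exists 1|move=> t [/andP[]]].
have tau_mono : {homo tau : x y / x <= y}.
  move=> x y xy; apply: lb_le_inf; first by exists 1.
  move=> t [t01 ht]; apply: ge_inf => //; split => //.
  by rewrite (le_trans _ ht)// ler_pM2l// clamp_mono.
(* If [h] exceeded the level at [tau s], an earlier time would already reach it, by continuity and
   [h 0 = 0]; if it were below, no time shortly after [tau s] could belong to [hit s]. *)
have htau s : h (tau s) = k * clamp s.
  apply/eqP; rewrite eq_le; apply/andP; split.
    rewrite leNgt; apply/negP => lt.
    have d0 : 0 < h (tau s) - k * clamp s by rewrite subr_gt0.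
    have /cvgrPdist_lt/(_ _ d0)/nbhs_ballP[e /= e0 he] := ch (tau s).
    have /andP[t0 _] := tau01 s.
    have tpos : 0 < tau s.
      rewrite lt_def t0 andbT; apply/eqP => t00; move: lt; rewrite t00 h0 ltNge.
      by rewrite mulr_ge0 ?(ltW k0)//; have /andP[] := clamp01 s.
    pose t' := Num.max 0 (tau s - e / 2).
    have t'0 : 0 <= t' by rewrite le_max lexx.
    have t'lt : t' < tau s by rewrite gt_max tpos ltrBlDr ltrDl divr_gt0.
    have t'e : `|tau s - t'| < e.
      rewrite ger0_norm ?subr_ge0 ?(ltW t'lt)//.
      have : tau s - e / 2 <= t' by rewrite le_max lexx orbT.
      lra.
    have := he t'; rewrite -ball_normE/= => /(_ t'e).
    rewrite ltr_norml => /andP[_ ht'].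
    have : tau s <= t'.
      apply: ge_inf => //; split; last by lra.
      by rewrite t'0 (le_trans (ltW t'lt))//; have /andP[] := tau01 s.
    by rewrite leNgt t'lt.
  rewrite leNgt; apply/negP => lt.
  have d0 : 0 < k * clamp s - h (tau s) by rewrite subr_gt0.
  have /cvgrPdist_lt/(_ _ d0)/nbhs_ballP[e /= e0 he] := ch (tau s).
  have [t [t01 ht] tlt] := inf_adherent e0 (hinf s).
  have tt : tau s <= t by apply: ge_inf.
  have te : `|tau s - t| < e.
    rewrite ler0_norm ?subr_le0// opprB ltrBlDl; exact: tlt.
  have := he t; rewrite -ball_normE/= => /(_ te).
  rewrite ltr_norml => /andP[]; lra.
exists (fun s => (X (tau s), Y (tau s))).
  have mtau : measurable_fun setT tau by exact: nondecreasing_measurable.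
  by apply: measurable_fun_pair; apply: measurableT_comp mtau => //;
    exact: continuous_measurable_fun.
split; last first.
  by move=> t t01; rewrite XY -/(h (tau t)) htau clampE.
exists ((fun t => (X t, Y t) : R^o * R^o) @` `[0%R, 1%R]); split.
- apply: continuous_compact; last exact: segment_compact.
  apply: continuous_subspaceT => t.
  by apply: (@cvg_pair _ _ _ _ (nbhs (X t)) (nbhs (Y t))); [exact: cX|exact: cY].
- by move=> _ [_ [t _ <-] <-]; rewrite XY; exists (gam t) => //; exact: gam1.
- by move=> t; exists (tau t) => //=; rewrite in_itv/=; exact: tau01.
Qed.

End Curve.

(** * Potentials of the curves *)

Section Potentials.
Variable R : realType.
Local Notation mu := (@lebesgue_measure R).

Definition mfun_of d d' (T : measurableType d) (U : measurableType d') (f : T -> U)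
    (mf : measurable_fun setT f) : {mfun T >-> U} :=
  HB.pack_for {mfun T >-> U} f (isMeasurableFun.Build d d' T U f mf).

Definition unif_push (G : R -> R * R) (mG : measurable_fun setT G) :
  probability (R * R)%type R :=
  distribution (uniform_prob (@ltr01 R)) (@mfun_of _ _ (measurableTypeR R) _ G mG).

Lemma ge0_integral_unif_push (G : R -> R * R) (mG : measurable_fun setT G)
    (f : R * R -> \bar R) : measurable_fun setT f -> (forall x, 0 <= f x)%E ->
  (\int[unif_push mG]_x f x = \int[mu]_(t in `[0%R, 1%R]) f (G t))%E.
Proof.
move=> mf f0; rewrite /unif_push ge0_integral_distribution//.
rewrite integral_uniform; first by rewrite subr0 invr1 mul1e.
  exact: measurableT_comp.
by move=> x; exact: f0.
Qed.

Lemma unif_push_eq1 (G : R -> R * R) (mG : measurable_fun setT G) (A : set (R * R)) :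
  (forall t, A (G t)) -> unif_push mG A = 1%E.
Proof.
move=> h; rewrite -(@probability_setT _ _ _ (uniform_prob (@ltr01 R))).
congr (uniform_prob _ _); apply/seteqP; split => // t _; exact: h.
Qed.

Lemma integral01_le (f : R -> \bar R) (b : R) : measurable_fun setT f ->
  (forall t, 0 <= f t)%E -> (forall t, 0 <= t <= 1 -> (f t <= b%:E)%E) ->
  (\int[mu]_(t in `[0%R, 1%R]) f t <= b%:E)%E.
Proof.
move=> mf f0 fb.
apply: (@le_trans _ _ (\int[mu]_(t in `[0%R, 1%R]) b%:E)%E).
  by apply: ge0_le_integral => //; exact: measurable_funTS.
rewrite integral_cst//= lebesgue_measure_itv/= lte_fin ltr01 -EFinD subr0 mule1//.
Qed.

Section OnePoint.
Variables (k : R) (z b : R[i]) (G : R -> R * R).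
Hypothesis k0 : 0 < k.
Hypothesis z1 : cabs z < 1.
Hypothesis b1 : cabs b < 1.
Hypothesis mG : measurable_fun setT G.
Hypothesis G1 : forall t, cabs (toC (G t)) < 1.
Hypothesis Gk : forall t, 0 <= t <= 1 -> rho (toC (G t)) b = k * t.

Let mg : measurable_fun setT (fun t => disk_green z (toC (G t))).
Proof. exact: (measurableT_comp (measurable_disk_green_snd z) mG). Qed.

(** Since [G t] is at distance k t from [b], rho z (G t) is at least |rho z b - k t| = k |c - t|
    with c = rho z b / k. A logarithmic integral remains, bounded by 4 wherever [z] lies. *)
Lemma near_potential : k <= 1 ->
  (\int[mu]_(t in `[0%R, 1%R]) disk_green z (toC (G t)) <= (- ln k + 4)%:E)%E.
Proof.
move=> k1; have lk : 0 <= - ln k by rewrite oppr_ge0 ln_le0.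
pose c := rho z b / k.
apply: (@le_trans _ _ (\int[mu]_(t in `[0%R, 1%R]) ((- ln k)%:E + dyadic_count c t))%E).
  apply: ge0_le_integral => //.
  - by move=> t _; exact: disk_green_ge0.
  - exact: measurable_funTS.
  - apply: emeasurable_funD; first exact: measurable_cst.
    by apply: measurable_funTS; exact: measurable_dyadic_count.
  - move=> t; rewrite /= in_itv/= => t01.
    have [->|ct] := eqVneq c t; first by rewrite dyadic_count_eq0 addey// leey.
    have d0 : 0 < `|c - t| by rewrite normr_gt0 subr_eq0.
    have e : `|rho z b - rho (toC (G t)) b| = k * `|c - t|.
      by rewrite Gk// -[k in RHS](gtr0_norm k0) -normrM mulrBr /c mulrCA divff ?mulr1// gt_eqF.
    have h : k * `|c - t| <= rho z (toC (G t)) by rewrite -e rho_dist.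
    have kd : 0 < k * `|c - t| by rewrite mulr_gt0.
    have zG : z != toC (G t).
      by apply: contraTneq (lt_le_trans kd h) => <-; rewrite rhozz ltxx.
    rewrite /disk_green z1 G1/= greenE//.
    apply: (@le_trans _ _ ((- ln k)%:E + (- ln `|c - t|)%:E)%E); last first.
      by rewrite leeD2l// ln_le_dyadic_count.
    rewrite -EFinD lee_fin -opprD lerN2 -lnM ?posrE// ler_ln ?posrE//.
    exact: lt_le_trans kd h.
rewrite ge0_integralD//.
- rewrite EFinD leeD// ?integral_dyadic_count// integral_cst//=.
  by rewrite lebesgue_measure_itv/= lte_fin ltr01 -EFinD subr0 mule1.
- by move=> t _; exact: dyadic_count_ge0.
- by apply: measurable_funTS; exact: measurable_dyadic_count.
Qed.

(** By the triangle inequality rho z (G t) is at least rho a b - 2 k, hence at least (1 - d) rho a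
    b. *)
Lemma far_potential (a : R[i]) (d : R) : cabs a < 1 -> 0 < d < 1 -> rho z a <= k ->
  2 * k <= d * rho a b ->
  (\int[mu]_(t in `[0%R, 1%R]) disk_green z (toC (G t)) <=
    (- ln (rho a b) - ln (1 - d))%:E)%E.
Proof.
move=> a1 /andP[d0 d1] zak kd; apply: integral01_le => //.
  by move=> t; exact: disk_green_ge0.
move=> t t01; have D0 : 0 < rho a b.
  by rewrite -(pmulr_rgt0 _ d0) (lt_le_trans _ kd)// mulr_gt0.
have d1' : 0 < 1 - d by rewrite subr_gt0.
have h : (1 - d) * rho a b <= rho z (toC (G t)).
  have h1 := rho_triangle z1 a1 b1.
  have h2 := rho_triangle (G1 t) z1 b1.
  have h3 : rho (toC (G t)) b <= k.
    by rewrite Gk// ler_piMr ?(ltW k0)//; move: t01 => /andP[].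
  rewrite (rhoC a z) in h1; lra.
have p0 : 0 < (1 - d) * rho a b by rewrite mulr_gt0.
have zG : z != toC (G t).
  by apply: contraTneq (lt_le_trans p0 h) => <-; rewrite rhozz ltxx.
rewrite /disk_green z1 G1/= greenE// lee_fin -opprD lerN2 addrC -lnM ?posrE//.
by rewrite ler_ln ?posrE// (lt_le_trans p0).
Qed.

End OnePoint.

(** If [a] and [b] are far apart compared with [k], the potential is nearly the Green function.
    Otherwise - ln (rho a b) is itself about - ln k, and a fraction [e] of it absorbs the constants
    of [near_potential]. *)
Lemma pair_potential (e : R) : 0 < e -> exists2 k0 : R, 0 < k0 <= 1 &
  forall (k : R) (a b z : R[i]) (G : R -> R * R), 0 < k <= k0 -> cabs z < 1 -> cabs a < 1 -> cabs b < 1 -> a != b ->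
    rho z a <= k -> measurable_fun setT G -> (forall t, cabs (toC (G t)) < 1) ->
    (forall t, 0 <= t <= 1 -> rho (toC (G t)) b = k * t) ->
    (\int[mu]_(t in `[0%R, 1%R]) disk_green z (toC (G t)) <=
      ((1 + e) * - ln (rho a b) + e)%:E)%E.
Proof.
(* Chosen so that - ln (1 - d) = e in the far case. *)
move=> e0; pose d := 1 - expR (- e).
have d01 : 0 < d < 1.
  apply/andP; split; last by rewrite ltrBlDr ltrDl expR_gt0.
  by rewrite subr_gt0 -[ltRHS]expR0 ltr_expR oppr_lt0.
have [d0 d1] := andP d01.
have d2 : 0 < 2 / d by rewrite divr_gt0.
have ln2 : 0 <= ln (2 / d).
  by rewrite ln_ge0// ler_pdivlMr// mul1r; lra.
(* For - ln k >= A the share e * (- ln k) covers the 4 of [near_potential] and the loss (1 + e) ln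
   (2 / d) from rho a b < 2 k / d. *)
pose A := (4 + (1 + e) * ln (2 / d)) / e.
have A0 : 0 <= A by rewrite divr_ge0 ?(ltW e0)// addr_ge0// mulr_ge0// addr_ge0// ltW.
exists (expR (- A)); first by rewrite expR_gt0/= -[leRHS]expR0 ler_expR oppr_le0.
move=> k a b z G /andP[k0 kA] z1 a1 b1 ab zak mG G1 Gk.
have rab := rho_gt0 a1 b1 ab.
have lab : 0 <= - ln (rho a b) by rewrite oppr_ge0 ln_le0// rho_le1.
have [far|near] := leP (2 * k) (d * rho a b).
  apply: (le_trans (far_potential k0 z1 b1 mG G1 Gk a1 d01 zak far)).
  have -> : ln (1 - d) = - e by rewrite /d subKr expRK.
  by rewrite lee_fin opprK lerD2r mulrDl mul1r lerDl mulr_ge0// ltW.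
have k1 : k <= 1 by rewrite (le_trans kA)// -[leRHS]expR0 ler_expR oppr_le0.
apply: (le_trans (near_potential k0 z1 b1 mG G1 Gk k1)).
rewrite lee_fin.
have lk : A <= - ln k by rewrite lerNr -[- A]expRK ler_ln ?posrE ?expR_gt0.
have eA : 4 + (1 + e) * ln (2 / d) <= e * - ln k.
  by rewrite [e * _]mulrC -ler_pdivrMr.
have lr : - ln k - ln (2 / d) <= - ln (rho a b).
  have kd2 : 0 < k * (2 / d) by rewrite mulr_gt0.
  rewrite -opprD lerN2 -lnM ?posrE// ler_ln ?posrE//.
  by rewrite mulrA ler_pdivlMr// [rho a b * d]mulrC [k * 2]mulrC ltW.
have e1 : 0 < 1 + e by rewrite addr_gt0.
have := ler_wpM2l (ltW e1) lr; lra.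
Qed.

End Potentials.

(** * Energy of smeared points *)

Section CapacityUpper.
Variables (R : realType) (phi : R[i] -> R[i]) (k1 : R).
Hypothesis hphi : holo_in 1 phi.
Hypothesis phi1 : forall x, cabs x < 1 -> cabs (phi x) < 1.
Hypothesis k10 : 0 < k1.
Hypothesis diam : forall c, cabs c < 1 -> exists2 b, cabs b < 1 & k1 <= rho (phi b) (phi c).
Local Notation mu := (@lebesgue_measure R).

Let sum_sym (N : nat) (B : nat -> nat -> R) (C : R) :
  (forall i j, B i j = B j i) -> (forall i, B i i = C) ->
  \sum_(i < N) \sum_(j < N) B i j = N%:R * C + 2 * \sum_(i < N) \sum_(j < i) B i j.
Proof.
move=> Bs BC; elim: N => [|N ih]; first by rewrite !big_ord0 mul0r mulr0 addr0.
rewrite big_ord_recr/=.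
under eq_bigr do rewrite big_ord_recr/=.
rewrite big_split/= ih [in RHS]big_ord_recr/= big_ord_recr/= BC -natr1.
have -> : \sum_(i < N) B i N = \sum_(j < N) B N j by apply: eq_bigr => j _; rewrite Bs.
by ring.
Qed.

Lemma ln_prod (n : nat) (F : nat -> R) : (forall i, (i < n)%N -> 0 < F i) ->
  ln (\prod_(i < n) F i) = \sum_(i < n) ln (F i).
Proof.
elim: n => [|n ih] F0; first by rewrite !big_ord0 ln1.
rewrite !big_ord_recr/= lnM ?posrE; last 2 first.
- by apply: prodr_gt0 => i _; apply: F0; rewrite ltnS ltnW.
- exact: F0.
by rewrite ih// => i i_n; apply: F0; rewrite ltnS ltnW.
Qed.

(* The point masses have infinite energy, so each [z i] is spread uniformly over
   a curve of pseudo-hyperbolic radius [k] inside the image of the disk; [C]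
   bounds the self-energy of these curves. *)
Lemma green_V_le (e : R) : 0 < e -> exists C : R, forall n (z : nat -> R[i]),
  (forall i, (phi @` disk) (z i)) ->
  (forall i j, (i <= n)%N -> (j <= n)%N -> i != j -> z i != z j) ->
  (green_V (phi @` disk) <= ((1 + e) * (- 2 * ln (fekete_prod n.+1 z)) / n.+1%:R ^+ 2 +
     e + C / n.+1%:R)%:E)%E.
Proof.
move=> e0; have [k0 /andP[k00 k01] hk0] := pair_potential e0.
pose k := Num.min k0 k1.
have kp : 0 < k by rewrite lt_min k00.
have kk0 : k <= k0 by rewrite ge_min lexx.
have kk1 : k <= k1 by rewrite ge_min lexx orbT.
have k_le1 : k <= 1 by rewrite (le_trans kk0).
pose C := - ln k + 4; exists C => n z Ez zz.
have z1 i : cabs (z i) < 1 by have [c c1 <-] := Ez i; exact: phi1.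
have /choice[G hG] : forall i, exists G : R -> R * R, [/\ measurable_fun setT G,
    exists Q : set (R^o * R^o), [/\ compact Q, toC @` Q `<=` phi @` disk & forall t, Q (G t)] &
    forall t, 0 <= t <= 1 -> rho (toC (G t)) (z i) = k * t].
  move=> i; have [c c1 <-] := Ez i; have [b b1 kb] := diam c1.
  have [G mG [hQ hG]] := radial_curve hphi phi1 c1 b1 kp (le_trans kk1 kb).
  by exists G; split.
have mG i : measurable_fun setT (G i) by have [] := hG i.
have Gk i t : 0 <= t <= 1 -> rho (toC (G i t)) (z i) = k * t.
  by have [_ _] := hG i; exact.
have G1 i t : cabs (toC (G i t)) < 1.
  have [_ [Q [_ hQ QG]] _] := hG i.
  have [c c1 <-] : (phi @` disk) (toC (G i t)) by apply: hQ; exists (G i t).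
  exact: phi1.
have [Q [cQ QE QG]] : exists Q : set (R^o * R^o), [/\ compact Q, toC @` Q `<=` phi @` disk &
    forall i, (i <= n)%N -> forall t, Q (G i t)].
  elim: n {zz} => [|n [Q [cQ QE QG]]].
    have [_ [Q [cQ QE QG]] _] := hG 0%N; exists Q; split => // i.
    by rewrite leqn0 => /eqP ->.
  have [_ [Q' [cQ' QE' QG']] _] := hG n.+1; exists (Q `|` Q'); split.
  - exact: compactU.
  - by rewrite image_setU => x [/QE|/QE'].
  - move=> i; rewrite leq_eqVlt => /predU1P[-> t|]; first by right.
    by rewrite ltnS => i_n t; left; exact: QG.
pose m i := unif_push (mG i).
pose M : probability (R * R)%type R := mixture n m.
have MQ : M Q = 1%E.
  by apply: mixture_eq1 => i i_n; apply: unif_push_eq1; exact: QG.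
have Q1 : toC @` Q `<=` disk by move=> x /QE[c c1 <-]; exact: phi1.
apply: (@le_trans _ _ (energy M)).
  by apply: ereal_inf_lbound; exists M => //; exists Q.
rewrite (energyE cQ Q1 MQ).
pose B i j := if i == j then C else (1 + e) * - ln (rho (z i) (z j)) + e.
have C0 : 0 <= C by rewrite addr_ge0// oppr_ge0 ln_le0.
have pot i j t : (i <= n)%N -> (j <= n)%N -> 0 <= t <= 1 ->
    (\int[mu]_(s in `[0%R, 1%R]) disk_green (toC (G i t)) (toC (G j s)) <= (B i j)%:E)%E.
  move=> i_n jn t01; rewrite /B; have [ij|ij] := eqVneq i j.
    by apply: (@near_potential _ k _ (z j)) => // s s01; exact: Gk.
  apply: (hk0 k) => //; rewrite ?kp ?zz//.
  - by rewrite Gk// ler_piMr ?(ltW kp)//; move: t01 => /andP[].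
  - by move=> s s01; exact: Gk.
have n0 : 0 < n.+1%:R :> R by rewrite ltr0n.
have U0 u : (0 <= \int[M]_v disk_green (toC u) (toC v))%E.
  by apply: integral_ge0 => v _; exact: disk_green_ge0.
have pu i t : (i <= n)%N -> 0 <= t <= 1 ->
    (\int[M]_v disk_green (toC (G i t)) (toC v) <=
     (n.+1%:R^-1 * \sum_(j < n.+1) B i j)%:E)%E.
  move=> i_n t01; rewrite ge0_integral_mixture; last 2 first.
  - exact: measurable_disk_green_snd.
  - by move=> v; exact: disk_green_ge0.
  rewrite EFinM lee_pmul2l// ?lte_fin ?invr_gt0// -sumEFin; apply: lee_sum => j _.
  rewrite ge0_integral_unif_push; last 2 first.
  - exact: measurable_disk_green_snd.
  - by move=> v; exact: disk_green_ge0.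
  by apply: pot => //; exact: leq_ord.
apply: (@le_trans _ _ (n.+1%:R^-1 * (n.+1%:R^-1 * \sum_(i < n.+1) \sum_(j < n.+1) B i j))%:E).
  rewrite /disk_energy ge0_integral_mixture//; last exact: measurable_disk_potential.
  rewrite EFinM lee_pmul2l// ?lte_fin ?invr_gt0// mulr_sumr -sumEFin; apply: lee_sum => i _.
  rewrite ge0_integral_unif_push//; last exact: measurable_disk_potential.
  apply: integral01_le => //.
    exact: (measurableT_comp (measurable_disk_potential M) (mG i)).
  by move=> t t01; apply: pu => //; exact: leq_ord.
rewrite lee_fin (@sum_sym _ _ C); last 2 first.
- by move=> i j; rewrite /B eq_sym; case: eqP => // _; rewrite rhoC.
- by move=> i; rewrite /B eqxx.
have rho0 i j : (i <= n)%N -> (j <= n)%N -> i != j -> 0 < rho (z i) (z j).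
  by move=> i_n jn ij; rewrite rho_gt0// zz.
have lnP : ln (fekete_prod n.+1 z) = \sum_(i < n.+1) \sum_(j < i) ln (rho (z i) (z j)).
  rewrite /fekete_prod (@ln_prod _ (fun i => \prod_(j < i) rho (z i) (z j))).
    apply: eq_bigr => i _; rewrite (@ln_prod _ (fun j => rho (z i) (z j)))// => j ji.
    by rewrite rho0 ?leq_ord// ?gtn_eqF// (leq_trans (ltnW ji))// leq_ord.
  move=> i i_n; apply: prodr_gt0 => j _.
  by rewrite rho0// ?gtn_eqF// (leq_trans (ltnW (ltn_ord j))).
have sumB : \sum_(i < n.+1) \sum_(j < i) B i j <=
    (1 + e) * - ln (fekete_prod n.+1 z) + n.+1%:R ^+ 2 / 2 * e.
  rewrite lnP.
  have -> : \sum_(i < n.+1) \sum_(j < i) B i j =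
      \sum_(i < n.+1) ((1 + e) * - (\sum_(j < i) ln (rho (z i) (z j))) + i%:R * e).
    apply: eq_bigr => i _.
    rewrite (eq_bigr (fun j : 'I_i => (1 + e) * - ln (rho (z i) (z j)) + e)).
      by rewrite big_split/= -mulr_sumr sumrN sumr_const card_ord mulr_natl.
    by move=> j _; rewrite /B gtn_eqF.
  rewrite big_split/= -mulr_sumr sumrN lerD2l -mulr_suml ler_pM2r//.
  elim: {+}n.+1 => [|N ih]; first by rewrite big_ord0 expr0n/= mul0r.
  by rewrite big_ord_recr/= -natr1; lra.
rewrite (_ : _ + _ + C / _ = (n.+1%:R ^+ 2)^-1 * (n.+1%:R * C + 2 *
   ((1 + e) * - ln (fekete_prod n.+1 z) + n.+1%:R ^+ 2 / 2 * e))); last first.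
  by field; rewrite gt_eqF.
rewrite mulrA -invfM -expr2 ler_pM2l ?invr_gt0 ?exprn_gt0// lerD2l.
by rewrite ler_pM2l.
Qed.

End CapacityUpper.

(** * Points of small energy *)

Section GreedyPoints.
Variables (R : realType) (mu : probability (R * R)%type R) (A : set (R * R)) (th j : R).
Hypothesis mA : measurable A.
Hypothesis th0 : 0 < th.
Hypothesis muA : mu A = th%:E.
Local Notation g := (@disk_green R).
Local Open Scope ereal_scope.

Lemma disk_greenC z w : g z w = g w z.
Proof.
rewrite /disk_green andbC; case: ifPn => // /andP[w1 z1].
have [->//|zw] := eqVneq z w.
by rewrite !greenE// 1?eq_sym// rhoC.
Qed.

Let ind (u : R * R) : \bar R := (\1_A u)%:E.

Let ind_ge0 u : 0 <= ind u.
Proof. by rewrite lee_fin. Qed.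

Let mind : measurable_fun setT ind.
Proof. by apply/measurable_EFinP; exact: measurable_indic. Qed.

Let U z := \int[mu]_v (g z (toC v) * ind v).

Let U_ge0 z : 0 <= U z.
Proof. by apply: integral_ge0 => v _; rewrite mule_ge0// disk_green_ge0. Qed.

Let mU : measurable_fun setT (fun u : R * R => U (toC u)).
Proof.
apply: (@measurable_fun_fubini_tonelli_F _ _ _ _ _ mu
  (fun x : (R * R) * (R * R) => g (toC x.1) (toC x.2) * ind x.2)).
  apply: emeasurable_funM.
    by apply: measurable_disk_green; apply: cmeas_toC.
  exact: measurableT_comp.
by move=> x; rewrite mule_ge0// disk_green_ge0.
Qed.

Let J := \int[mu]_u (U (toC u) * ind u).
(** After division by [th ^+ 2]: the measure conditioned on [A] has energy at most [j]. *)
Hypothesis Jj : J <= (th ^+ 2 * j)%:E.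

Let H (s : seq R[i]) := \sum_(w <- s) U w.

Fixpoint pair_energy (s : seq R[i]) : \bar R :=
  if s is z :: s' then \sum_(w <- s') g z w + pair_energy s' else 0.

Lemma pair_energy_ge0 s : 0 <= pair_energy s.
Proof.
elim: s => //= z s ih; rewrite adde_ge0//; apply: sume_ge0 => w _.
exact: disk_green_ge0.
Qed.

Let mgu w : measurable_fun setT (fun u : R * R => g (toC u) w).
Proof. by apply: measurable_disk_green; [exact: cmeas_toC|exact: cmeas_toC_cst]. Qed.

Let sum_ge0 s z : 0 <= \sum_(w <- s) g z w.
Proof. by apply: sume_ge0 => w _; exact: disk_green_ge0. Qed.

Let msum s : measurable_fun setT (fun u : R * R => \sum_(w <- s) g (toC u) w).
Proof. by apply: emeasurable_sum. Qed.

Let integral_sum s : \int[mu]_u ((\sum_(w <- s) g (toC u) w) * ind u) = H s.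
Proof.
elim: s => [|w s ih].
  rewrite /H big_nil; under eq_integral do rewrite big_nil mul0e.
  exact: integral0.
rewrite /H big_cons -/(H s) -ih.
under eq_integral do rewrite big_cons ge0_muleDl ?disk_green_ge0//.
rewrite ge0_integralD//.
- by congr (_ + _); apply: eq_integral => u _; rewrite disk_greenC.
- by move=> u _; rewrite mule_ge0// disk_green_ge0.
- exact: emeasurable_funM.
- by move=> u _; rewrite mule_ge0.
- exact: emeasurable_funM.
Qed.

(** If the inequality failed throughout [A], integrating over [A] would give at least th (x + d) >
    th x; the slack [d] makes the contradiction strict. *)
Let below_mean (s : seq R[i]) (c x d : R) : (0 <= c)%R -> (0 < d)%R ->
  H s + c%:E * J <= (th * x)%:E ->
  exists2 u, A u & \sum_(w <- s) g (toC u) w + c%:E * U (toC u) <= (x + d)%:E.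
Proof.
move=> c0 d0 hx; apply: contrapT => hn.
have cU0 u : 0 <= c%:E * U (toC u) by rewrite mule_ge0.
pose F u := (\sum_(w <- s) g (toC u) w + c%:E * U (toC u)) * ind u.
have mcU : measurable_fun setT (fun u => c%:E * U (toC u)).
  by apply: emeasurable_funM => //; exact: measurable_cst.
have IF : \int[mu]_u F u = H s + c%:E * J.
  rewrite /F; under eq_integral do rewrite ge0_muleDl//.
  rewrite ge0_integralD//.
  - rewrite integral_sum; congr (_ + _).
    under eq_integral do rewrite -muleA.
    rewrite ge0_integralZl//; first exact: emeasurable_funM.
    by move=> u _; rewrite mule_ge0.
  - by move=> u _; rewrite mule_ge0.
  - exact: emeasurable_funM.
  - by move=> u _; rewrite mule_ge0.
  - exact: emeasurable_funM.
have x0 : (0 <= x)%R.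
  have : 0 <= (th * x)%:E.
    apply: le_trans hx; rewrite adde_ge0//; first by apply: sume_ge0.
    by rewrite mule_ge0//; apply: integral_ge0 => u _; rewrite mule_ge0.
  by rewrite lee_fin pmulr_rge0.
have xd0 : (0 <= x + d)%R by rewrite addr_ge0// ltW.
have : \int[mu]_u ((x + d)%:E * ind u) <= \int[mu]_u F u.
  apply: ge0_le_integral => //.
  - by move=> u _; rewrite mule_ge0.
  - by apply: emeasurable_funM => //; exact: measurable_cst.
  - by apply: emeasurable_funM => //; exact: emeasurable_funD.
  - move=> u _; rewrite /F /ind indicE; case: (boolP (u \in A)) => [uA|]; last by rewrite !mule0.
    rewrite !mule1 leNgt; apply/negP => lt; apply: hn; exists u; first exact: set_mem.
    exact: ltW.
rewrite IF ge0_integralZl//.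
rewrite integral_indic// setIT [X in _ * X <= _]muA => /le_trans/(_ hx).
rewrite -EFinM lee_fin mulrC ler_pM2l//.
by rewrite leNgt ltrDl d0.
Qed.

(* Method of conditional expectations: the left-hand side of the hypothesis is
   the expected final energy if the [m] remaining points were drawn
   independently from [mu] conditioned on [A], up to the term in ['C(m, 2)]. *)
Let choose m : forall (s : seq R[i]) (x d : R), (0 < d)%R ->
  pair_energy s + (m%:R / th)%:E * H s <= x%:E ->
  exists t, [/\ size t = m, forall w, w \in t -> (toC @` A) w &
    pair_energy (t ++ s) <= (x + 'C(m, 2)%:R * j + m%:R * d)%:E].
Proof.
elim: m => [|m ih] s x d d0 hx.
  exists [::]; split => //=.
  by move: hx; rewrite ?bin0n !mul0r mul0e adde0 !addr0.
have H0 : 0 <= H s by apply: sume_ge0.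
have E0 := pair_energy_ge0 s.
have mt : (0 < m.+1%:R / th)%R by rewrite divr_gt0.
have nNy (y : \bar R) : 0 <= y -> y != -oo.
  by move=> y0; rewrite gt_eqF// (lt_le_trans ltNy0).
have Hfin : H s \is a fin_num.
  rewrite ge0_fin_numE// ltey; apply/eqP => Hy; move: hx.
  by rewrite Hy gt0_muley ?lte_fin// addey// nNy.
have Efin : pair_energy s \is a fin_num.
  rewrite ge0_fin_numE// ltey; apply/eqP => Ey; move: hx.
  by rewrite Ey addye// nNy// mule_ge0// lee_fin ltW.
pose h := (fine (H s) / th)%R; pose e := fine (pair_energy s).
have Hh : H s = (th * h)%:E by rewrite /h mulrC divfK ?gt_eqF// fineK.
have Ee : pair_energy s = e%:E by rewrite /e fineK.
have hx' : (e + m.+1%:R * h <= x)%R.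
  by move: hx; rewrite Hh Ee -EFinM -EFinD lee_fin mulrA divfK ?gt_eqF.
have mth : (0 <= m%:R / th)%R by rewrite divr_ge0// ltW.
(* Over [A] the mean of the potential of [s] is [h], and that of the weighted term is at most (m /
   th) * th * j = m j. *)
have [|u Au hu] := @below_mean s (m%:R / th) (h + m%:R * j) d mth d0.
  apply: (@le_trans _ _ ((th * h)%:E + (m%:R / th)%:E * (th ^+ 2 * j)%:E)).
    by rewrite Hh leeD2l// lee_wpmul2l.
  by rewrite -EFinM -EFinD lee_fin le_eqVlt; apply/orP; left; apply/eqP; field; rewrite gt_eqF.
set z := toC u in hu.
have [|t [st tA ht]] := ih (z :: s) (x + m%:R * j + d)%R d d0.
  rewrite /= /H big_cons -/(H s) ge0_muleDr// Ee Hh addeACA.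
  apply: (@le_trans _ _ ((h + m%:R * j + d)%:E + (e%:E + (m%:R / th)%:E * (th * h)%:E))).
    by rewrite leeD2r.
  rewrite -EFinM -!EFinD lee_fin mulrA divfK ?gt_eqF//; move: hx'; rewrite -natr1; lra.
exists (rcons t z); split.
- by rewrite size_rcons st.
- by move=> w; rewrite mem_rcons inE => /predU1P[->|/tA//]; exists u.
- rewrite cat_rcons (le_trans ht)// lee_fin binS bin1 natrD -natr1.
  by rewrite le_eqVlt; apply/orP; left; apply/eqP; ring.
Qed.

Lemma greedy_points (n : nat) (d : R) : (0 < d)%R ->
  exists t, [/\ size t = n, forall w, w \in t -> (toC @` A) w &
    pair_energy t <= ('C(n, 2)%:R * j + n%:R * d)%:E].
Proof.
move=> d0; have [|t [st tA ht]] := @choose n [::] 0 d d0.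
  by rewrite /= /H big_nil mule0 adde0.
by exists t; split => //; move: ht; rewrite cats0 add0r.
Qed.

End GreedyPoints.

Section FeketeEnergy.
Variable R : realType.

Lemma expeR_disk_green (z w : R[i]) : cabs z < 1 -> cabs w < 1 ->
  (rho z w)%:E = expeR (- disk_green z w).
Proof.
move=> z1 w1; rewrite /disk_green z1 w1/=.
have [->|zw] := eqVneq z w; first by rewrite /green eqxx rhozz.
by rewrite greenE//= opprK lnK// posrE rho_gt0.
Qed.

(** [pair_energy] grows at the head of the list and [fekete_prod] at the last index, hence the
    [rev]. Repeated points fit in: energy +oo against product 0. *)
Lemma fekete_prod_energy (t : seq R[i]) : (forall w, w \in t -> cabs w < 1) ->
  (fekete_prod (size t) (nth 0 (rev t)))%:E = expeR (- pair_energy t).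
Proof.
elim: t => [|z s ih] t1; first by rewrite /fekete_prod big_ord0 [pair_energy _]/= oppe0 expeR0.
have z1 : cabs z < 1 by apply: t1; rewrite mem_head.
have s1 w : w \in s -> cabs w < 1 by move=> ws; apply: t1; rewrite inE ws orbT.
rewrite /= fekete_prodS EFinM.
have sr := size_rev s.
rewrite (@eq_fekete_prod _ _ _ (nth 0 (rev s))); last first.
  by move=> i i_s; rewrite rev_cons nth_rcons sr i_s.
rewrite ih//.
have -> : \prod_(i < size s) rho (nth 0 (rev (z :: s)) (size s)) (nth 0 (rev (z :: s)) i) =
    \prod_(w <- s) rho z w.
  rewrite rev_cons.
  transitivity (\prod_(i < size (rev s)) rho z (nth 0 (rev s) i)).
    rewrite sr; apply: eq_bigr => i _.
    by rewrite !nth_rcons sr ltnn eqxx ltn_ord.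
  have -> : \prod_(w <- s) rho z w = \prod_(w <- rev s) rho z w.
    by apply: perm_big; rewrite perm_sym perm_rev.
  by rewrite [RHS](big_nth 0) big_mkord.
have -> : (\prod_(w <- s) rho z w)%:E = expeR (- \sum_(w <- s) disk_green z w).
  elim: s s1 {t1 ih sr} => [_|w s ih s1]; first by rewrite !big_nil oppe0 expeR0.
  rewrite !big_cons EFinM ih; last by move=> v vs; apply: s1; rewrite inE vs orbT.
  rewrite (expeR_disk_green z1 (s1 _ (mem_head _ _))) -expeRD oppeD//.
  apply: ge0_adde_def; rewrite inE ?disk_green_ge0//.
  by apply: sume_ge0 => v _; exact: disk_green_ge0.
rewrite -expeRD addeC oppeD//.
apply: ge0_adde_def; rewrite inE ?pair_energy_ge0//.
by apply: sume_ge0 => v _; exact: disk_green_ge0.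
Qed.

End FeketeEnergy.

(** * Lower bound for Fekete products *)

Section FeketeLower.
Variables (R : realType) (phi : R[i] -> R[i]).
Hypothesis hphi : holo_in 1 phi.
Hypothesis phi1 : forall x, cabs x < 1 -> cabs (phi x) < 1.
Let K : numFieldType := R[i].

Let toCk (u : R^o * R^o) : K := toC u.

Let continuous_toC : continuous toCk.
Proof.
by move=> u; apply: cvg_complex; [exact: cvg_fst|exact: cvg_snd].
Qed.

Let square : set (R^o * R^o) := (`[-1, 1] : set R^o) `*` (`[-1, 1] : set R^o).

Let compact_square : compact square.
Proof. by apply: compact_setX; exact: segment_compact. Qed.

(** For r <= 1 the square does not restrict the disk; it gives compactness as a closed subset of a
    product of segments. *)
Let Bset (r : R) : set (R^o * R^o) := square `&` [set u | cabs (toCk u) <= r].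

Let compact_B r : compact (Bset r).
Proof.
apply: (@subclosed_compact _ _ square) => //.
- apply: closedI.
    apply: compact_closed; first exact: norm_hausdorff.
    exact: compact_square.
  have -> : [set u | cabs (toCk u) <= r] = (fun u => cabs (toCk u)) @^-1` [set x | x <= r] by [].
  apply: preimage_closed; last exact: closed_le.
  by move=> u _; apply: (continuous_comp (@continuous_toC u)); exact: continuous_cabs.
- by move=> u [].
Qed.

Let Psi (u : R^o * R^o) : R^o * R^o :=
  (complex.Re (phi (toCk u)), complex.Im (phi (toCk u))).

Let Cset r := Psi @` Bset r.

Let compact_C r : r < 1 -> compact (Cset r).
Proof.
move=> r1; apply: continuous_compact; last exact: compact_B.
apply: continuous_in_subspaceT => u; rewrite inE => -[_ /= ur].
have cp : {for u, continuous (fun u => phi (toCk u) : K)}.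
  apply: (@continuous_comp _ _ _ toCk (phi : K -> K)); first exact: continuous_toC.
  by apply: complex_derivable_continuous; apply: hphi; exact: le_lt_trans ur r1.
apply: (@cvg_pair _ _ _ _ (nbhs (complex.Re (phi (toCk u)))) (nbhs (complex.Im (phi (toCk u))))).
  by apply: (continuous_comp cp); exact: continuous_Re.
by apply: (continuous_comp cp); exact: continuous_Im.
Qed.

Let toC_Psi u : toC (Psi u) = phi (toC u).
Proof. by rewrite /toC /= /toCk; case: (phi _). Qed.

Let in_C r v x : cabs x <= r -> r < 1 -> toC v = phi x -> Cset r v.
Proof.
move=> xr r1 vx; exists (complex.Re x, complex.Im x).
  have x1 : cabs x <= 1 by rewrite (le_trans xr)// ltW.
  split; [split|].
  - by rewrite /= in_itv/= -ler_norml (le_trans (le_Re_cabs _)).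
  - by rewrite /= in_itv/= -ler_norml (le_trans (le_Im_cabs _)).
  - by rewrite /toCk /toC/=; case: x xr {vx x1}.
have xE : toCk (complex.Re x, complex.Im x) = x by rewrite /toCk /toC/=; case: (x).
by rewrite /Psi xE -vx; case: v vx.
Qed.

(* A measure with compact support in the image is almost entirely carried by the
   image of a smaller disk; losing a little mass is paid for by [I0 < I]. *)
Lemma fekete_ge (I : R) : (green_V (phi @` disk) < I%:E)%E ->
  exists2 r, r < 1 & forall n, expR (- ('C(n, 2)%:R * I + 1)) <=
    fekete n (phi @` [set x | cabs x <= r]).
Proof.
move=> /ereal_inf_lt[_ [mu [Q [cQ [QE muQ]]] <-]].
have Q1 : toC @` Q `<=` disk by move=> x /QE[c c1 <-]; exact: phi1.
rewrite (energyE cQ Q1 muQ) => EI.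
have mQ := compact_measurable_prod cQ.
have inner0 u : (0 <= \int[mu]_v disk_green (toC u) (toC v))%E.
  by apply: integral_ge0 => v _; exact: disk_green_ge0.
have E0 : (0 <= disk_energy mu)%E by apply: integral_ge0.
have Efin : disk_energy mu \is a fin_num by rewrite ge0_fin_numE// (lt_trans EI)// ltry.
pose I0 := fine (disk_energy mu).
have EI0 : disk_energy mu = I0%:E by rewrite fineK.
have I00 : 0 <= I0 by rewrite fine_ge0.
have I0I : I0 < I by move: EI; rewrite EI0 lte_fin.
have Ip : 0 < I by apply: le_lt_trans I0I.
pose r (m : nat) : R := 1 - m.+1%:R^-1.
have r1 m : r m < 1 by rewrite /r ltrBlDr ltrDl.
pose F m : set (R * R) := Q `&` Cset (r m).
have mF m : measurable (F m).
  by apply: measurableI => //; apply: compact_measurable_prod; exact: compact_C.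
have Fmono : nondecreasing_seq F.
  move=> m n mn; apply/subsetPset => v [Qv [u [hu /= ur] uv]]; split => //.
  exists u => //; split => //=; rewrite (le_trans ur)// lerD2l lerN2.
  by rewrite lef_pV2 ?posrE// ler_nat ltnS.
have UF : \bigcup_m F m = Q.
  apply/seteqP; split => [v [m _ []]//|v Qv].
  have [x x1 xv] : (phi @` disk) (toC v) by apply: QE; exists v.
  have d0 : 0 < 1 - cabs x by rewrite subr_gt0.
  have [m _ /(_ m (leqnn m)) /= hm] := near_infty_natSinv_lt (PosNum d0).
  exists m => //; split => //; apply: (@in_C _ _ x) => //.
  by rewrite /r lerBrDr addrC -lerBrDr; exact: ltW.
have := @nondecreasing_cvg_mu _ _ _ mu F mF (bigcupT_measurable _ mF) Fmono.
rewrite UF [X in _ --> X]muQ => cF.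
(* Since ((1 + x) / 2)^2 >= x, a mass [th] above (1 + x) / 2 already gives I0 <= th^2 I, as
   [greedy_points] demands. *)
pose x := I0 / I.
have x1 : x < 1 by rewrite ltr_pdivrMr// mul1r.
have x0 : 0 <= x by rewrite divr_ge0// ltW.
have th1 : (((1 + x) / 2)%:E < 1)%E by rewrite lte_fin; lra.
have [m hm] : exists m, (((1 + x) / 2)%:E < mu (F m))%E.
  have /cF[m _ /(_ m (leqnn m)) h] : nbhs (1%E : \bar R) [set y | ((1 + x) / 2)%:E < y]%E.
    by apply: open_nbhs_nbhs; split => //; exact: open_ereal_gt_ereal.
  by exists m.
have muFfin : mu (F m) \is a fin_num by rewrite fin_num_measure.
pose th := fine (mu (F m)).
have muF : mu (F m) = th%:E by rewrite fineK.
have hth : (1 + x) / 2 < th by move: hm; rewrite muF lte_fin.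
have th0 : 0 < th by lra.
have Ith : I0 <= th ^+ 2 * I.
  rewrite -ler_pdivrMr// -/x (@le_trans _ _ (((1 + x) / 2) ^+ 2))//.
    by have := sqr_ge0 (1 - x); rewrite !expr2; lra.
  by rewrite ler_pXn2r ?nnegrE ?(ltW hth) ?(ltW th0)//; lra.
have mind : measurable_fun setT (fun v : R * R => (\1_(F m) v : R)%:E).
  by apply/measurable_EFinP; exact: measurable_indic.
exists (r m) => // n.
(* A slack of 1 / (n + 1) per point adds up to less than the 1 in the exponent. *)
have n0 : 0 < (n.+1%:R^-1 : R) by rewrite invr_gt0.
have [|t [st tA ht]] := @greedy_points R mu (F m) th I (mF m) th0 muF _ n n.+1%:R^-1 n0.
  apply: (@le_trans _ _ I0%:E); last by rewrite lee_fin.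
  rewrite -EI0; apply: ge0_le_integral => //.
  - move=> u _; rewrite mule_ge0 ?lee_fin//; apply: integral_ge0 => v _.
    by rewrite mule_ge0 ?lee_fin// disk_green_ge0.
  - apply: emeasurable_funM; last by apply/measurable_EFinP; exact: measurable_indic.
    apply: (@measurable_fun_fubini_tonelli_F _ _ _ _ _ mu (fun x : (R * R) * (R * R) =>
      disk_green (toC x.1) (toC x.2) * (\1_(F m) x.2)%:E)%E).
      apply: emeasurable_funM; first by apply: measurable_disk_green; apply: cmeas_toC.
      exact: (measurableT_comp mind measurable_snd).
    by move=> y; rewrite mule_ge0 ?lee_fin// disk_green_ge0.
  - exact: measurable_disk_potential.
  have ind1 (y : \bar R) u : (0 <= y -> y * (\1_(F m) u)%:E <= y)%E.
    by move=> y0; rewrite indicE; case: (_ \in _); rewrite ?mule1// mule0.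
  move=> u _; apply: (@le_trans _ _ (\int[mu]_v (disk_green (toC u) (toC v) * (\1_(F m) v)%:E))%E).
    apply: ind1; apply: integral_ge0 => v _.
    by rewrite mule_ge0 ?lee_fin// disk_green_ge0.
  apply: ge0_le_integral => //.
  - by move=> v _; rewrite mule_ge0 ?lee_fin// disk_green_ge0.
  - apply: emeasurable_funM; first exact: measurable_disk_green_snd.
    by apply/measurable_EFinP; exact: measurable_indic.
  - exact: measurable_disk_green_snd.
  - by move=> v _; apply: ind1; exact: disk_green_ge0.
have inE w : w \in t -> (phi @` [set x | cabs x <= r m]) w.
  move=> /tA[v [_ [u [_ ur] <-]] <-]; rewrite toC_Psi.
  by exists (toC u).
have E1 : phi @` [set x | cabs x <= r m] `<=` disk.
  by move=> _ [y yr <-]; apply: phi1; exact: le_lt_trans yr (r1 m).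
have t1 w : w \in t -> cabs w < 1 by move=> /inE/E1.
apply: (@le_trans _ _ (fekete_prod n (nth 0 (rev t)))); last first.
  apply: fekete_prod_le => // i i_n; apply: inE.
  by rewrite -mem_rev mem_nth// size_rev st.
rewrite -lee_fin -[X in fekete_prod X]st (fekete_prod_energy t1).
apply: (@le_trans _ _ (expeR (- ('C(n, 2)%:R * I + n%:R * n.+1%:R^-1)%:E))); last first.
  by rewrite lee_expeR leeN2.
rewrite /= lee_fin ler_expR lerN2 lerD2l ler_pdivrMr// mul1r ler_nat//.
Qed.

End FeketeLower.

(** * Increments of quadratically growing sequences *)

Section Increments.
Variable R : realType.

Lemma sum_increments (w : nat -> R) N k :
  w (N + k)%N - w N = \sum_(i < k) (w (N + i).+1 - w (N + i)%N).
Proof.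
elim: k => [|k ih]; first by rewrite big_ord0 addn0 subrr.
by rewrite big_ord_recr/= -ih addnS; ring.
Qed.

Lemma nat_ge (x : R) : exists n : nat, x <= n%:R.
Proof.
by exists (Num.bound `|x|); rewrite (le_trans (ler_norm _))// ltW// archi_boundP.
Qed.

Lemma divn_succ_bounds (N q : nat) : (0 < q)%N -> (q <= N)%N ->
  (N%:R / q%:R <= (N %/ q).+1%:R :> R) /\ ((N %/ q).+1%:R <= 2 * N%:R / q%:R :> R).
Proof.
move=> q0 qN; have q0' : 0 < q%:R :> R by rewrite ltr0n.
rewrite ler_pdivrMr// ler_pdivlMr// -!natrM !ler_nat; split.
  by rewrite ltnW// ltn_ceil.
by have := leq_trunc_div N q; rewrite mulSn; lia.
Qed.

Lemma increments_bound (N i k : nat) : (i < k)%N -> (k <= N)%N -> ((N + i).+1 <= 3 * N)%N.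
Proof. lia. Qed.

Lemma increments_bound2 (N q N0 : nat) : (3 <= q)%N -> (q + 3 * N0 + 1 <= N)%N ->
  (N0 <= N - (N %/ q).+1)%N.
Proof.
move=> q3 h; have h2 := leq_trunc_div N q.
have : (3 * (N %/ q) <= N)%N by rewrite (leq_trans _ h2)// mulnC leq_mul2l q3 orbT.
lia.
Qed.

(** Here [x] is [N] and [y] the window length; the 5 bounds (x + y)^2 + x^2 by 5 x^2 for y <= x. One
    contradiction serves both windows. *)
Lemma increments_absurd (x y v e e' q : R) :
  0 < x -> 0 < y -> y <= x -> x <= y * q -> 0 < e -> 0 < e' ->
  v * y <= x * e -> 10 * (e' * q) = e ->
  y * x * e <= v * (y * y) / 2 + e' * (5 * (x * x)) / 2 -> False.
Proof.
move=> x0 y0 yx xyq e0 e'0 vy e'q h.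
have f1 : v * (y * y) <= x * e * y by rewrite mulrA ler_pM2r.
have f4 : x * x <= x * (y * q) by rewrite ler_pM2l.
have f6 : e' * (x * x) <= e' * (x * (y * q)) by rewrite ler_pM2l.
have f7 : e' * (x * (y * q)) = x * y * e / 10 by rewrite -e'q; field.
have f8 : 0 < x * y * e by rewrite !mulr_gt0.
move: h f1 f6 f7 f8; lra.
Qed.

Definition quad_near (w : nat -> R) (v e : R) (N0 : nat) :=
  forall n, (N0 <= n)%N -> n%:R ^+ 2 * (v - e) / 2 <= w n <= n%:R ^+ 2 * (v + e) / 2.

(** Over a window of about N / q indices next to [N] the mean increment is N v, up to a curvature
    term of order v N / q and an uncertainty of order e' q N. So [q] is fixed first and [e'] after
    it; some increment is no worse than the mean. The windows after and before [N] give the two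
    conclusions. *)
Lemma increments (v e : R) : 0 <= v -> 0 < e -> exists2 e' : R, 0 < e' &
  forall w N0, quad_near w v e' N0 -> exists N1, forall N, (N1 <= N)%N ->
   (exists n, [/\ (N <= n)%N, (n.+1 <= 3 * N)%N & w n.+1 - w n <= N%:R * (v + e)]) /\
   (exists2 n, (n < N)%N & N%:R * (v - e) <= w n.+1 - w n).
Proof.
move=> v0 e0; have [q0 hq0] := nat_ge (2 * v / e).
(* The [+ 3] keeps the window shorter than [N] and the start [N - k] of the backward one beyond
   [N0]. *)
pose q := (q0 + 3)%N.
have q_gt0 : (0 < q)%N by rewrite /q addn3.
have q3 : (3 <= q)%N by rewrite leq_addl.
have qR : 0 < q%:R :> R by rewrite ltr0n.
have vq : v / q%:R <= e / 2.
  rewrite ler_pdivrMr//.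
  have : 2 * v / e <= q%:R by rewrite (le_trans hq0)// ler_nat leq_addr.
  rewrite ler_pdivrMr//; lra.
pose e' := e / (10 * q%:R).
have e'0 : 0 < e' by rewrite divr_gt0// mulr_gt0.
have e'q : 10 * (e' * q%:R) = e by rewrite /e'; field; rewrite gt_eqF.
exists e' => // w N0 hw; exists (q + 3 * N0 + 1)%N => N hN.
have qN : (q <= N)%N by rewrite (leq_trans _ hN)// -addnA leq_addr.
have N_gt0 : (0 < N)%N by rewrite (leq_trans _ qN).
have N0N : (N0 <= N)%N by rewrite (leq_trans (increments_bound2 q3 hN))// leq_subr.
have N0' : 0 < N%:R :> R by rewrite ltr0n.
have [] := divn_succ_bounds q_gt0 qN.
set k := (N %/ q).+1 => k1 k2.
have kN : (k <= N)%N.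
  by rewrite /k ltn_divLR// -[ltnLHS]muln1 ltn_pmul2l// (leq_trans _ q3).
have k0 : 0 < k%:R :> R by rewrite ltr0n.
have kN' : k%:R <= N%:R :> R by rewrite ler_nat.
have Nqk : N%:R <= k%:R * q%:R :> R by rewrite -ler_pdivrMr.
have vk : v * k%:R <= N%:R * e.
  rewrite (le_trans (ler_wpM2l v0 k2))//.
  rewrite (_ : v * _ = 2 * N%:R * (v / q%:R)); last by ring.
  rewrite (_ : _ * e = 2 * N%:R * (e / 2)); last by field.
  by rewrite ler_pM2l// mulr_gt0.
split.
- apply: contrapT => hn.
  have hinc i : (i < k)%N -> N%:R * (v + e) < w (N + i).+1 - w (N + i)%N.
    move=> ik; rewrite ltNge; apply/negP => h; apply: hn; exists (N + i)%N.
    by split => //; [exact: leq_addr|exact: increments_bound ik kN].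
  have : k%:R * (N%:R * (v + e)) <= w (N + k)%N - w N.
    rewrite sum_increments mulr_natl -[k in _ *+ k]card_ord -sumr_const.
    by apply: ler_sum => i _; rewrite ltW// hinc.
  have /andP[_ h1] := hw (N + k)%N (leq_trans N0N (leq_addr _ _)).
  have /andP[h2 _] := hw N N0N.
  move: h1 h2; rewrite natrD; set x := N%:R in N0' Nqk vk kN' *; set y := k%:R in k0 Nqk vk kN' * => h1 h2 h3.
  apply: (@increments_absurd x y v e e' q%:R) => //.
  have f2 : y * y <= x * x by rewrite ler_pM// ltW.
  have f3 : x * y <= x * x by rewrite ler_pM2l.
  have f5 : e' * ((x + y) * (x + y) + x * x) <= e' * (5 * (x * x)).
    by rewrite ler_pM2l//; move: f2 f3; lra.
  move: h1 h2 h3 f5; rewrite !expr2; lra.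
- apply: contrapT => hn; pose M := (N - k)%N.
  have MN : (M + k = N)%N by rewrite subnK.
  have hinc i : (i < k)%N -> w (M + i).+1 - w (M + i)%N < N%:R * (v - e).
    move=> ik; rewrite ltNge; apply/negP => h; apply: hn; exists (M + i)%N => //.
    by rewrite -MN ltn_add2l.
  have : w N - w M <= k%:R * (N%:R * (v - e)).
    have -> : w N = w (M + k)%N by rewrite MN.
    rewrite sum_increments mulr_natl -[k in _ *+ k]card_ord -sumr_const.
    by apply: ler_sum => i _; rewrite ltW// hinc.
  have N3M : (N0 <= M)%N by exact: increments_bound2.
  have /andP[h1 _] := hw N N0N.
  have /andP[_ h2] := hw M N3M.
  have MR : M%:R = N%:R - k%:R :> R by rewrite /M natrB.
  move: h1 h2; rewrite MR; set x := N%:R in N0' Nqk vk kN' MR *; set y := k%:R in k0 Nqk vk kN' MR * => h1 h2 h3.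
  apply: (@increments_absurd x y v e e' q%:R) => //.
  have f2 : y * y <= x * x by rewrite ler_pM// ltW.
  have f3 : x * y <= x * x by rewrite ler_pM2l.
  have f5 : e' * ((x - y) * (x - y) + x * x) <= e' * (5 * (x * x)).
    rewrite ler_pM2l//; have xy0 : 0 < x * y by rewrite mulr_gt0.
    by move: f2 f3 xy0; lra.
  move: h1 h2 h3 f5; rewrite !expr2; lra.
Qed.

(** Squaring exp y >= 1 + y at y = N e / 2 gives quadratic growth. It absorbs the factors that are
    constant or linear in [N]. *)
Lemma expR_beats_linear (e c : R) : 0 < e -> 0 < c ->
  exists N0, forall N, (N0 <= N)%N -> N%:R / c <= expR (N%:R * e).
Proof.
move=> e0 c0; have [N0 hN0] := nat_ge (4 / (c * e ^+ 2)).
exists N0.+1 => N hN; have N1 : 0 < N%:R :> R by rewrite ltr0n; lia.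
have h : expR (N%:R * e) = expR (N%:R * e / 2) ^+ 2 by rewrite -expRM_natl; congr expR; field.
rewrite h (@le_trans _ _ ((N%:R * e / 2) ^+ 2))//; last first.
  have h0 : 0 <= N%:R * e / 2 by rewrite divr_ge0// mulr_ge0// ltW.
  by rewrite ler_pXn2r ?nnegrE ?expR_ge0// (le_trans _ (expR_ge1Dx _))// lerDr.
have ce : 0 < c * e ^+ 2 by rewrite mulr_gt0// exprn_gt0.
have : 4 / (c * e ^+ 2) <= N%:R by rewrite (le_trans hN0)// ler_nat ltnW.
rewrite ler_pdivrMr// => h4.
rewrite ler_pdivrMr// (_ : _ * c = N%:R * (N%:R * (c * e ^+ 2)) / 4); last by field.
by rewrite ler_pdivlMr// ler_pM2l.
Qed.

Lemma cvg_root (a : nat -> \bar R) (v : R) :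
  (forall e, 0 < e -> exists N0, forall N, (N0 <= N)%N ->
    ((expR (- (N%:R * (v + e))))%:E <= a N <= (expR (- (N%:R * (v - e))))%:E)%E) ->
  (fun n : nat => poweR (a n.+1) (n.+1%:R)^-1) @ \oo --> (expR (- v))%:E.
Proof.
move=> h.
have key e : 0 < e -> exists N0, forall n, (N0 <= n)%N ->
    ((expR (- (v + e)))%:E <= poweR (a n.+1) (n.+1%:R)^-1 <= (expR (- (v - e)))%:E)%E.
  move=> e0; have [N0 hN0] := h _ e0; exists N0 => n hn.
  have /andP[h1 h2] := hN0 n.+1 (leqW hn).
  have n0 : 0 < n.+1%:R :> R by [].
  have E (x : R) : (expR x)%:E = poweR (expR (n.+1%:R * x))%:E (n.+1%:R)^-1.
    by rewrite poweR_EFin /powR gt_eqF ?expR_gt0// expRK mulKf// gt_eqF.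
  have i0 : 0 <= (n.+1%:R)^-1 :> R by rewrite invr_ge0.
  have p1 : ((expR (n.+1%:R * - (v + e)))%:E \in `[0%E, +oo%E])%E.
    by rewrite in_itv/= leey lee_fin expR_ge0.
  have p2 : ((expR (n.+1%:R * - (v - e)))%:E \in `[0%E, +oo%E])%E.
    by rewrite in_itv/= leey lee_fin expR_ge0.
  have p3 : (a n.+1 \in `[0%E, +oo%E])%E.
    by rewrite in_itv/= leey (le_trans _ h1)// lee_fin expR_ge0.
  by rewrite (E (- (v + e))) (E (- (v - e))); apply/andP; split; apply: gt0_ler_poweR => //; rewrite mulrN.
apply/fine_cvgP; split.
  have [N0 hN0] := key 1 ltr01; exists N0 => // n /= /hN0 /andP[h1 h2].
  rewrite fin_numE; apply/andP; split.
    by rewrite gt_eqF// (lt_le_trans _ h1)// ltNyr.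
  by rewrite lt_eqF// (le_lt_trans h2)// ltry.
apply/cvgrPdist_le => d d0.
have /cvgrPdist_le/(_ _ d0)/nbhs_ballP[r /= r0 hr] := @continuous_expR R (- v).
have r20 : 0 < r / 2 by rewrite divr_gt0.
have [N0 hN0] := key _ r20; exists N0 => // n /= /hN0.
case: (poweR _ _) => [x| |] /andP[] //; rewrite !lee_fin => x1 x2.
have b1 : ball (- v) r (- (v + r / 2)).
  by rewrite -ball_normE/= opprK addrC addrAC subrr add0r gtr0_norm// ltr_pdivrMr// ltr_pMr// ltr1n.
have b2 : ball (- v) r (- (v - r / 2)).
  rewrite -ball_normE/= opprK (_ : - v + (v - r / 2) = - (r / 2)); last by ring.
  by rewrite normrN gtr0_norm// ltr_pdivrMr// ltr_pMr// ltr1n.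
have := hr _ b1; have := hr _ b2; rewrite !ler_norml => /andP[? ?] /andP[? ?].
by apply/andP; split => /=; lra.
Qed.

End Increments.

(** * Asymptotics of the approximation numbers *)

Section Asymptotics.
Variables (R : realType) (p : R) (phi : R[i] -> R[i]).
Hypothesis p1 : 1 <= p.
Hypothesis hphi : holo_in 1 phi.
Hypothesis phi1 : forall x, cabs x < 1 -> cabs (phi x) < 1.
Local Notation E := (phi @` disk).
Local Notation a := (approx_num p (compo phi)).

Lemma approx_num_antitone m n : (m <= n)%N -> (a n <= a m)%E.
Proof.
move=> mn; apply: ereal_inf_le_tmp => _ [S [h1 [h2 [k [km h3]]]] <-].
exists S => //; split => //; split => //; exists k; split => //.
exact: leq_trans km mn.
Qed.

Lemma hardy_cst (c : R[i]) : hardy p (fun=> c).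
Proof.
have hc : holo_in 1 (fun=> c) by move=> z _; exact: complex_derivable_cst.
split; first exact/holo_on_diskP.
by apply: le_lt_trans (hp_norm_le p1 (cabs_ge0 c) hc _) (ltry _).
Qed.

Lemma hp_norm0 : hp_norm p (fun=> 0 : R[i]) = 0%E.
Proof.
apply/eqP; rewrite eq_le hp_norm_ge0 andbT.
have hc : holo_in 1 (fun=> 0 : R[i]) by move=> z _; exact: complex_derivable_cst.
by apply: hp_norm_le => // z _; rewrite cabs0.
Qed.

Lemma approx_num_ge0 n : (0 <= a n)%E.
Proof.
apply: le_ereal_inf_tmp => _ [S _ <-].
apply: (@le_trans _ _ (hp_norm p (fun z => compo phi (fun=> 0 : R[i]) z - S (fun=> 0 : R[i]) z))).
  exact: hp_norm_ge0.
apply: ereal_sup_ubound; exists (fun=> 0 : R[i]) => //; split; first exact: hardy_cst.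
by rewrite hp_norm0.
Qed.

(** Approximation by the zero operator, whose error is bounded by subordination. For [n = 0] there
    is no admissible operator and the infimum is +oo. *)
Lemma approx_num_bounded n : (0 < n)%N -> (a n <= (4 / (1 - cabs (phi 0)))%:E)%E.
Proof.
move=> n0; apply: (@le_trans _ _ (opnorm_diff p (compo phi) (fun _ _ => 0 : R[i]))).
  apply: ereal_inf_lbound; exists (fun _ _ => 0 : R[i]); last exact: erefl.
  split.
    by move=> f _; exact: hardy_cst.
  split; first by move=> *; rewrite mulr0 addr0.
  exists 0%N; split => //; exists (fun _ _ => 0 : R[i]); split; first by move=> i; exact: hardy_cst.
  by move=> f _; exists (fun=> 0) => z _; rewrite big_ord0.
apply: ge_ereal_sup => _ [f [[/holo_on_diskP hf _] f1] <-].
rewrite (_ : (fun z => _) = compo phi f); last by apply/funext => z; rewrite subr0.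
exact: hp_norm_compo.
Qed.

End Asymptotics.

Lemma fekete_mono (R : realType) (A B : set R[i]) n : A `<=` B -> B `<=` disk ->
  0 < fekete n A -> fekete n A <= fekete n B.
Proof.
move=> AB B1 A0; apply: ge_sup.
  apply: contrapT => /set0P/negP/negPn/eqP h.
  by move: A0; rewrite /fekete h sup0 ltxx.
by move=> _ [z hz <-]; apply: fekete_prod_le => // i i_n; apply: AB; exact: hz.
Qed.

(** * Rates for a nonconstant symbol *)

Section NonConstant.
Variables (R : realType) (p : R) (phi : R[i] -> R[i]).
Hypothesis p1 : 1 <= p.
Hypothesis hphi : holo_in 1 phi.
Hypothesis phi1 : forall x, cabs x < 1 -> cabs (phi x) < 1.
Local Notation E := (phi @` disk).
Local Notation a := (approx_num p (compo phi)).

Variables b1 b2 : R[i].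
Hypothesis b1D : cabs b1 < 1.
Hypothesis b2D : cabs b2 < 1.
Hypothesis b12 : phi b1 != phi b2.

Let k1 := rho (phi b1) (phi b2) / 2.

Let k10 : 0 < k1.
Proof. by rewrite divr_gt0// rho_gt0// phi1. Qed.

(** By the triangle inequality no point is closer than half of their distance to both [phi b1] and
    [phi b2]. *)
Let diam c : cabs c < 1 -> exists2 b, cabs b < 1 & k1 <= rho (phi b) (phi c).
Proof.
move=> c1; have t := rho_triangle (phi1 c1) (phi1 b1D) (phi1 b2D).
have [h|h] := leP k1 (rho (phi b1) (phi c)); first by exists b1.
exists b2 => //; rewrite rhoC; move: t h; rewrite /k1; lra.
Qed.

Lemma green_V_near (e : R) : 0 < e -> exists C : R, forall n (z : nat -> R[i]),
  (forall i, E (z i)) ->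
  (forall i j, (i <= n)%N -> (j <= n)%N -> i != j -> z i != z j) ->
  (green_V E <= ((1 + e) * (- 2 * ln (fekete_prod n.+1 z)) / n.+1%:R ^+ 2 +
     e + C / n.+1%:R)%:E)%E.
Proof. exact: (green_V_le hphi phi1 k10 diam). Qed.

(** A single smeared point already has finite energy: the case [n = 0] of [green_V_near], where
    distinctness is vacuous. *)
Lemma green_V_fin : exists2 v : R, 0 <= v & green_V E = v%:E.
Proof.
have V0 : (0 <= green_V E)%E.
  apply: le_ereal_inf_tmp => _ [mu [Q [cQ [QE muQ]]] <-].
  rewrite (energyE cQ _ muQ); last by move=> x /QE[c c1 <-]; exact: phi1.
  apply: integral_ge0 => u _; apply: integral_ge0 => w _; exact: disk_green_ge0.
have [C hC] := green_V_near (@ltr01 R).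
have Vy : (green_V E < +oo)%E.
  apply: le_lt_trans (hC 0%N (fun=> phi b1) _ _) (ltry _).
    by move=> _; exists b1.
  by move=> i j; rewrite !leqn0 => /eqP -> /eqP ->; rewrite eqxx.
exists (fine (green_V E)); first by rewrite fine_ge0.
by rewrite fineK// ge0_fin_numE.
Qed.

Variable v : R.
Hypothesis v0 : 0 <= v.
Hypothesis Vv : green_V E = v%:E.

Let E1 : E `<=` disk.
Proof. by move=> _ [x x1 <-]; exact: phi1. Qed.

Let Er r := phi @` [set x | cabs x <= r].

Let Er_sub r : r < 1 -> Er r `<=` E.
Proof. by move=> r1 _ [x xr <-]; exists x => //; exact: le_lt_trans xr r1. Qed.

Let E_neq0 : E !=set0.
Proof. by exists (phi b1); exists b1. Qed.

Lemma fekete_le (e : R) : 0 < e -> exists N0, forall n, (N0 <= n)%N ->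
  fekete n E <= expR (- (n%:R ^+ 2 * (v - e) / 2)).
Proof.
(* Then e' (1 + v) = e / 2, which gives (1 + e') (v - e) <= v - e' - e / 2. *)
move=> e0; pose e' := e / (2 * (1 + v)).
have v1 : 0 < 1 + v by rewrite ltr_wpDr.
have e'0 : 0 < e' by rewrite divr_gt0// mulr_gt0.
have [C hC] := green_V_near e'0.
have [N0 hN0] := nat_ge (2 * C / e).
exists N0.+1 => -[//|n] hn.
have n0 : 0 < n.+1%:R :> R by [].
have CN : C / n.+1%:R <= e / 2.
  have : 2 * C / e <= n.+1%:R by rewrite (le_trans hN0)// ler_nat ltnW.
  rewrite !ler_pdivrMr//; lra.
have ne : fekete_set n.+1 E !=set0.
  by have [y Ey] := E_neq0; exists (fekete_prod n.+1 (fun=> y)); exists (fun=> y).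
apply: ge_sup => // _ [z hz <-].
(* [green_V_near] wants every index to land in the image, also those that the product ignores. *)
pose z' i := if (i <= n)%N then z i else phi b1.
have -> : fekete_prod n.+1 z = fekete_prod n.+1 z'.
  by apply: eq_fekete_prod => i; rewrite ltnS /z' => ->.
have Ez' i : E (z' i).
  by rewrite /z'; case: ifPn => [i_n|_]; [apply: hz|exists b1].
have [P0|P0] := leP (fekete_prod n.+1 z') 0.
  by rewrite (le_trans P0)// expR_ge0.
have dz i j : (i <= n)%N -> (j <= n)%N -> i != j -> z' i != z' j.
  move=> i_n jn; wlog ij : i j i_n jn / (i < j)%N.
    by move=> h; rewrite neq_ltn => /orP[ij|ij]; [|rewrite eq_sym]; apply: h => //; rewrite neq_ltn ij.
  move=> _; apply/eqP => zij; move: P0; rewrite /fekete_prod.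
  rewrite (bigD1 (Ordinal (jn : (j < n.+1)%N)))//= (bigD1 (Ordinal ij))//= zij rhozz.
  by rewrite !mul0r ltxx.
have := hC n z' Ez' dz; rewrite Vv lee_fin.
rewrite -[X in X <= expR _](lnK P0) ler_expR.
set l := ln _ => h.
have e1 : 0 < 1 + e' by rewrite addr_gt0.
have ee : e' * (1 + v) = e / 2 by rewrite /e'; field; rewrite gt_eqF.
have n2 : 0 < n.+1%:R ^+ 2 :> R by rewrite exprn_gt0.
have h2 : v - e' - e / 2 <= (1 + e') * (- 2 * l) / n.+1%:R ^+ 2.
  by move: h CN; move: (C / _) (_ / _ ^+ 2) => x y; lra.
have h3 : (1 + e') * (v - e) <= v - e' - e / 2.
  have : 0 < e' * e by rewrite mulr_gt0.
  by move: ee; lra.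
have : (1 + e') * (v - e) <= (1 + e') * (- 2 * l / n.+1%:R ^+ 2).
  by rewrite mulrA (le_trans h3).
rewrite ler_pM2l// ler_pdivlMr//; lra.
Qed.

(** [fekete_ge] at the level v + e / 2 supplies the radius [r]; the opposite bound comes from
    [fekete_le] on the larger set [E]. *)
Lemma fekete_quad (e : R) : 0 < e -> exists2 r, r < 1 &
  (forall n, 0 < fekete n (Er r)) /\
  exists N0, quad_near (fun n => - ln (fekete n (Er r))) v e N0.
Proof.
move=> e0; have e20 : 0 < e / 2 by rewrite divr_gt0.
have [|r r1 hr] := @fekete_ge _ _ hphi phi1 (v + e / 2).
  by rewrite Vv lte_fin ltrDl.
have pos n : 0 < fekete n (Er r) by exact: lt_le_trans (expR_gt0 _) (hr n).
exists r => //; split => //.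
(* From n >= 4 / e on, n^2 e / 4 >= 1 absorbs the [+ 1] in the exponent of [fekete_ge]. *)
have [N1 hN1] := fekete_le e0; have [N2 hN2] := nat_ge (4 / e).
exists (N1 + N2 + 1)%N => n hn; apply/andP; split.
  rewrite lerNr -ler_expR lnK ?posrE//.
  apply: le_trans (hN1 n _); last by rewrite (leq_trans _ hn)// -addnA leq_addr.
  by apply: fekete_mono => //; exact: Er_sub.
have -> : n%:R ^+ 2 * (v + e) / 2 = - ln (expR (- (n%:R ^+ 2 * (v + e) / 2))).
  by rewrite expRK opprK.
rewrite lerN2 ler_ln ?posrE ?expR_gt0// (le_trans _ (hr n))// ler_expR lerN2.
have n1 : (0 < n)%N by rewrite (leq_trans _ hn)// addn1.
have nR : 1 <= n%:R :> R by rewrite ler1n.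
have ne : 4 <= n%:R * e.
  rewrite -ler_pdivrMr// (le_trans hN2)// ler_nat (leq_trans _ hn)//.
  by rewrite -addnA addnCA leq_addr.
have n2e : n%:R * e <= n%:R ^+ 2 * e.
  by rewrite expr2 ler_pM2r// ler_peMl// (le_trans ler01).
have c2 : 'C(n, 2)%:R <= n%:R ^+ 2 / 2 :> R.
  rewrite ler_pdivlMr// -natrM -natrX ler_nat bin2 muln2.
  apply: (@leq_trans (n * n.-1)%N).
    by rewrite -[leqRHS]odd_double_half leq_addl.
  by rewrite -mulnn leq_mul2l leq_pred orbT.
have ve : 0 <= v + e / 2 by rewrite addr_ge0// ltW.
have := ler_wpM2r ve c2; lra.
Qed.

Lemma approx_num_lower (e : R) : 0 < e -> exists N0, forall N, (N0 <= N)%N ->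
  ((expR (- (N%:R * (v + e))))%:E <= a N)%E.
Proof.
move=> e0; have e20 : 0 < e / 2 by rewrite divr_gt0.
have [e' e'0 hinc] := increments v0 e20.
have [r r1 [pos [N1 hq]]] := fekete_quad e'0.
have [N2 hN2] := hinc _ _ hq.
(* 1/24 collects the 1/2 of [fekete_separated], the 1/4 of [approx_num_ge], and n + 1 <= 3 N. *)
pose c := (1 - r) / 24.
have c0 : 0 < c by rewrite divr_gt0// subr_gt0.
have [N3 hN3] := expR_beats_linear e20 c0.
exists (N2 + N3 + 1)%N => N hN.
have NN2 : (N2 <= N)%N by rewrite (leq_trans _ hN)// -addnA leq_addr.
have NN3 : (N3 <= N)%N by rewrite (leq_trans _ hN)// -addnA addnCA leq_addr.
have N0 : (0 < N)%N by rewrite (leq_trans _ hN)// addn1.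
have [[n [Nn n3N wn]] _] := hN2 N NN2.
apply: le_trans (approx_num_antitone p phi (leqW Nn)).
have Er1 : Er r `<=` disk by move=> x /(Er_sub r1)/E1.
have [z hz nz] := @fekete_near _ _ Er1 n.+1 (pos n.+1).
have /choice[c' hc'] : forall i, exists x, (i <= n)%N -> cabs x <= r /\ phi x = z i.
  move=> i; have [i_n|_] := leqP i n; last by exists 0.
  by have [x xr xz] := hz i i_n; exists x.
pose del := fekete n.+1 (Er r) / fekete n (Er r) / 2.
have del0 : 0 < del by rewrite !divr_gt0.
have := @approx_num_ge R p phi r del n c' p1 hphi phi1 r1.
move=> /(_ (fun j jn => (hc' j jn).1) del0) h.
apply: le_trans (h _); last first.
  move=> j jn; rewrite (hc' j jn).2.
  rewrite (_ : \prod_(i < n) _ = \prod_(i < n) rho (z j) (z (bump j i))).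
    exact: fekete_separated.
  apply: eq_bigr => i _; congr (rho _ _); apply: (hc' _ _).2.
  by rewrite /bump; case: (j <= i)%N; rewrite ?add1n ?add0n// ltnW.
have dE : del = expR (- (- ln (fekete n.+1 (Er r)) - - ln (fekete n (Er r)))) / 2.
  by rewrite /del opprB opprK [_ + ln _]addrC expRD expRN !lnK// posrE.
rewrite lee_fin dE.
have n1 : 0 < n.+1%:R :> R by [].
have NR : 0 < N%:R :> R by rewrite ltr0n.
apply: (@le_trans _ _ (expR (- (N%:R * (v + e / 2))) / 2 / (3 * N%:R) * ((1 - r) / 4))); last first.
  rewrite ler_pM2r ?divr_gt0 ?subr_gt0// ler_pM ?divr_ge0 ?expR_ge0 ?invr_ge0 ?mulr_ge0//.
    by rewrite ler_pM2r ?invr_gt0// ler_expR lerN2.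
  by rewrite lef_pV2 ?posrE ?mulr_gt0// -natrM ler_nat.
have -> : - (N%:R * (v + e)) = - (N%:R * (v + e / 2)) + - (N%:R * (e / 2)) by field.
rewrite expRD -!mulrA ler_pM2l ?expR_gt0// expRN.
have -> : 2^-1 * ((3 * N%:R)^-1 * ((1 - r) / 4)) = (N%:R / c)^-1.
  by rewrite /c; field; rewrite subr_eq0 gt_eqF// gt_eqF.
rewrite lef_pV2 ?posrE ?expR_gt0 ?divr_gt0 ?subr_gt0//; exact: hN3.
Qed.

Lemma approx_num_upper (r0 : R) : r0 < 1 -> (forall x, cabs x < 1 -> cabs (phi x) <= r0) ->
  forall e : R, 0 < e -> exists N0, forall N, (N0 <= N)%N ->
  (a N <= (expR (- (N%:R * (v - e))))%:E)%E.
Proof.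
(* One third of [e] each for the increment, for the Blaschke product on the circle, and for the
   constant 2 / (s - r0). *)
move=> r01 phir e e0; have e30 : 0 < e / 3 by rewrite divr_gt0.
have [e' e'0 hinc] := increments v0 e30.
have r00 : 0 <= r0 by apply: le_trans (cabs_ge0 _) (phir b1 b1D).
have [r r1 [pos [N1 hq]]] := fekete_quad e'0.
have leE n : fekete n (Er r) <= fekete n E.
  by apply: fekete_mono => //; exact: Er_sub.
have posE n : 0 < fekete n E by exact: lt_le_trans (pos n) (leE n).
have [N2 hN2] := fekete_le e'0.
have hqE : quad_near (fun n => - ln (fekete n E)) v e' (N1 + N2)%N.
  move=> n hn; apply/andP; split.
    by rewrite lerNr -ler_expR lnK ?posrE// hN2// (leq_trans _ hn)// leq_addl.
  have /andP[_ h] := hq n (leq_trans (leq_addr _ _) hn).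
  by apply: le_trans h; rewrite lerN2 ler_ln ?posrE.
have [N3 hN3] := hinc _ _ hqE.
pose q := expR (- (e / 3)).
have q0 : 0 < q by exact: expR_gt0.
have q1 : q < 1 by rewrite /q -[ltRHS]expR0 ltr_expR oppr_lt0.
(* Hyperbolic addition: the circle of radius [s] is at pseudo-hyperbolic distance exactly [q] from
   the disk of radius [r0]. *)
pose s := (q + r0) / (1 + q * r0).
have d0 : 0 < 1 + q * r0 by rewrite ltr_wpDr// mulr_ge0// ltW.
have s1 : s < 1.
  rewrite ltr_pdivrMr// mul1r.
  have : 0 < (1 - q) * (1 - r0) by rewrite mulr_gt0 ?subr_gt0.
  lra.
have r0s : r0 < s.
  rewrite ltr_pdivlMr//.
  have : 0 < q * (1 - r0 ^+ 2) by rewrite mulr_gt0// subr_gt0 expr_lt1.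
  rewrite expr2; lra.
have sr : 0 < s - r0 by rewrite subr_gt0.
have sigE : (s - r0) / (1 - s * r0) = q.
  have r2 : 1 - r0 ^+ 2 != 0 by rewrite gt_eqF// subr_gt0 expr_lt1.
  have -> : s - r0 = q * (1 - r0 ^+ 2) / (1 + q * r0).
    by rewrite /s; field; rewrite gt_eqF.
  have -> : 1 - s * r0 = (1 - r0 ^+ 2) / (1 + q * r0).
    by rewrite /s; field; rewrite gt_eqF.
  by field; rewrite r2 gt_eqF.
pose c := (s - r0) / 2.
have c0 : 0 < c by rewrite divr_gt0.
have [N4 hN4] := expR_beats_linear e30 c0.
exists (N3 + N4 + 1)%N => N hN.
have NN3 : (N3 <= N)%N by rewrite (leq_trans _ hN)// -addnA leq_addr.
have NN4 : (N4 <= N)%N by rewrite (leq_trans _ hN)// -addnA addnCA leq_addr.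
have N0 : (0 < N)%N by rewrite (leq_trans _ hN)// addn1.
have [_ [n nN wn]] := hN3 N NN3.
apply: (le_trans (approx_num_antitone p phi nN)).
have [z hz nz] := @fekete_near _ _ E1 n (posE n).
have zr j : (j < n)%N -> cabs (z j) <= r0.
  by move=> jn; have [x x1 <-] := hz j jn; exact: phir.
have := @approx_num_le R p phi r0 s n z p1 hphi phir zr r0s s1
  (2 * (fekete n.+1 E / fekete n E)).
rewrite sigE => h; apply: (le_trans (h _)).
  move=> x x1; apply: blaschke_small => //; by exists x.
rewrite lee_fin.
have fE : fekete n.+1 E / fekete n E = expR (- (- ln (fekete n.+1 E) - - ln (fekete n E))).
  by rewrite opprB opprK [_ + ln _]addrC expRD expRN !lnK// posrE.
have NR : 1 <= N%:R :> R by rewrite ler1n.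
apply: (@le_trans _ _ (2 * expR (- (N%:R * (v - e / 3))) / q ^+ N / (s - r0))).
  rewrite ler_pM2r ?invr_gt0// ler_pM ?invr_ge0 ?exprn_ge0 ?(ltW q0)//.
  - by rewrite mulr_ge0// divr_ge0 ?(ltW (posE _)).
  - by rewrite ler_pM2l// fE ler_expR lerN2.
  - rewrite lef_pV2 ?posrE ?exprn_gt0//; apply: ler_wiXn2l; rewrite ?(ltW q0) ?(ltW q1)//.
    exact: ltnW.
have -> : - (N%:R * (v - e)) = - (N%:R * (v - e / 3)) + N%:R * (e / 3) + N%:R * (e / 3).
  by field.
have qN : (q ^+ N)^-1 = expR (N%:R * (e / 3)).
  by rewrite /q -expRM_natl mulrN expRN invrK.
rewrite qN !expRD [2 * _]mulrC -!mulrA ler_pM2l ?expR_gt0// mulrCA ler_pM2l ?expR_gt0//.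
rewrite (le_trans _ (hN4 N NN4))// /c invf_div.
rewrite [leLHS](_ : _ = 1 * (2 / (s - r0))) ?mul1r// ler_peMl// divr_ge0// ltW//.
Qed.

End NonConstant.

(** * The special cases and the conclusion *)

Section Assembly.
Variables (R : realType) (p : R) (phi : R[i] -> R[i]).
Hypothesis p1 : 1 <= p.
Hypothesis hphi : holo_in 1 phi.
Hypothesis phi1 : forall x, cabs x < 1 -> cabs (phi x) < 1.
Local Notation E := (phi @` disk).
Local Notation a := (approx_num p (compo phi)).

Let disk0 : cabs (0 : R[i]) < 1.
Proof. by rewrite cabs0. Qed.

(** Otherwise image points with moduli tending to 1 would have a cluster point of modulus at least 1
    in the closure. *)
Lemma cclosure_bounded : cclosure E `<=` disk ->
  exists2 r0 : R, r0 < 1 & forall x, cabs x < 1 -> cabs (phi x) <= r0.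
Proof.
move=> clE; apply: contrapT => nr.
have /choice[x hx] : forall m : nat, exists x, cabs x < 1 /\ 1 - m.+1%:R^-1 < cabs (phi x).
  move=> m; apply: contrapT => nx; apply: nr; exists (1 - m.+1%:R^-1).
    by rewrite ltrBlDr ltrDl invr_gt0.
  by move=> x x1; rewrite leNgt; apply/negP => h; apply: nx; exists x.
pose Q : set (R^o * R^o) := `[-1, 1]%classic `*` `[-1, 1]%classic.
have cQ : compact Q by apply: compact_setX; exact: segment_compact.
pose u (m : nat) : R^o * R^o := (complex.Re (phi (x m)), complex.Im (phi (x m))).
have [|y [_ cy]] := cQ (u @ \oo) _.
  exists 0%N => // m _; have c1 := ltW (phi1 (hx m).1).
  by split; rewrite /= in_itv/= -ler_norml;
    [exact: le_trans (le_Re_cabs _) c1|exact: le_trans (le_Im_cabs _) c1].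
have near_y (M : nat) (e : R) : 0 < e ->
    exists2 m, (M <= m)%N & cabs (toC y - phi (x m)) < e.
  move=> e0; have e20 : 0 < e / 2 by rewrite divr_gt0.
  have h1 : (u @ \oo) (u @` [set m | (M <= m)%N]).
    by exists M => // m /= Mm; exists m.
  have h2 : nbhs y (ball y (e / 2)) by exact: nbhsx_ballx.
  have [_ [[m /= Mm <-] [b1 b2]]] := cy _ _ h1 h2.
  exists m => //; apply: le_lt_trans (cabs_le_ReIm _) _.
  rewrite [ltRHS]splitr ltrD//.
    by move: b1; rewrite /= -ball_normE/=; case: (phi (x m)).
  by move: b2; rewrite /= -ball_normE/=; case: (phi (x m)).
have y1 : cabs (toC y) < 1.
  apply: clE => e e0; have [m _ hm] := near_y 0%N e e0.
  by exists (phi (x m)) => //; exists (x m) => //; exact: (hx m).1.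
pose e := (1 - cabs (toC y)) / 2.
have e0 : 0 < e by rewrite divr_gt0// subr_gt0.
have [M _ hM] := near_infty_natSinv_lt (PosNum e0).
have [m Mm hm] := near_y M e e0.
have := hM m Mm => /= h3; have h4 := (hx m).2.
have := ge_cabsB (phi (x m)) (toC y); rewrite cabsBC => h5.
by move: h3 h4 h5 hm; rewrite /e; move: m.+1%:R^-1 => t; lra.
Qed.

(** * Constant symbols *)

Section Constant.
Hypothesis phic : forall x, cabs x < 1 -> phi x = phi 0.

(** All mass sits at a single point, where the Green function is +oo. *)
Lemma green_V_cst : green_V E = +oo%E.
Proof.
apply/eqP; rewrite -leye_eq; apply: le_ereal_inf_tmp => _ [mu [Q [cQ [QE muQ]]] <-].
have QD : toC @` Q `<=` disk by move=> x /QE[c c1 <-]; exact: phi1.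
have mQ := compact_measurable_prod cQ.
have gQ u w : Q u -> Q w -> disk_green (toC u) (toC w) = +oo%E.
  move=> Qu Qw; have [c c1 cu] := QE _ (ex_intro2 _ _ _ Qu erefl).
  have [c' c'1 cw] := QE _ (ex_intro2 _ _ _ Qw erefl).
  rewrite -cu -cw !phic// /disk_green phi1//= /green eqxx//.
have pot u : Q u -> (\int[mu]_w disk_green (toC u) (toC w) = +oo)%E.
  move=> Qu; apply/eqP; rewrite -leye_eq.
  have <- : (\int[mu]_(w in Q) disk_green (toC u) (toC w) = +oo)%E.
    rewrite (eq_integral (cst +oo%E)); last first.
      by move=> w; rewrite inE => Qw; rewrite gQ.
    by rewrite integral_cst// -[LHS]/(+oo * mu Q)%E muQ mule1.
  apply: ge0_subset_integral => //; first exact: measurable_disk_green_snd.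
  by move=> w _; exact: disk_green_ge0.
rewrite (energyE cQ QD muQ) /disk_energy.
have <- : (\int[mu]_(u in Q) (\int[mu]_w disk_green (toC u) (toC w)) = +oo)%E.
  rewrite (eq_integral (cst +oo%E)); last first.
    by move=> u; rewrite inE => Qu; rewrite pot.
  by rewrite integral_cst// -[LHS]/(+oo * mu Q)%E muQ mule1.
apply: ge0_subset_integral => //; first exact: measurable_disk_potential.
by move=> u _; apply: integral_ge0 => w _; exact: disk_green_ge0.
Qed.

Lemma approx_num_cst n : (1 < n)%N -> a n = 0%E.
Proof.
move=> n1; apply/eqP; rewrite eq_le approx_num_ge0// andbT.
apply: (@le_trans _ _ (opnorm_diff p (compo phi) (compo phi))).
  apply: ereal_inf_lbound; exists (compo phi); last exact: erefl.
  split.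
    move=> f [/holo_on_diskP hf _].
    have hc : holo_in 1 (compo phi f).
      move=> z z1; apply: complex_derivable_comp; first exact: hphi.
      exact/hf/phi1.
    split; first exact/holo_on_diskP.
    apply: le_lt_trans (hp_norm_le p1 (cabs_ge0 (f (phi 0))) hc _) (ltry _).
    by move=> z z1; rewrite /compo phic.
  split; first by [].
  exists 1%N; split => //; exists (fun _ _ => 1); split.
    by move=> _; exact: hardy_cst.
  move=> f _; exists (fun=> f (phi 0)) => z z1.
  by rewrite big_ord_recl big_ord0 addr0 mulr1 /compo phic.
apply: ge_ereal_sup => _ [f _ <-].
rewrite (_ : (fun z => _) = (fun=> 0)); last by apply/funext => z; rewrite subrr.
by rewrite hp_norm0.
Qed.

End Constant.

(** * Symbols of sup-norm 1 *)

Section FullDisk.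
Hypothesis sup1 : supnorm_disk phi = 1%E.

Let far (s : R) : s < 1 -> exists2 x, cabs x < 1 & s < cabs (phi x).
Proof.
move=> s1; have : (s%:E < supnorm_disk phi)%E by rewrite sup1 lte_fin.
by move=> /ereal_sup_gt[_ [x x1 <-]]; rewrite lte_fin => sx; exists x.
Qed.

(** (q + m) / (1 + q m) is the hyperbolic sum of the radii: beyond it every point is at distance at
    least [q] from the disk of radius [m]. *)
Lemma rho_far (q m : R) (z w : R[i]) : 0 < q < 1 -> 0 <= m < 1 -> cabs w <= m ->
  cabs z < 1 -> (q + m) / (1 + q * m) < cabs z -> q <= rho z w.
Proof.
move=> /andP[q0 q1] /andP[m0 m1] wm z1 hz.
have w1 : cabs w < 1 by rewrite (le_lt_trans wm).
rewrite (le_trans _ (rho_ge_cabs z1 w1))//.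
have d0 : 0 < 1 - cabs w * cabs z by rewrite subr_gt0 mul_cabs_lt1.
rewrite ler_pdivlMr// (le_trans _ (ler_norm _))//.
have d1 : 0 < 1 + q * m by rewrite ltr_wpDr// mulr_ge0// ltW.
move: hz; rewrite ltr_pdivrMr// => hz.
have qz : 0 <= (m - cabs w) * (1 - q * cabs z).
  by rewrite mulr_ge0 ?subr_ge0// mulr_ile1 ?cabs_ge0 ?(ltW q0) ?(ltW q1) ?(ltW z1).
by move: hz qz; move: (cabs z) (cabs w) => x y; lra.
Qed.

Lemma separated_points (q : R) n : 0 < q < 1 ->
  exists2 z : nat -> R[i], forall i, E (z i) &
    forall i j, (j < i)%N -> (i < n)%N -> q <= rho (z i) (z j).
Proof.
move=> /andP[q0 q1].
(* The induction also carries a bound [m < 1] on the moduli so far, which tells how near to the unit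
   circle the next point must be. *)
suff [z [m [_ Ez _ hz]]] : exists (z : nat -> R[i]) (m : R),
    [/\ 0 <= m < 1, forall i, E (z i), forall j, (j < n)%N -> cabs (z j) <= m &
      forall i j, (j < i)%N -> (i < n)%N -> q <= rho (z i) (z j)].
  by exists z.
elim: n => [|n [z [m [/andP[m0 m1] Ez zm hz]]]].
  by exists (fun=> phi 0), 0; split => //; rewrite lexx ltr01.
have d1 : 0 < 1 + q * m by rewrite ltr_wpDr// mulr_ge0// ltW.
have s1 : (q + m) / (1 + q * m) < 1.
  rewrite ltr_pdivrMr// mul1r.
  have : 0 < (1 - q) * (1 - m) by rewrite mulr_gt0 ?subr_gt0.
  lra.
have ms : m <= (q + m) / (1 + q * m).
  rewrite ler_pdivlMr//.
  have : 0 <= q * (1 - m * m) by rewrite mulr_ge0 ?(ltW q0)// subr_ge0 mulr_ile1// ltW.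
  lra.
have [x x1 sx] := far s1.
exists (fun i => if (i < n)%N then z i else phi x), (cabs (phi x)); split.
- by rewrite cabs_ge0 phi1.
- by move=> i; case: ifP => // _; exists x.
- move=> j _; case: ifP => // jn.
  by rewrite (le_trans (zm j jn))// (le_trans ms)// ltW.
- move=> i j ji; rewrite ltnS leq_eqVlt => /predU1P[i_n|i_n].
    move: ji; rewrite i_n ltnn => jn; rewrite jn; apply: (@rho_far q m) => //;
      [exact/andP|exact/andP|exact: zm|exact: phi1].
  by rewrite i_n (ltn_trans ji i_n); exact: hz.
Qed.

Lemma nonconstant_supnorm1 : exists2 b, cabs b < 1 & phi b != phi 0.
Proof.
have [b b1 hb] := far (phi1 disk0); exists b => //.
by apply: contraTneq hb => ->; rewrite ltxx.
Qed.

(** There are 'C(n, 2) factors; the generous exponent n^2 only changes how close to 1 [q] must be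
    taken. *)
Lemma fekete_prod_ge (q : R) n (z : nat -> R[i]) : 0 < q < 1 ->
  (forall i j, (j < i)%N -> (i < n)%N -> q <= rho (z i) (z j)) ->
  q ^+ (n * n) <= fekete_prod n z.
Proof.
move=> /andP[q0 q1] h.
have cst k (x : R) : x ^+ k = \prod_(i < k) x by rewrite prodr_const card_ord.
rewrite exprM (cst n (q ^+ n)).
apply: ler_prod => i _; rewrite exprn_ge0 ?(ltW q0)//=.
apply: (@le_trans _ _ (q ^+ i)).
  by apply: ler_wiXn2l; rewrite ?(ltW q0) ?(ltW q1)// ltnW.
rewrite (cst i q); apply: ler_prod => j _.
by rewrite (ltW q0) h.
Qed.

Lemma green_V_supnorm1 (v : R) : 0 <= v -> green_V E = v%:E -> v = 0.
Proof.
move=> v0 Vv; have [b b1 bphi] := nonconstant_supnorm1.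
suff h (e : R) : 0 < e -> v <= 3 * e.
  apply/eqP; rewrite eq_le v0 andbT; apply/ler_addgt0Pr => e e0.
  by rewrite add0r (le_trans (h (e / 3) _)) ?divr_gt0// mulrC divfK.
move=> e0.
have [C hC] := green_V_near hphi phi1 b1 disk0 bphi e0.
have [n0 hn0] := nat_ge (C / e).
pose n := n0.+1; have n1 : 0 < n%:R :> R by [].
have Cn : C / n%:R <= e.
  rewrite ler_pdivrMr// mulrC -ler_pdivrMr// (le_trans hn0)// ler_nat.
  exact: leqnSn.
have e1 : 0 < 1 + e by rewrite addr_gt0.
(* Then (1 + e) * 2 * eta = e, so each of the three terms of [green_V_near] is at most [e]. *)
pose eta := e / (2 * (1 + e)).
have eta0 : 0 < eta by rewrite divr_gt0// mulr_gt0.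
have q01 : 0 < expR (- eta) < 1.
  by rewrite expR_gt0 -[ltRHS]expR0 ltr_expR oppr_lt0.
have [z Ez hz] := separated_points n q01.
have := hC n0 z Ez _; rewrite Vv lee_fin => /(_ _)/le_trans; apply.
  move=> i j i_n jn; wlog ij : i j i_n jn / (i < j)%N.
    by move=> h; rewrite neq_ltn => /orP[ij|ij]; [|rewrite eq_sym]; apply: h => //;
      rewrite neq_ltn ij.
  move=> _; apply/eqP => zij; have := hz j i ij jn.
  by rewrite zij rhozz leNgt (andP q01).1.
have h1 : - (n%:R ^+ 2 * eta) <= ln (fekete_prod n z).
  have P0 : expR (- (n%:R ^+ 2 * eta)) <= fekete_prod n z.
    apply: le_trans (fekete_prod_ge q01 hz).
    by rewrite -expRM_natl natrM -expr2 mulrN.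
  by rewrite -[leLHS]expRK ler_ln ?posrE ?expR_gt0// (lt_le_trans (expR_gt0 _) P0).
have n2 : 0 < n%:R ^+ 2 :> R by rewrite exprn_gt0.
have h2 : (1 + e) * (- 2 * ln (fekete_prod n z)) / n%:R ^+ 2 <= e.
  rewrite [leRHS](_ : e = (1 + e) * (2 * (n%:R ^+ 2 * eta)) / n%:R ^+ 2); last first.
    by rewrite /eta; field; rewrite gt_eqF//= gt_eqF.
  rewrite ler_pM2r ?invr_gt0// ler_pM2l//.
  by move: h1; move: (ln _) (_ * eta) => x y; lra.
by move: h2 Cn; rewrite -/n; move: (C / _) (_ / _ ^+ 2) => x y; lra.
Qed.

End FullDisk.

Lemma approx_num_le1 (e : R) : 0 < e -> exists N0, forall N, (N0 <= N)%N ->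
  (a N <= (expR (N%:R * e))%:E)%E.
Proof.
move=> e0; pose c := (1 - cabs (phi 0)) / 4.
have c0 : 0 < c by rewrite divr_gt0// subr_gt0 phi1.
have [N0 hN0] := expR_beats_linear e0 c0.
exists N0.+1 => N hN; have N1 : (0 < N)%N by exact: leq_trans hN.
apply: (le_trans (approx_num_bounded p1 hphi phi1 N1)); rewrite lee_fin.
rewrite (le_trans _ (hN0 N (ltnW hN)))// /c invf_div ler_peMl ?ler1n//.
by rewrite divr_ge0// subr_ge0 ltW// phi1.
Qed.

End Assembly.

Theorem theorem4p1 (R : realType) (p : R) (phi : R[i] -> R[i]) :
  1 <= p -> holo_on_disk phi -> (forall z, cabs z < 1 -> cabs (phi z) < 1) ->
  (cclosure (phi @` disk) `<=` disk ->
     (fun n : nat => poweR (approx_num p (compo phi) n.+1) (n.+1%:R)^-1) @ \oo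
       --> expeR (- (green_cap (phi @` disk))^-1)%E) /\
  (supnorm_disk phi = 1%E ->
     (fun n : nat => poweR (approx_num p (compo phi) n.+1) (n.+1%:R)^-1) @ \oo
       --> 1%E).
Proof.
move=> p1 /holo_on_diskP hphi phi1.
have disk0 : cabs (0 : R[i]) < 1 by rewrite cabs0.
split=> [clE|sup1].
  (* 1 / Cap is the minimal energy itself, also when that is 0 or +oo. *)
  rewrite /green_cap inveK.
  have [[b b1 bphi]|cphi] := pselect (exists2 b, cabs b < 1 & phi b != phi 0).
    have [v v0 Vv] := green_V_fin hphi phi1 b1 disk0 bphi.
    have [r0 r01 phir] := cclosure_bounded phi1 clE.
    rewrite Vv; apply: cvg_root => e e0.
    have [N1 h1] := approx_num_lower p1 hphi phi1 b1 disk0 bphi v0 Vv e0.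
    have [N2 h2] := approx_num_upper p1 hphi phi1 b1 disk0 bphi v0 Vv r01 phir e0.
    exists (maxn N1 N2) => N; rewrite geq_max => /andP[hN1 hN2].
    by rewrite h1// h2.
  have phic x : cabs x < 1 -> phi x = phi 0.
    move=> x1; apply/eqP/negPn/negP => h; apply: cphi; by exists x.
  (* The limit is exp(-oo) = 0, and the terms vanish from index 1 on, where [n.+1] exceeds the rank
     one. *)
  rewrite (green_V_cst phi1 phic); apply: cvg_near_cst; exists 1%N => // n n1.
  by rewrite (approx_num_cst p1 hphi phi1 phic)// poweR0r// invr_neq0// pnatr_eq0.
have [b b1 bphi] := nonconstant_supnorm1 phi1 sup1.
have [v v0 Vv] := green_V_fin hphi phi1 b1 disk0 bphi.
have vE := green_V_supnorm1 hphi phi1 sup1 v0 Vv.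
(* The case V = 0: the general lower estimate applies, and the upper one is mere boundedness of the
   operator. *)
have -> : 1%E = (expR (- 0))%:E :> \bar R by rewrite oppr0 expR0.
apply: cvg_root => e e0.
have [N1 h1] := approx_num_lower p1 hphi phi1 b1 disk0 bphi v0 Vv e0.
have [N2 h2] := approx_num_le1 p1 hphi phi1 e0.
exists (maxn N1 N2) => N; rewrite geq_max => /andP[hN1 hN2].
by rewrite -vE h1//= vE sub0r mulrN opprK h2.
Qed.
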